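(* Let $d \geq 2$ and $m \geq 3$ be integers and let $D \subset \mathbb{R}^d$ be a bounded connected open set of class $C^m$. Then the set of domains $\Omega\in\mathcal{O}^m(D)$ such that $\mathrm{Iso}(\Omega)=\{\mathrm{Id}\}$ is residual in $\mathcal{O}^m(D)$.
   Context: For a vector field $f$ of class $C^m$ on $\mathbb{R}^d$ put $\|f\|_{C^m} := \sum_{|\alpha|\le m} \sup_{x\in\mathbb{R}^d} |\partial^\alpha f(x)|$. Let $C^m_0(\mathbb{R}^d,\mathbb{R}^d)$ be the space of $C^m$ vector fields on $\mathbb{R}^d$ that vanish at infinity for the $C^m$ norm (all derivatives of order at most $m$ tend to $0$ at infinity). Let $\mathrm{Diff}^m_0(\mathbb{R}^d)$ be the group of $C^m$-diffeomorphisms $f$ of $\mathbb{R}^d$ with $f-\mathrm{id} \in C^m_0(\mathbb{R}^d,\mathbb{R}^d)$. Define $\mathcal{O}^m(D) := \{ f(D) : f \in \mathrm{Diff}^m_0(\mathbb{R}^d)\}$, endowed with the Courant--Micheletti distance $$d(\Omega_1,\Omega_2) := \inf \Bigl\{ \sum_{i=1}^N \bigl(\|f_i-\mathrm{id}\|_{C^m} + \|f_i^{-1}-\mathrm{id}\|_{C^m}\bigr) : N\ge 1,\ f_i \in \mathrm{Diff}^m_0(\mathbb{R}^d),\ f_N\circ\cdots\circ f_1(\Omega_1)=\Omega_2 \Bigr\},$$ for which it is a complete separable metric space. $\mathrm{Iso}(\Omega) := \{ S \in \mathrm{Isom}(\mathbb{R}^d) : S(\Omega)=\Omega\}$, where $\mathrm{Isom}(\mathbb{R}^d)$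 is the group of Euclidean isometries $x\mapsto Ax+c$, $A\in O_d(\mathbb{R})$, $c\in\mathbb{R}^d$. A subset of a topological space is residual if it contains a countable intersection of dense open sets. *)

(* Defs.v *)
From HB Require Import structures.
From mathcomp Require Import all_boot all_order all_algebra.
From mathcomp Require Import all_classical all_reals all_analysis.

Set Implicit Arguments.
Unset Strict Implicit.
Unset Printing Implicit Defensive.

Import Order.TTheory GRing.Theory Num.Theory.
Import numFieldNormedType.Exports.

Local Open Scope classical_set_scope.
Local Open Scope ring_scope.

(* The library norm `|x| on 'rV_d is the sup norm; [enorm] is the Euclidean
   one. Both induce the same topology. *)
Definition enorm (R : realType) (d : nat) (x : 'rV[R]_d) : R :=
  Num.sqrt (\sum_(i < d) x 0 i ^+ 2).

Definition partial (R : realType) (d : nat) (V : normedModType R) (i : 'I_d)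
    (f : 'rV[R]_d -> V) : 'rV[R]_d -> V :=
  fun x => 'D_(delta_mx 0 i : 'rV[R]_d) f x.

Fixpoint is_Cm (R : realType) (d : nat) (V : normedModType R) (m : nat)
    (f : 'rV[R]_d -> V) : Prop :=
  continuous f /\
  if m is m'.+1 then
    forall i : 'I_d,
      (forall x, derivable f x (delta_mx 0 i : 'rV[R]_d)) /\
      is_Cm m' (partial i f)
  else True.

(* A multi-index of order at most m has all its entries at most m, so these
   multi-indices are the elements of order at most m of a finite type. *)
Definition multi_index (d m : nat) := {ffun 'I_d -> 'I_m.+1}.

Definition order_mi (d m : nat) (a : multi_index d m) : nat :=
  (\sum_(i < d) a i)%N.

Definition mpartial (R : realType) (d m : nat) (V : normedModType R)
    (a : multi_index d m) (f : 'rV[R]_d -> V) : 'rV[R]_d -> V :=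
  foldr (fun i g => iter (a i) (partial i) g) f (enum 'I_d).

(* [sup] is real-valued, with junk value 0 on unbounded sets; [normCm] is only
   applied to fields in C^m_0, all of whose derivatives are bounded. *)
Definition normCm (R : realType) (d m : nat) (f : 'rV[R]_d -> 'rV[R]_d) : R :=
  \sum_(a : multi_index d m | (order_mi a <= m)%N)
    sup (range (fun x => enorm (mpartial a f x))).

Definition is_Cm0 (R : realType) (d m : nat) (f : 'rV[R]_d -> 'rV[R]_d) :
    Prop :=
  is_Cm m f /\
  forall a : multi_index d m, (order_mi a <= m)%N ->
  forall e : R, 0 < e ->
  exists M : R, forall x, M < enorm x -> enorm (mpartial a f x) < e.

Record Diff0 (R : realType) (d m : nat) := MkDiff0 {
  diff_fun :> 'rV[R]_d -> 'rV[R]_d;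
  diff_inv : 'rV[R]_d -> 'rV[R]_d;
  diff_funK : cancel diff_fun diff_inv;
  diff_invK : cancel diff_inv diff_fun;
  diff_fun_Cm : is_Cm m diff_fun;
  diff_inv_Cm : is_Cm m diff_inv;
  diff_fun_Cm0 : is_Cm0 m (fun x => diff_fun x - x)
}.

Definition orbit_shapes (R : realType) (d m : nat) (D : set 'rV[R]_d) :
    set (set 'rV[R]_d) :=
  [set W | exists f : Diff0 R d m, W = f @` D].

(* [:: f_1; ...; f_N] is sent to f_N \o ... \o f_1. *)
Definition compose_diffs (R : realType) (d m : nat) (fs : seq (Diff0 R d m)) :
    'rV[R]_d -> 'rV[R]_d :=
  foldl (fun (g : 'rV[R]_d -> 'rV[R]_d) (f : Diff0 R d m) => f \o g) id fs.

Definition diff_cost (R : realType) (d m : nat) (f : Diff0 R d m) : R :=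
  normCm m (fun x => f x - x) + normCm m (fun x => diff_inv f x - x).

Definition courant_dist (R : realType) (d m : nat) (W1 W2 : set 'rV[R]_d) : R :=
  inf [set s | exists fs : seq (Diff0 R d m),
    [/\ (0 < size fs)%N, compose_diffs fs @` W1 = W2 &
        s = \sum_(f <- fs) diff_cost f]].

Definition shape_space (R : realType) (d m : nat) (D : set 'rV[R]_d) :=
  set_type (orbit_shapes m D).

HB.instance Definition _ (R : realType) (d m : nat) (D : set 'rV[R]_d) :=
  Choice.on (shape_space m D).

Section shape_topology.
Variables (R : realType) (d m : nat) (D : set 'rV[R]_d).

Definition shape_ball (W : shape_space m D) (e : R) : set (shape_space m D) :=
  [set W' | courant_dist m (val W) (val W') < e].

Definition shape_open (U : set (shape_space m D)) : Prop :=
  forall W, U W -> exists2 e : R, 0 < e & shape_ball W e `<=` U.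

Let shape_openT : shape_open [set: shape_space m D].
Proof. by move=> W _; exists 1. Qed.

Let shape_openI : setI_closed shape_open.
Proof.
move=> U V oU oV W [/oU[e e0 eU] /oV[r r0 rV]].
exists (Num.min e r); first by rewrite lt_min e0.
by move=> W'; rewrite /shape_ball /= lt_min => /andP[/eU ? /rV ?].
Qed.

Let shape_open_bigU (I : Type) (f : I -> set (shape_space m D)) :
  (forall i, shape_open (f i)) -> shape_open (\bigcup_i f i).
Proof.
move=> of_ W [i _ /of_[e e0 ef]].
by exists e => // W' /ef ?; exists i.
Qed.

HB.instance Definition _ :=
  isOpenTopological.Build (shape_space m D)
    shape_openT shape_openI shape_open_bigU.

End shape_topology.

(* In suitable orthonormal coordinates, near each boundary point D is the part
   of space lying strictly above the graph of a C^m function of the other d - 1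
   coordinates ([col' i] deletes the i-th coordinate). *)
Definition Cm_domain (R : realType) (d m : nat) (D : set 'rV[R]_d) : Prop :=
  forall x0, (closure D `\` interior D) x0 ->
  exists (Q : 'M[R]_d) (i : 'I_d) (g : 'rV[R]_d.-1 -> R) (r : R),
    [/\ Q *m Q^T = 1%:M, is_Cm m g, 0 < r &
        forall y, enorm (y - x0) < r ->
          (D y <-> g (col' i (y *m Q)) < (y *m Q) 0 i)].

(* Points are row vectors, so a linear map acts by right multiplication. *)
Definition is_isometry (R : realType) (d : nat) (S : 'rV[R]_d -> 'rV[R]_d) :
    Prop :=
  exists (A : 'M[R]_d) (c : 'rV[R]_d),
    A *m A^T = 1%:M /\ S = fun x => x *m A + c.

Definition Iso (R : realType) (d : nat) (W : set 'rV[R]_d) :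
    set ('rV[R]_d -> 'rV[R]_d) :=
  [set S | is_isometry S /\ S @` W = W].

Definition residual (T : topologicalType) (A : set T) : Prop :=
  exists U : nat -> set T,
    (forall n, open (U n) /\ dense (U n)) /\ \bigcap_n U n `<=` A.

(* Main.v *)
Require Import Defs.
From HB Require Import structures.
From mathcomp Require Import all_boot all_order all_algebra.
From mathcomp Require Import all_classical all_reals all_analysis.
From mathcomp Require Import ring lra zify perm.

(** For a [d.+1]-tuple [X] of points put [Phi X = vol X ^ 2 * spread X], where
    [vol] is the determinant of the simplex and [spread] a weighted sum of its
    squared edge lengths: [Phi] is invariant under isometries.  Let [K] be the
    closure of a domain [W], and let [X] have the largest [|Phigrad X|] among the
    maximizers of [Phi] on tuples of [K].  Moving [W] by [t] times
    [u y = \sum_a b_a y *: Phigrad X a], with [b_a] a bump at the vertex [x_a],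
    raises [Phi] near [X] by [t * |Phigrad X| ^ 2 + o(t)].  By Cauchy-Schwarz and
    the choice of [X] no other maximizer gains as much, so every near-maximizer of
    [Phi] on a domain within [t ^ 2] of the perturbed one tends to [X] as [t] tends
    to 0.  A symmetry of that domain sends near-maximizers to near-maximizers, hence
    almost fixes the vertices of a nondegenerate simplex, and is close to the
    identity.  So the domains all of whose symmetries are [1/n]-close to the
    identity contain a dense open set, for every [n].  The limits as [t] tends to 0
    are taken along an ultrafilter on the integers. *)

Set Implicit Arguments.
Unset Strict Implicit.
Unset Printing Implicit Defensive.

Import Order.TTheory GRing.Theory Num.Theory.
Import numFieldNormedType.Exports.

Local Open Scope classical_set_scope.
Local Open Scope ring_scope.

(** * Matrices, lines and the mean value inequality *)

(** Maximizers of [Phi] are in general far from unique: every symmetry of [W] permutes them. Nothing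
    is known about the unperturbed domain, so the perturbation itself has to single out one
    maximizer to first order in [t]. The factor [vol X ^ 2] keeps the maximizing simplices
    nondegenerate, so that an isometry, reflections included, is determined by its values at the
    vertices. The weights of [spread] deal with the remaining ambiguity, a relabelling of the
    vertices of [X]; excluding it takes three vertices, hence [d >= 2]. Domains are open: a maximum
    lives on the closure and only near-maximizers are at hand. The tolerance [t ^ 2], both for
    near-maximality and for neighbouring domains, is negligible against gains of order [t]; this is
    why a whole ball around the perturbed domain is controlled. The analytic cost is to realise the
    field by diffeomorphisms which, with their inverses, are O(t)-close to the identity in C^m. One
    shear per vertex, each along a fixed direction, reduces the inversion to one scalar equation. *)

Lemma ler_mx_entry (R : realType) (m n : nat) (M : 'M[R]_(m, n)) i j :
  `|M i j| <= `|M|.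
Proof. by rewrite [leRHS]/Num.norm /= mx_normrE; apply/bigmax_geP; right => /=; exists (i, j). Qed.

Lemma mx_norm_ler (R : realType) (m n : nat) (M : 'M[R]_(m, n)) (c : R) :
  0 <= c -> (forall i j, `|M i j| <= c) -> `|M| <= c.
Proof.
move=> c0 Mc; rewrite [leLHS]/Num.norm /= mx_normrE.
by apply/bigmax_leP; split => // -[i j] _ /=.
Qed.

Lemma cvg_mxP (R : realType) (T : Type) (F : set_system T) {FF : Filter F} (m n : nat)
    (f : T -> 'M[R]_(m, n)) (M : 'M[R]_(m, n)) :
  (forall i j, (fun t => f t i j) @ F --> M i j) <-> f @ F --> M.
Proof.
split=> [H|H i j]; last first.
  exact: (cvg_comp _ _ H (@coord_continuous R m n i j M)).
apply/cvgrPdist_le => e e0.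
have : \forall t \near F, forall i j, `|M i j - f t i j| <= e.
  apply: filter_forall => i; apply: filter_forall => j.
  by move/cvgrPdist_le: (H i j); apply.
apply: filterS => t ht; apply: mx_norm_ler; first exact: ltW.
by move=> i j; rewrite !mxE.
Qed.

Section line.
Variables (R : realType) (V W : normedModType R).

Lemma is_derive_line (f : V -> W) (x v : V) (a : R) : derivable f (a *: v + x) v ->
  is_derive a 1 (fun s : R => f (s *: v + x)) ('D_v f (a *: v + x)).
Proof.
have E : (fun h : R => h^-1 *: (((fun s : R => f (s *: v + x)) \o shift a) (h *: 1) -
    f (a *: v + x)))
  = (fun h : R => h^-1 *: ((f \o shift (a *: v + x)) (h *: v) - f (a *: v + x))).
  by apply/funext => h /=; rewrite [h *: 1]mulr1 scalerDl addrA.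
move=> df; split.
  by rewrite /derivable E.
by rewrite /derive E.
Qed.

End line.

Section mvt.
Variables (R : realType).

Lemma line_mvt (V : normedModType R) (f : V -> R) (x v : V) (s : R) :
  (forall y, derivable f y v) ->
  exists2 c : R, `|c| <= `|s| & f (x + s *: v) - f x = s * 'D_v f (x + c *: v).
Proof.
move=> df; pose g (u : R) := f (u *: v + x).
have dg (u : R) : is_derive u 1 g ('D_v f (u *: v + x)) by exact: is_derive_line.
have cg (A : set R) : {within A, continuous g}.
  apply: continuous_subspaceT => u.
  by apply: differentiable_continuous; apply/derivable1_diffP; case: (dg u).
case: (ltrgtP s 0) => s0.
- have [c cs E] := @MVT R g (fun u => 'D_v f (u *: v + x)) s 0 s0 (fun u _ => dg u) (cg _).
  exists c.
    move: cs; rewrite in_itv /= => /andP[h1 h2].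
    by rewrite ltr0_norm // ltr0_norm // lerN2 ltW.
  move: E; rewrite /g scale0r add0r sub0r [_ + x]addrC [_ + x]addrC => E.
  by apply: oppr_inj; rewrite opprB E; ring.
- have [c cs E] := @MVT R g (fun u => 'D_v f (u *: v + x)) 0 s s0 (fun u _ => dg u) (cg _).
  exists c.
    move: cs; rewrite in_itv /= => /andP[h1 h2].
    by rewrite gtr0_norm // gtr0_norm // ltW.
  move: E; rewrite /g scale0r add0r subr0 [_ + x]addrC [_ + x]addrC => ->.
  by rewrite mulrC.
- exists 0; first by rewrite normr0.
  by rewrite s0 scale0r addr0 subrr mul0r.
Qed.

Variables (d : nat).
Local Notation E_ i := (delta_mx 0 i : 'rV[R]_d).

(** Walk from [x] to [x + h] along edges of the box, one coordinate at a time, and use the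
    one-variable mean value theorem on each leg. Only derivatives along coordinate vectors enter,
    which is all that [is_Cm] provides. *)
Lemma box_mvt (f : 'rV[R]_d -> R) (x h : 'rV[R]_d) :
  (forall i y, derivable f y (E_ i)) ->
  exists2 z : 'I_d -> 'rV[R]_d, (forall i, `|z i - x| <= `|h|) &
    f (x + h) - f x = \sum_i h 0 i * partial i f (z i).
Proof.
move=> df.
pose p (n : nat) : 'rV[R]_d := x + \row_j (if (j < n)%N then h 0 j else 0).
have pS (i : 'I_d) : p i.+1 = p i + h 0 i *: E_ i.
  apply/rowP => j; rewrite !mxE eqxx /= ltnS leq_eqVlt -addrA; congr (_ + _).
  have [->|ij] := eqVneq j i; first by rewrite eqxx ltnn /= mulr1 add0r.
  have -> : (j == i :> nat) = false by apply/negbTE.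
  by rewrite /= mulr0 addr0.
have H (i : 'I_d) : {c : R | `|c| <= `|h 0 i| /\
    f (p i.+1) - f (p i) = h 0 i * partial i f (p i + c *: E_ i)}.
  apply: cid; have [c c1 c2] := @line_mvt _ f (p i) (E_ i) (h 0 i) (df i).
  by exists c; rewrite pS.
exists (fun i : 'I_d => p i + sval (H i) *: E_ i).
  move=> i; have [c1 _] := svalP (H i); apply: mx_norm_ler => // k j.
  rewrite !mxE ord1 eqxx /=; set c := sval _ in c1 *.
  have -> : x 0 j + (if (j < i)%N then h 0 j else 0) + c * (j == i)%:R - x 0 j
    = (if (j < i)%N then h 0 j else 0) + c * (j == i)%:R by ring.
  have [->|ij] := eqVneq j i.
    by rewrite ltnn add0r mulr1 (le_trans c1) ?ler_mx_entry.
  rewrite mulr0 addr0; case: ifP => _; first exact: ler_mx_entry.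
  by rewrite normr0.
transitivity (\sum_(i < d) (f (p i.+1) - f (p i))).
  rewrite -(big_mkord xpredT (fun i => f (p i.+1) - f (p i))) telescope_sumr //.
  congr (f _ - f _); rewrite /p; apply/rowP => j; rewrite !mxE.
    by rewrite ltn_ord.
  by rewrite ltn0 addr0.
by apply: eq_bigr => i _; have [_ E] := svalP (H i); exact: E.
Qed.

End mvt.

(** * Partial derivatives *)

Lemma cvg_sumr (R : realType) (T : Type) (F : set_system T) {FF : Filter F}
    (I : Type) (r : seq I) (P : pred I) (f : I -> T -> R) (l : I -> R) :
  (forall i, P i -> f i @ F --> l i) ->
  (fun t => \sum_(i <- r | P i) f i t) @ F --> \sum_(i <- r | P i) l i.
Proof.
move=> H; elim: r => [|a r IH].
  under eq_fun do rewrite big_nil.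
  by rewrite big_nil; exact: cvg_cst.
under eq_fun do rewrite big_cons.
rewrite big_cons; case: ifP => Pa //.
by apply: cvgD => //; exact: H.
Qed.

Lemma derivable_line_cvg (R : realType) (V W : normedModType R) (f : V -> W) (x v : V) :
  derivable f x v -> f (s *: v + x) @[s --> (0 : R)] --> f x.
Proof.
move=> df; have : derivable (fun s : R => f (s *: v + x)) 0 1.
  by have /derivable1P := df.
move/derivable1_diffP/differentiable_continuous => H.
have : f (s *: v + x) @[s --> (0 : R)] --> f ((0 : R) *: v + x) by exact: H.
by rewrite scale0r add0r.
Qed.

(** Chain rule without differentiability of [f]: [box_mvt] expresses the increment by partial
    derivatives at points within [|h s|] of [psi x], and continuity of the partial derivatives there
    gives the limit. *)
Lemma is_derive_comp_partial (R : realType) (V : normedModType R) (d : nat)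
    (f : 'rV[R]_d -> R) (psi : V -> 'rV[R]_d) (x v : V) :
  (forall i y, derivable f y (delta_mx 0 i)) ->
  (forall i, {for psi x, continuous (partial i f)}) ->
  derivable psi x v ->
  is_derive x v (f \o psi) (\sum_j 'D_v psi x 0 j * partial j f (psi x)).
Proof.
move=> df cf dpsi.
pose h (s : R) := psi (s *: v + x) - psi x.
have H (s : R) : {z : 'I_d -> 'rV[R]_d | (forall i, `|z i - psi x| <= `|h s|) /\
    f (psi x + h s) - f (psi x) = \sum_i h s 0 i * partial i f (z i)}.
  by apply: cid; have [z z1 z2] := box_mvt (psi x) (h s) df; exists z.
pose z s := sval (H s).
have hz s i : `|z s i - psi x| <= `|h s| by have [hh _] := svalP (H s); exact: hh.
have hE s : f (psi (s *: v + x)) - f (psi x) = \sum_i h s 0 i * partial i f (z s i).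
  by have [_ <-] := svalP (H s); rewrite /h subrKC.
have h0 : h s @[s --> (0 : R)] --> (0 : 'rV[R]_d).
  rewrite -[X in _ --> X](subrr (psi x)).
  by apply: cvgB; [exact: derivable_line_cvg|exact: cvg_cst].
have cz i : z s i @[s --> (0 : R)] --> psi x.
  apply/cvgrPdist_lt => e e0; move/cvgrPdist_lt: h0 => /(_ _ e0).
  apply: filterS => s; rewrite sub0r normrN => hs.
  by rewrite distrC (le_lt_trans _ hs).
have key : (fun s : R => s^-1 *: (((f \o psi) \o shift x) (s *: v) - (f \o psi) x))
    @ 0^' --> \sum_j 'D_v psi x 0 j * partial j f (psi x).
  rewrite (_ : (fun s : R => _) = fun s =>
    \sum_i (s^-1 * h s 0 i) * partial i f (z s i)); last first.
    apply/funext => s /=; rewrite hE [LHS]mulr_sumr.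
    by apply: eq_bigr => i _; rewrite mulrA.
  apply: cvg_sumr => i _; apply: cvgM.
    have : (fun s : R => s^-1 *: h s) @ 0^' --> 'D_v psi x by exact: dpsi.
    move/cvg_mxP => /(_ 0 i); apply: cvg_trans; apply: near_eq_cvg.
    by near=> s; rewrite !mxE.
  apply: continuous_cvg; first exact: cf.
  by apply: cvg_trans (cz i); apply: cvg_app; exact: cvg_within.
split; first by apply/cvg_ex; eexists; exact: key.
exact/cvg_lim.
Unshelve. all: by end_near.
Qed.

(** Schwarz's theorem: the second difference is symmetric in the two directions, and two mean value
    steps, taken in either order, turn it into [s * s] times a mixed derivative at a nearby
    point. *)
Lemma partial_comm (R : realType) (d : nat) (f : 'rV[R]_d -> R) (i j : 'I_d) :
  (forall k y, derivable f y (delta_mx 0 k)) ->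
  (forall k l y, derivable (partial k f) y (delta_mx 0 l)) ->
  (forall k l, continuous (partial l (partial k f))) ->
  partial i (partial j f) = partial j (partial i f).
Proof.
move=> df ddf cf.
pose E k : 'rV[R]_d := delta_mx 0 k.
have key k l x (s : R) : s != 0 -> exists a b : R, [/\ `|a| <= `|s|, `|b| <= `|s| &
   f (x + s *: E k + s *: E l) - f (x + s *: E k) - f (x + s *: E l) + f x =
   s * s * partial l (partial k f) (x + a *: E k + b *: E l)].
  move=> s0.
  pose g := fun y => f (y + s *: E l) - f y.
  have shE y : is_derive y (E k) (fun y => f (y + s *: E l)) (partial k f (y + s *: E l)).
    have Q : (fun h : R => h^-1 *: (((fun y => f (y + s *: E l)) \o shift y) (h *: E k) -
        f (y + s *: E l)))
      = (fun h : R => h^-1 *: ((f \o shift (y + s *: E l)) (h *: E k) - f (y + s *: E l))).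
      by apply/funext => h /=; rewrite addrA.
    by split; [rewrite /derivable Q; exact: df | rewrite /derive Q].
  have gE y : is_derive y (E k) g (partial k f (y + s *: E l) - partial k f y).
    by apply: is_deriveB; apply: derivableP; exact: df.
  have [|a a1] := @line_mvt _ _ g x (E k) s; first by move=> y; case: (gE y).
  rewrite (@derive_val _ _ _ _ _ _ _ (gE _)) {1 2}/g.
  have [|b b1 ->] := @line_mvt _ _ (partial k f) (x + a *: E k) (E l) s.
    by move=> y; exact: ddf.
  move=> H; exists a, b; split => //.
  by rewrite -mulrA -H; ring.
apply/funext => x.
have lim k l : exists a b : R -> R, (forall s, [/\ s != 0 -> `|a s| <= `|s|,
   s != 0 -> `|b s| <= `|s| & s != 0 ->
   f (x + s *: E k + s *: E l) - f (x + s *: E k) - f (x + s *: E l) + f x =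
   s * s * partial l (partial k f) (x + a s *: E k + b s *: E l)]).
  have H s : {ab : R * R | [/\ s != 0 -> `|ab.1| <= `|s|, s != 0 -> `|ab.2| <= `|s| & s != 0 ->
   f (x + s *: E k + s *: E l) - f (x + s *: E k) - f (x + s *: E l) + f x =
   s * s * partial l (partial k f) (x + ab.1 *: E k + ab.2 *: E l)]}.
    apply: cid; case: (eqVneq s 0) => [s0|s0]; first by exists (0, 0).
    by have [a [b [? ? ?]]] := key k l x s s0; exists (a, b).
  by exists (fun s => (sval (H s)).1), (fun s => (sval (H s)).2) => s; exact: (svalP (H s)).
have cv0 (a : R -> R) : (forall s, s != 0 -> `|a s| <= `|s|) -> a s @[s --> 0^'] --> 0.
  move=> ha; apply/cvgrPdist_lt => e e0; near=> s.
  rewrite sub0r normrN (@le_lt_trans _ _ `|s|) //.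
    by apply: ha; near: s; exact: nbhs_dnbhs_neq.
  near: s; apply: dnbhs0_lt => //.
have lim2 k l : (fun s : R => s^-1 * s^-1 *
    (f (x + s *: E k + s *: E l) - f (x + s *: E k) - f (x + s *: E l) + f x)) @ 0^' -->
    partial l (partial k f) x.
  have [a [b H]] := lim k l.
  have : (fun s => partial l (partial k f) (x + a s *: E k + b s *: E l)) @ 0^' -->
      partial l (partial k f) x.
    have : x + a s *: E k + b s *: E l @[s --> 0^'] --> x + 0 *: E k + 0 *: E l.
      apply: cvgD; first apply: cvgD; first exact: cvg_cst.
        by apply: cvgZr_tmp; apply: cv0 => s; have [] := H s.
      by apply: cvgZr_tmp; apply: cv0 => s; have [] := H s.
    by rewrite !scale0r !addr0; apply: continuous_cvg; exact: cf.
  apply: cvg_trans; apply: near_eq_cvg; near=> s.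
  have s0 : s != 0 by near: s; exact: nbhs_dnbhs_neq.
  by have [_ _ ->//] := H s; field.
have L1 := lim2 i j; have L2 := lim2 j i.
have S : (fun s : R => s^-1 * s^-1 *
    (f (x + s *: E i + s *: E j) - f (x + s *: E i) - f (x + s *: E j) + f x))
  = (fun s : R => s^-1 * s^-1 *
    (f (x + s *: E j + s *: E i) - f (x + s *: E j) - f (x + s *: E i) + f x)).
  apply/funext => s; congr (_ * _); rewrite [x + s *: E i + _]addrAC; ring.
rewrite S in L1.
by apply: (cvg_unique _ L2 L1).
Unshelve. all: by end_near.
Qed.

(** * Families of functions with uniformly controlled derivatives *)

Definition vanishing (R : realType) (d : nat) (f : 'rV[R]_d -> R) : Prop :=
  forall e : R, 0 < e -> exists M : R, forall x, M < `|x| -> `|f x| < e.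

Section reg.
Variables (R : realType) (d : nat).
Local Notation E_ i := (delta_mx 0 i : 'rV[R]_d).

Definition C0fam (T : Type) (tau : T -> R) (F : T -> 'rV[R]_d -> R) : Prop :=
  [/\ forall t, continuous (F t),
      exists2 B : R, 0 <= B & forall t x, `|F t x| <= B * tau t &
      forall t, vanishing (F t)].

(* For [tau = 1] on [unit] this says that the function is in C^k_0; for a family
   of shears with parameters [tau t = t] it says that their C^k distance to the
   identity is O(t). *)
Fixpoint reg (T : Type) (tau : T -> R) (k : nat) (F : T -> 'rV[R]_d -> R) : Prop :=
  C0fam tau F /\
  if k is k'.+1 then
    forall i : 'I_d, exists2 F' : T -> 'rV[R]_d -> R,
      (forall t x, is_derive x (E_ i) (F t) (F' t x)) & reg tau k' F'
  else True.

Variables (T : Type) (tau : T -> R).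
Hypothesis tau01 : forall t, 0 <= tau t <= 1.
Implicit Types F G : T -> 'rV[R]_d -> R.

Lemma reg_C0 k F : reg tau k F -> C0fam tau F.
Proof. by case: k => [|k] []. Qed.

Lemma regW k F : reg tau k.+1 F -> reg tau k F.
Proof.
elim: k F => [|k IH] F [F0 H]; first by split.
split=> // i; have [F' F1 F2] := H i; exists F' => //; exact: IH.
Qed.

Lemma reg_le n k F : (n <= k)%N -> reg tau k F -> reg tau n F.
Proof.
elim: k => [|k IH]; first by rewrite leqn0 => /eqP ->.
by rewrite leq_eqVlt => /predU1P[->//|nk /regW]; exact: IH.
Qed.

Lemma C0fam0 : C0fam tau (fun _ _ => 0).
Proof.
split=> [t|//|t e e0]; first exact: cst_continuous.
  by exists 0 => // t x; rewrite normr0 mul0r.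
by exists 0 => x _; rewrite normr0.
Qed.

Lemma reg0 k : reg tau k (fun _ _ => 0).
Proof.
elim: k => [|k IH]; split=> //; try exact: C0fam0.
move=> i; exists (fun _ _ => 0) => // t x; exact: is_derive_cst.
Qed.

Lemma C0famD F G : C0fam tau F -> C0fam tau G -> C0fam tau (fun t x => F t x + G t x).
Proof.
move=> [cF [B B0 bF] vF] [cG [C K0 bG] vG]; split=> [t x|//|t e e0].
- exact: (cvgD (cF t x) (cG t x)).
- exists (B + C); first exact: addr_ge0.
  by move=> t x; rewrite mulrDl (le_trans (ler_normD _ _))// lerD.
- have e2 : 0 < e / 2 by rewrite divr_gt0.
  have [M1 H1] := vF t _ e2; have [M2 H2] := vG t _ e2.
  exists (Num.max M1 M2) => x; rewrite gt_max => /andP[x1 x2].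
  by rewrite [e]splitr (le_lt_trans (ler_normD _ _))// ltrD// ?H1 ?H2.
Qed.

Lemma regD k F G : reg tau k F -> reg tau k G -> reg tau k (fun t x => F t x + G t x).
Proof.
elim: k F G => [|k IH] F G [F0 HF] [G0 HG]; split=> //; try exact: C0famD.
move=> i; have [F' F1 F2] := HF i; have [G' G1 G2] := HG i.
exists (fun t x => F' t x + G' t x); last exact: IH.
by move=> t x; apply: is_deriveD.
Qed.

Lemma C0famM F G : C0fam tau F -> C0fam tau G -> C0fam tau (fun t x => F t x * G t x).
Proof.
move=> [cF [B B0 bF] vF] [cG [C K0 bG] vG]; split=> [t x|//|t e e0].
- exact: (cvgM (cF t x) (cG t x)).
- exists (B * C); first exact: mulr_ge0.
  move=> t x; have /andP[t0 t1] := tau01 t; rewrite normrM.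
  (* One of the two factors [tau t] is bounded by 1, so a product of O(tau) families is again
     O(tau). *)
  have -> : B * C * tau t = (B * 1) * (C * tau t) by ring.
  apply: ler_pM => //; apply: (le_trans (bF t x)).
  by apply: ler_wpM2l.
- have eC : 0 < e / (C + 1) by rewrite divr_gt0// ltr_wpDl.
  have [M HM] := vF t _ eC; exists M => x /HM h.
  rewrite normrM -(@divfK _ (C + 1) _ e) ?gt_eqF ?ltr_wpDl//.
  have /andP[t0 t1] := tau01 t.
  have cG1 : `|G t x| <= C by rewrite (le_trans (bG t x))// ler_piMr.
  rewrite (@le_lt_trans _ _ (e / (C + 1) * `|G t x|)) //.
    by rewrite ler_wpM2r// ltW.
  by rewrite ltr_pM2l// (le_lt_trans cG1)// ltrDl.
Qed.

Lemma is_deriveDfun (V W : normedModType R) (f g : V -> W) (x v : V) df dg :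
  is_derive x v f df -> is_derive x v g dg -> is_derive x v (fun y => f y + g y) (df + dg).
Proof. exact: is_deriveD. Qed.

Lemma is_deriveBfun (V W : normedModType R) (f g : V -> W) (x v : V) df dg :
  is_derive x v f df -> is_derive x v g dg -> is_derive x v (fun y => f y - g y) (df - dg).
Proof. exact: is_deriveB. Qed.

Lemma is_derive_cstfun (V W : normedModType R) (c : W) (x v : V) :
  is_derive x v (fun=> c) 0.
Proof. exact: is_derive_cst. Qed.

Lemma is_deriveMfun (V : normedModType R) (f g : V -> R) (x v : V) df dg :
  is_derive x v f df -> is_derive x v g dg ->
  is_derive x v (fun y => f y * g y) (df * g x + f x * dg).
Proof.
move=> hf hg; apply: is_derive_eq (is_deriveM hf hg) _.
by rewrite addrC mulrC.
Qed.

Lemma regM k F G : reg tau k F -> reg tau k G -> reg tau k (fun t x => F t x * G t x).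
Proof.
elim: k F G => [|k IH] F G HF HG.
  by split=> //; apply: C0famM; [exact: reg_C0 HF|exact: reg_C0 HG].
split; first by apply: C0famM; [exact: reg_C0 HF|exact: reg_C0 HG].
move=> i; have [F' F1 F2] := HF.2 i; have [G' G1 G2] := HG.2 i.
exists (fun t x => F' t x * G t x + F t x * G' t x).
  by move=> t x; apply: is_deriveMfun.
by apply: regD; apply: IH => //; exact: regW.
Qed.

Lemma reg_sum k (I : Type) (r : seq I) (F : I -> T -> 'rV[R]_d -> R) :
  (forall i, reg tau k (F i)) -> reg tau k (fun t x => \sum_(i <- r) F i t x).
Proof.
move=> HF; elim: r => [|a r IH].
  rewrite (_ : (fun _ _ => _) = fun _ _ => 0); first exact: reg0.
  by apply/funext => t; apply/funext => x; rewrite big_nil.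
rewrite (_ : (fun _ _ => _) = fun t x => F a t x + \sum_(i <- r) F i t x); first exact: regD.
by apply/funext => t; apply/funext => x; rewrite big_cons.
Qed.

Lemma C0famZ (c : R) F : C0fam tau F -> C0fam tau (fun t x => c * F t x).
Proof.
move=> [cF [B B0 bF] vF]; split=> [t x|//|t e e0].
- exact: (cvgM (cvg_cst _) (cF t x)).
- exists (`|c| * B); first exact: mulr_ge0.
  by move=> t x; rewrite normrM -mulrA ler_wpM2l.
- have ec : 0 < e / (`|c| + 1) by rewrite divr_gt0// ltr_wpDl.
  have [M HM] := vF t _ ec; exists M => x /HM h.
  rewrite normrM -(@divfK _ (`|c| + 1) _ e) ?gt_eqF ?ltr_wpDl// mulrC.
  rewrite (@le_lt_trans _ _ (e / (`|c| + 1) * `|c|)) //.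
    by rewrite ler_wpM2r// ltW.
  by rewrite ltr_pM2l// ltrDl.
Qed.

Lemma is_deriveZfun (V : normedModType R) (c : R) (f : V -> R) (x v : V) df :
  is_derive x v f df -> is_derive x v (fun y => c * f y) (c * df).
Proof. by move=> hf; apply: is_derive_eq (is_deriveZ _ hf) _. Qed.

Lemma regZ k (c : R) F : reg tau k F -> reg tau k (fun t x => c * F t x).
Proof.
elim: k F => [|k IH] F [F0 HF]; split=> //; try exact: C0famZ.
move=> i; have [F' F1 F2] := HF i.
exists (fun t x => c * F' t x); last exact: IH.
by move=> t x; apply: is_deriveZfun.
Qed.

Lemma is_derive_sumfun (V : normedModType R) (I : Type) (r : seq I) (f : I -> V -> R)
    (x v : V) (df : I -> R) : (forall i, is_derive x v (f i) (df i)) ->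
  is_derive x v (fun y => \sum_(i <- r) f i y) (\sum_(i <- r) df i).
Proof.
move=> H; elim: r => [|a r IH].
  rewrite big_nil (_ : (fun _ => _) = cst 0); first exact: is_derive_cst.
  by apply/funext => y; rewrite big_nil.
rewrite big_cons (_ : (fun _ => _) = fun y => f a y + \sum_(i <- r) f i y).
  by apply: is_deriveD.
by apply/funext => y; rewrite big_cons.
Qed.

Lemma regN k F : reg tau k F -> reg tau k (fun t x => - F t x).
Proof.
move=> HF; rewrite (_ : (fun _ _ => _) = fun t x => -1 * F t x); first exact: regZ.
by apply/funext => t; apply/funext => x; rewrite mulN1r.
Qed.

Lemma regB k F G : reg tau k F -> reg tau k G -> reg tau k (fun t x => F t x - G t x).
Proof. by move=> HF HG; apply: regD => //; exact: regN. Qed.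

Lemma reg_partial k F i : reg tau k.+1 F ->
  (forall t x, derivable (F t) x (E_ i)) /\ reg tau k (fun t => partial i (F t)).
Proof.
move=> [_ /(_ i)[F' F1 F2]]; split; first by move=> t x; case: (F1 t x).
rewrite (_ : (fun _ => _) = F') //; apply/funext => t; apply/funext => x.
by rewrite /partial; exact: derive_val.
Qed.

Lemma reg_derivable k F i t x : reg tau k.+1 F -> derivable (F t) x (E_ i).
Proof. by move=> /reg_partial-/(_ i)[H _]. Qed.

Lemma reg_continuous k F t : reg tau k F -> continuous (F t).
Proof. by move=> /reg_C0[]. Qed.

Lemma reg_is_Cm k F t : reg tau k F -> is_Cm k (F t).
Proof.
elim: k F => [|k IH] F HF; split=> //; try exact: reg_continuous HF.
by move=> i; have [F1 F2] := reg_partial i HF; split=> //; exact: IH F2.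
Qed.

Lemma near_id_continuous (h : 'I_d -> T -> 'rV[R]_d -> R) k t : (forall j, reg tau k (h j)) ->
  continuous (fun x : 'rV[R]_d => x + \row_j h j t x).
Proof.
move=> hr x.
have H : \row_j h j t y @[y --> x] --> \row_j h j t x.
  apply: (proj1 (@cvg_mxP R _ (nbhs x) _ 1 d _ _)) => a j.
  rewrite mxE; under eq_fun do rewrite mxE.
  exact: reg_continuous (hr j) x.
exact: (cvgD (@cvg_id _ (nbhs x)) H).
Qed.

(** The bounded displacement sends [psi t x] to infinity with [x], so decay passes to the composite;
    the bound in [tau] is inherited from [F] whatever [psi] is. *)
Lemma C0fam_comp F (psi : T -> 'rV[R]_d -> 'rV[R]_d) :
  C0fam tau F -> (forall t, continuous (psi t)) ->
  (forall t, exists C : R, forall x, `|psi t x - x| <= C) ->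
  C0fam tau (fun t x => F t (psi t x)).
Proof.
move=> [cF [B B0 bF] vF] cpsi bpsi; split=> [t x|//|t e e0].
- exact: (continuous_comp (cpsi t x) (cF t _)).
- by exists B => // t x; exact: bF.
- have [C hC] := bpsi t.
  have [M HM] := vF t _ e0; exists (M + C) => x xM; apply: HM.
  rewrite -ltrBrDr in xM; apply: (lt_le_trans xM).
  rewrite lerBlDr; have {1}-> : x = psi t x - (psi t x - x) by rewrite opprB addrC subrK.
  by rewrite (le_trans (ler_normB _ _))// lerD2l.
Qed.

Lemma near_id_bounded (h : 'I_d -> T -> 'rV[R]_d -> R) t : (forall j, C0fam tau (h j)) ->
  exists C : R, forall x : 'rV[R]_d, `|x + \row_j h j t x - x| <= C.
Proof.
move=> hh.
have H (j : 'I_d) : {C : R | 0 <= C /\ forall x, `|h j t x| <= C}.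
  apply: cid; have [_ [C K0 HC] _] := hh j; exists (C * tau t).
  by have /andP[t0 t1] := tau01 t; split; [exact: mulr_ge0 | move=> x; exact: HC].
have s0 : 0 <= \sum_j sval (H j) by apply: sumr_ge0 => j _; have [] := svalP (H j).
exists (\sum_j sval (H j)) => x; rewrite addrC addKr mx_norm_ler// => a j.
rewrite mxE; have [_ h1] := svalP (H j).
rewrite (le_trans (h1 x))// (bigD1 j)//= lerDl sumr_ge0// => l _.
by have [] := svalP (H l).
Qed.

(** Constants do not vanish at infinity, so the identity matrix in the derivative of [psi t] lies
    outside the class. Its contribution is therefore split off as the term [partial i (F t)] at
    [psi t x], and the products only involve derivatives of the displacement. *)
Lemma reg_comp k F (h : 'I_d -> T -> 'rV[R]_d -> R) :
  reg tau k F -> (forall j, reg tau k (h j)) ->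
  reg tau k (fun t x => F t (x + \row_j h j t x)).
Proof.
elim: k F h => [|k IH] F h HF Hh.
  split=> //; apply: (C0fam_comp (reg_C0 HF)) => t.
    exact: near_id_continuous Hh.
  by apply: near_id_bounded => j; exact: reg_C0 (Hh j).
split.
  apply: (C0fam_comp (reg_C0 HF)) => t; first exact: near_id_continuous Hh.
  by apply: near_id_bounded => j; exact: reg_C0 (Hh j).
move=> i.
pose psi t x := x + \row_j h j t x.
exists (fun t x => partial i (F t) (psi t x)
   + \sum_j partial i (h j t) x * partial j (F t) (psi t x)); last first.
  apply: regD.
    apply: (IH (fun t => partial i (F t)) h); first exact: (reg_partial i HF).2.
    by move=> j; exact: regW.
  apply: reg_sum => j; apply: regM; first exact: (reg_partial i (Hh j)).2.
  apply: (IH (fun t => partial j (F t)) h); first exact: (reg_partial j HF).2.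
  by move=> l; exact: regW.
move=> t x.
have dh : derivable (fun x => \row_j h j t x) x (E_ i).
  apply/derivable_mxP => a j; rewrite (_ : (fun _ => _) = h j t).
    exact: reg_derivable (Hh j).
  by apply/funext => y; rewrite mxE.
have D := is_deriveD (is_derive_id x (E_ i)) (derivableP dh).
have dpsi : derivable (psi t) x (E_ i) by case: D.
have Dpsi : 'D_(E_ i) (psi t) x = E_ i + \row_j partial i (h j t) x.
  rewrite (@derive_val _ _ _ _ _ _ _ D); congr (_ + _); rewrite (derive_mx dh).
  apply/rowP => j; rewrite [LHS]mxE [RHS]mxE /partial.
  have -> : (fun y => (\row_j0 h j0 t y) 0 j) = h j t by apply/funext => y; rewrite mxE.
  by [].
apply: is_derive_eq (is_derive_comp_partial _ _ dpsi) _.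
- by move=> j y; exact: reg_derivable HF.
- by move=> j; apply: reg_continuous (reg_partial j HF).2 _.
rewrite Dpsi (eq_bigr (fun j => (j == i)%:R * partial j (F t) (psi t x)
    + partial i (h j t) x * partial j (F t) (psi t x))); last first.
  by move=> j _; rewrite !mxE eqxx /= mulrDl.
rewrite big_split /= (bigD1 i)//= eqxx mul1r big1 ?addr0//.
by move=> j /negbTE ->; rewrite mul0r.
Qed.

Lemma C0fam_frac F : C0fam tau F -> (forall t x, `|F t x| <= 2^-1) ->
  C0fam tau (fun t x => F t x / (1 + F t x)).
Proof.
move=> [cF [B B0 bF] vF] F2.
have pos t x : 2^-1 <= 1 + F t x.
  have := F2 t x; rewrite ler_norml => /andP[h _].
  rewrite -lerBlDl (le_trans _ h)//; lra.
have le2 t x : `|F t x / (1 + F t x)| <= 2 * `|F t x|.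
  rewrite normrM normfV (@gtr0_norm _ (1 + _)); last by rewrite (lt_le_trans _ (pos t x)).
  rewrite mulrC ler_wpM2r// -[leRHS]invrK lef_pV2 ?posrE// ?invr_gt0//.
  by rewrite (lt_le_trans _ (pos t x)).
split=> [t x|//|t e e0].
- have n0 : 1 + F t x != 0 by rewrite gt_eqF// (lt_le_trans _ (pos t x)).
  exact: (cvgM (cF t x) (cvgV n0 (cvgD (cvg_cst _) (cF t x)))).
- exists (2 * B); first exact: mulr_ge0.
  by move=> t x; rewrite (le_trans (le2 t x))// -mulrA ler_wpM2l.
- have e2 : 0 < e / 2 by rewrite divr_gt0.
  have [M HM] := vF t _ e2; exists M => x /HM h.
  by rewrite (le_lt_trans (le2 t x))// -ltr_pdivlMl// mulrC.
Qed.

(** The function [1 / (1 + F)] tends to 1 at infinity, but [q = F / (1 + F)] stays in the class and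
    [1 / (1 + F) = 1 - q]. Hence the derivative of [q] is [F' * (1 - q) ^ 2], a polynomial in [F']
    and [q] each of whose terms contains [F']. *)
Lemma reg_frac k F : reg tau k F -> (forall t x, `|F t x| <= 2^-1) ->
  reg tau k (fun t x => F t x / (1 + F t x)).
Proof.
elim: k F => [|k IH] F HF F2.
  by split=> //; apply: C0fam_frac => //; exact: reg_C0 HF.
split; first by apply: C0fam_frac => //; exact: reg_C0 HF.
move=> i; have [F' F1 F3] := HF.2 i.
pose q t x := F t x / (1 + F t x).
have pos t x : 1 + F t x != 0.
  rewrite gt_eqF//; have := F2 t x; rewrite ler_norml => /andP[h _].
  by rewrite -ltrBlDl (lt_le_trans _ h)//; lra.
have Hq : reg tau k q by apply: IH => //; exact: regW.
exists (fun t x => F' t x - q t x * F' t x - q t x * (F' t x - q t x * F' t x)); last first.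
  have H1 : reg tau k (fun t x => F' t x - q t x * F' t x).
    by apply: regB => //; exact: regM.
  by apply: regB => //; exact: regM.
move=> t x.
have d1 : is_derive x (E_ i) (fun y => (1 + F t y)^-1) (- (1 + F t x) ^- 2 * F' t x).
  have D : is_derive x (E_ i) (fun y => 1 + F t y) (0 + F' t x).
    by apply: is_deriveD; exact: is_derive_cst.
  split; first by apply: derivableV => //; case: D.
  by rewrite deriveV// (@derive_val _ _ _ _ _ _ _ D) add0r.
apply: is_derive_eq (is_deriveMfun (F1 t x) d1) _.
by rewrite /q; field; exact: pos.
Qed.

End reg.

(** * Vector fields vanishing at infinity and their norms *)

Lemma is_Cm_cst (R : realType) (d m : nat) (V : normedModType R) (c : V) :
  is_Cm m (fun _ : 'rV[R]_d => c).
Proof.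
elim: m c => [|m IH] c; split=> //; try exact: cst_continuous.
move=> i; split; first by move=> x; exact: derivable_cst.
rewrite (_ : partial i _ = fun _ => 0) //.
by apply/funext => x; rewrite /partial derive_cst.
Qed.

Lemma is_Cm_id (R : realType) (d m : nat) : is_Cm m (id : 'rV[R]_d -> 'rV[R]_d).
Proof.
case: m => [|m]; split=> //; try by move=> x; exact: cvg_id.
move=> i; split; first by move=> x; exact: derivable_id.
rewrite (_ : partial i _ = fun _ => delta_mx 0 i); first exact: is_Cm_cst.
by apply/funext => x; rewrite /partial derive_id.
Qed.

Lemma is_CmD (R : realType) (d m : nat) (V : normedModType R) (f g : 'rV[R]_d -> V) :
  is_Cm m f -> is_Cm m g -> is_Cm m (fun x => f x + g x).
Proof.
elim: m f g => [|m IH] f g [cf Hf] [cg Hg].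
  by split=> // x; exact: (cvgD (cf x) (cg x)).
split; first by move=> x; exact: (cvgD (cf x) (cg x)).
move=> i; have [df Pf] := Hf i; have [dg Pg] := Hg i; split.
  by move=> x; exact: (derivableD (df x) (dg x)).
rewrite (_ : partial i _ = fun x => partial i f x + partial i g x); first exact: IH.
by apply/funext => x; exact: (deriveD (df x) (dg x)).
Qed.

Lemma is_CmN (R : realType) (d m : nat) (V : normedModType R) (f : 'rV[R]_d -> V) :
  is_Cm m f -> is_Cm m (fun x => - f x).
Proof.
elim: m f => [|m IH] f [cf Hf].
  by split=> // x; exact: (cvgN (cf x)).
split; first by move=> x; exact: (cvgN (cf x)).
move=> i; have [df Pf] := Hf i; split.
  by move=> x; exact: (derivableN (df x)).
rewrite (_ : partial i _ = fun x => - partial i f x); first exact: IH.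
by apply/funext => x; exact: (deriveN (df x)).
Qed.

Lemma is_Cm_le (R : realType) (d m n : nat) (V : normedModType R) (f : 'rV[R]_d -> V) :
  (n <= m)%N -> is_Cm m f -> is_Cm n f.
Proof.
elim: m n f => [|m IH] [|n] f //= nm [cf Hf]; split=> // i.
by have [df Pf] := Hf i; split=> //; exact: IH Pf.
Qed.

Lemma is_Cm_continuous (R : realType) (d m : nat) (V : normedModType R) (f : 'rV[R]_d -> V) :
  is_Cm m f -> continuous f.
Proof. by case: m => [|m] []. Qed.

Section coord.
Variables (R : realType) (d n : nat).
Implicit Type f : 'rV[R]_d -> 'rV[R]_n.

Lemma partial_coord f i x j : derivable f x (delta_mx 0 i) ->
  partial i f x 0 j = partial i (fun y => f y 0 j) x.
Proof. by move=> df; rewrite /partial (derive_mx df) mxE. Qed.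

Lemma continuous_coordP f : (forall j, continuous (fun x => f x 0 j)) <-> continuous f.
Proof.
split=> [H x|H j x].
  by apply: (proj1 (@cvg_mxP R _ (nbhs x) _ 1 n _ _)) => a j; rewrite ord1; exact: H.
exact: (proj2 (@cvg_mxP R _ (nbhs x) _ 1 n _ _) (H x)).
Qed.

Lemma is_Cm_coordP m f : (forall j, is_Cm m (fun x => f x 0 j)) <-> is_Cm m f.
Proof.
elim: m f => [|m IH] f.
  split=> [H|[cf _] j]; split=> //.
    by apply/continuous_coordP => j; have [] := H j.
  exact: (proj2 (continuous_coordP f) cf).
split=> [H|[cf H] j]; split.
- by apply/continuous_coordP => j; have [] := H j.
- move=> i.
  have df x : derivable f x (delta_mx 0 i).
    apply/derivable_mxP => a j; rewrite ord1.
    by have [_ /(_ i)[h _]] := H j; exact: h.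
  split=> //; apply/IH => j; have [_ /(_ i)[_]] := H j.
  congr is_Cm; apply/funext => x; symmetry; exact: partial_coord.
- exact: (proj2 (continuous_coordP f) cf).
- move=> i; have [df Pf] := H i.
  split=> [x|]; first by have /derivable_mxP := df x; exact.
  have := proj2 (IH _) Pf j; congr is_Cm; apply/funext => x; exact: partial_coord.
Qed.

End coord.

(** Words of directions rather than multi-indices: [is_Cm] and [reg] differentiate in any order,
    while [mpartial] fixes one. The two are reconciled by [parts_perm]. *)
Definition parts (R : realType) (d : nat) (V : normedModType R) (l : seq 'I_d)
    (f : 'rV[R]_d -> V) : 'rV[R]_d -> V := foldr (@partial R d V) f l.

Definition mi_seq (d m : nat) (a : multi_index d m) : seq 'I_d :=
  flatten [seq nseq (a i) i | i <- enum 'I_d].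

Section parts.
Variables (R : realType) (d : nat).

Lemma mpartialE (V : normedModType R) m (a : multi_index d m) (f : 'rV[R]_d -> V) :
  mpartial a f = parts (mi_seq a) f.
Proof.
rewrite /mpartial /mi_seq /parts; elim: (enum _) => [//|i s IH] /=.
rewrite foldr_cat IH; move: (foldr _ f (flatten _)) => g.
by elim: (nat_of_ord (a i)) => [//|k /= ->].
Qed.

Lemma size_mi_seq m (a : multi_index d m) : size (mi_seq a) = order_mi a.
Proof.
rewrite /mi_seq size_flatten /shape -map_comp sumnE big_map /order_mi big_enum /=.
by apply: eq_bigr => i _; rewrite size_nseq.
Qed.

Lemma is_Cm_parts (V : normedModType R) m (l : seq 'I_d) (f : 'rV[R]_d -> V) : is_Cm m f ->
  (size l <= m)%N -> is_Cm (m - size l) (parts l f).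
Proof.
move=> Hf; elim: l => [|i l IH] /= lm; first by rewrite subn0.
have := IH (ltnW lm); rewrite -[(m - size l)%N]prednK ?subn_gt0//.
by rewrite -subnS => -[_ /(_ i)[]].
Qed.

Lemma parts_derivable (V : normedModType R) m (l : seq 'I_d) (f : 'rV[R]_d -> V) i x :
  is_Cm m f -> (size l < m)%N -> derivable (parts l f) x (delta_mx 0 i).
Proof.
move=> Hf lm; have := is_Cm_parts Hf (ltnW lm).
by rewrite -[(m - size l)%N]prednK ?subn_gt0// => -[_ /(_ i)[]].
Qed.

Lemma parts_coord m n (l : seq 'I_d) (f : 'rV[R]_d -> 'rV[R]_n) x j : is_Cm m f ->
  (size l <= m)%N -> parts l f x 0 j = parts l (fun y => f y 0 j) x.
Proof.
move=> Hf; elim: l x => [//|i l IH] x /= lm.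
rewrite partial_coord; last exact: parts_derivable Hf lm.
by congr (partial i _ x); apply/funext => y; apply: IH; exact: ltnW.
Qed.

(** The head letter of [l] is located in [l'] and moved past the letters before it one at a time;
    each exchange is an instance of [partial_comm], whose continuity assumption holds because the
    words have length at most [m]. *)
Lemma parts_perm m (l l' : seq 'I_d) (f : 'rV[R]_d -> R) : is_Cm m f -> (size l <= m)%N ->
  perm_eq l l' -> parts l f = parts l' f.
Proof.
move=> Hf; elim: l l' => [|i l IH] l' lm pl.
  by move: pl; rewrite perm_sym => /perm_nilP ->.
have il' : i \in l' by rewrite -(perm_mem pl) mem_head.
move: pl lm; case/splitPr: il' => l1 l2.
rewrite perm_sym -cat1s perm_catCA perm_cons perm_sym => pl lm.
rewrite /= (IH _ (ltnW lm) pl).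
have {lm} : (size (l1 ++ l2) < m)%N by rewrite -(perm_size pl).
elim: l1 {pl} => [//|j l1 IH1] /= lm.
rewrite -(IH1 (ltnW lm)); apply: partial_comm.
- by move=> k y; apply: parts_derivable Hf _; rewrite ltnW.
- by move=> k l0 y; exact: (@parts_derivable _ m (k :: l1 ++ l2) f l0 y Hf).
- move=> k l0; have := @is_Cm_parts _ m [:: l0, k & l1 ++ l2] f Hf lm.
  exact: is_Cm_continuous.
Qed.

Lemma mi_seq_surj m (l : seq 'I_d) : (size l <= m)%N ->
  exists a : multi_index d m, perm_eq l (mi_seq a).
Proof.
move=> lm; exists [ffun i => inord (count_mem i l)].
rewrite /perm_eq; apply/allP => /= i _; apply/eqP.
rewrite /mi_seq count_flatten -map_comp sumnE big_map big_enum /= (bigD1 i)//= big1.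
  rewrite addn0 ffunE inordK ?ltnS; last by rewrite (leq_trans (count_size _ _)).
  by rewrite count_nseq /= eqxx mul1n.
by move=> j ji; rewrite count_nseq /= (negbTE ji).
Qed.

End parts.

(** * Comparison of the Euclidean and sup norms *)

Section enorm.
Variables (R : realType) (d : nat).
Implicit Type x : 'rV[R]_d.

Lemma enorm_ge0 x : 0 <= enorm x. Proof. exact: sqrtr_ge0. Qed.

Lemma entry_le_enorm x j : `|x 0 j| <= enorm x.
Proof.
rewrite -sqrtr_sqr ler_wsqrtr// (bigD1 j)//= lerDl sumr_ge0// => i _.
exact: sqr_ge0.
Qed.

Lemma norm_le_enorm x : `|x| <= enorm x.
Proof. by apply: mx_norm_ler => [|i j]; rewrite ?enorm_ge0// ord1 entry_le_enorm. Qed.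

Lemma enorm_le_sum x : enorm x <= \sum_j `|x 0 j|.
Proof.
have s0 : 0 <= \sum_j `|x 0 j| by apply: sumr_ge0.
rewrite -[leRHS]ger0_norm// -sqrtr_sqr ler_wsqrtr// expr2 mulr_suml.
apply: ler_sum => i _; rewrite -real_normK ?num_real// expr2 ler_wpM2l//.
by rewrite (bigD1 i)//= lerDl sumr_ge0.
Qed.

Lemma enorm_le_norm x : enorm x <= d%:R * `|x|.
Proof.
rewrite (le_trans (enorm_le_sum x))//.
apply: (@le_trans _ _ (\sum_(j < d) `|x|)); last by rewrite sumr_const card_ord mulr_natl.
by apply: ler_sum => i _; exact: ler_mx_entry.
Qed.

End enorm.

(** * From coordinate families to C^m_0 vector fields and their norms *)

Section Cm0.
Variables (R : realType) (d m : nat).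
Local Notation tau1 := (fun _ : unit => 1 : R).

Lemma vanishing_bounded (f : 'rV[R]_d -> R) : continuous f -> vanishing f ->
  exists2 B : R, 0 <= B & forall x, `|f x| <= B.
Proof.
move=> cf vf; have [M HM] := vf 1 ltr01.
(* The absolute value of [M] keeps [K] nonempty even when [M] is negative. *)
pose K := [set x : 'rV[R]_d | `|x| <= `|M|].
have cK : compact K.
  apply: bounded_closed_compact.
    by exists `|M|; split=> // y yM x /= xM; rewrite (le_trans xM)// ltW.
  rewrite (_ : K = (fun x => `|x|) @^-1` [set y | y <= `|M|])//.
  apply: preimage_closed; last exact: closed_le.
  by move=> x _; exact: norm_continuous.
have K0 : K !=set0 by exists 0; rewrite /K /= normr0.
have cf' : {within K, continuous (fun x => `|f x|)}.
  apply: continuous_subspaceT => x; exact: (cvg_norm (cf x)).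
have [c _ Hc] := compact_EVT_max K0 cK cf'.
exists (Num.max `|f c| 1); first by rewrite le_max ler01 orbT.
move=> x; rewrite le_max; case: (leP `|x| `|M|) => xM.
  by rewrite (Hc x)// inE.
by rewrite (ltW (HM x _)) ?orbT// (le_lt_trans _ xM)// ler_norm.
Qed.

Lemma reg_unit (k : nat) (f : 'rV[R]_d -> R) : is_Cm k f ->
  (forall l : seq 'I_d, (size l <= k)%N -> vanishing (parts l f)) ->
  reg tau1 k (fun _ => f).
Proof.
elim: k f => [|k IH] f Hf Hv.
  split=> //; split; [move=> _; exact: is_Cm_continuous Hf| |move=> _; exact: (Hv [::])].
  have [B B0 HB] := vanishing_bounded (is_Cm_continuous Hf) (Hv [::] isT).
  by exists B => // _ x; rewrite mulr1.
split.
  split; [move=> _; exact: is_Cm_continuous Hf| |move=> _; exact: (Hv [::])].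
  have [B B0 HB] := vanishing_bounded (is_Cm_continuous Hf) (Hv [::] isT).
  by exists B => // _ x; rewrite mulr1.
move=> i; have [df Pf] := Hf.2 i; exists (fun _ => partial i f).
  by move=> _ x; exact: derivableP.
apply: IH => // l lk; have := Hv (rcons l i); rewrite size_rcons ltnS => /(_ lk).
by rewrite /parts foldr_rcons.
Qed.

Lemma is_Cm0_reg (f : 'rV[R]_d -> 'rV[R]_d) j : is_Cm0 m f ->
  reg tau1 m (fun _ x => f x 0 j).
Proof.
move=> [Hf Hv]; apply: reg_unit; first exact: (proj2 (is_Cm_coordP _ _) Hf).
move=> l lm; have [a pa] := mi_seq_surj lm.
rewrite (parts_perm _ lm pa); last exact: (proj2 (is_Cm_coordP _ _) Hf).
have am : (order_mi a <= m)%N by rewrite -size_mi_seq -(perm_size pa).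
move=> e e0; have [M HM] := Hv a am e e0.
exists M => x xM; rewrite -(parts_coord _ _ Hf) ?size_mi_seq// -mpartialE.
rewrite (le_lt_trans (entry_le_enorm _ _))// HM// (lt_le_trans xM)//.
exact: norm_le_enorm.
Qed.

Variables (T : Type) (tau : T -> R).
Hypothesis tau01 : forall t, 0 <= tau t <= 1.

Lemma reg_parts k l F : reg tau k F -> (size l <= k)%N ->
  C0fam tau (fun t : T => @parts R d _ l (F t)).
Proof.
move=> HF lk; suff : reg tau (k - size l) (fun t : T => parts l (F t)) by move/reg_C0.
elim: l lk => [|i l IH] /= lk; first by rewrite subn0.
have := IH (ltnW lk); rewrite -[(k - size l)%N]prednK ?subn_gt0//.
by rewrite -subnS => /(reg_partial i)[].
Qed.

Variable F : 'I_d -> T -> 'rV[R]_d -> R.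
Hypothesis regF : forall j, reg tau m (F j).

Lemma reg_row_is_Cm t : is_Cm m (fun x => \row_j F j t x).
Proof.
apply/is_Cm_coordP => j; rewrite (_ : (fun _ => _) = F j t); first exact: reg_is_Cm (regF j).
by apply/funext => x; rewrite mxE.
Qed.

Lemma mpartial_row (a : multi_index d m) t x : (order_mi a <= m)%N ->
  enorm (mpartial a (fun x => \row_j F j t x) x) <= \sum_j `|parts (mi_seq a) (F j t) x|.
Proof.
move=> am; rewrite (le_trans (enorm_le_sum _))//; apply: ler_sum => j _.
rewrite mpartialE (parts_coord _ _ (reg_row_is_Cm t)) ?size_mi_seq//.
rewrite (_ : (fun y => _) = F j t)//.
by apply/funext => y; rewrite mxE.
Qed.

Lemma reg_row_is_Cm0 t : is_Cm0 m (fun x => \row_j F j t x).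
Proof.
split; first exact: reg_row_is_Cm.
move=> a am e e0.
(* Dividing by [d.+1] rather than [d] makes the sum of [d] such terms strictly smaller than [e] and
   is safe for [d = 0]. *)
have e0' : 0 < e / d.+1%:R by rewrite divr_gt0.
have H j : {M : R | forall x, M < `|x| -> `|parts (mi_seq a) (F j t) x| < e / d.+1%:R}.
  apply: cid; have := reg_parts (regF j) (_ : (size (mi_seq a) <= m)%N).
  by rewrite size_mi_seq => /(_ am) [_ _ /(_ t)]; apply.
(* The factor [d] converts the Euclidean threshold into a sup norm one, through [enorm_le_norm]. *)
exists (d%:R * \sum_j `|sval (H j)|) => x xM.
have xM' j : sval (H j) < `|x|.
  apply: (@le_lt_trans _ _ (\sum_j `|sval (H j)|)).
    rewrite (bigD1 j)//= (le_trans (ler_norm _))// lerDl sumr_ge0//.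
  have := lt_le_trans xM (enorm_le_norm x).
  have [d0|d0] := ltrP 0 (d%:R : R); first by rewrite ltr_pM2l.
  have : d%:R == 0 :> R by rewrite eq_le d0 ler0n.
  by move=> /eqP ->; rewrite !mul0r ltxx.
rewrite (le_lt_trans (mpartial_row _ _ am))//.
apply: (@le_lt_trans _ _ (\sum_(j < d) (e / d.+1%:R))).
  by apply: ler_sum => j _; rewrite ltW// (svalP (H j)).
rewrite sumr_const card_ord -[X in X < _]mulr_natr -mulrA gtr_pMr//.
by rewrite mulrC ltr_pdivrMr// mul1r ltr_nat.
Qed.

(** This is the purpose of working with families: a single constant serves all parameters, so the
    C^m norm of the displacement is O(tau). *)
Lemma reg_row_normCm : exists2 C : R, 0 <= C &
  forall t, normCm m (fun x => \row_j F j t x) <= C * tau t.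
Proof.
have H (a : multi_index d m) : {C : R | 0 <= C /\ forall t, (order_mi a <= m)%N ->
    sup (range (fun x => enorm (mpartial a (fun x => \row_j F j t x) x))) <= C * tau t}.
  apply: cid; have [am|] := boolP (order_mi a <= m)%N; last by exists 0.
  have H j : {B : R | 0 <= B /\ forall t x, `|parts (mi_seq a) (F j t) x| <= B * tau t}.
    apply: cid; have := reg_parts (regF j) (_ : (size (mi_seq a) <= m)%N).
    by rewrite size_mi_seq => /(_ am) [_ [B ? ?] _]; exists B.
  exists (\sum_j sval (H j)); split.
    by apply: sumr_ge0 => j _; have [] := svalP (H j).
  move=> t _; apply: ge_sup; first by exists (enorm (mpartial a (fun x => \row_j F j t x) 0)), 0.
  move=> _ [x _ <-]; rewrite (le_trans (mpartial_row _ _ am))// mulr_suml.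
  by apply: ler_sum => j _; have [_] := svalP (H j); exact.
exists (\sum_(a : multi_index d m | (order_mi a <= m)%N) sval (H a)).
  by apply: sumr_ge0 => a _; have [] := svalP (H a).
move=> t; rewrite /normCm mulr_suml; apply: ler_sum => a am.
by have [_] := svalP (H a); exact.
Qed.

End Cm0.

(** When the range is unbounded the inequality still holds, [sup] then being 0. *)
Lemma sup_range_ge0 (R : realType) (T : Type) (f : T -> R) : (forall x, 0 <= f x) ->
  0 <= sup (range f).
Proof.
move=> f0; have [hs|/sup_out ->//] := pselect (has_sup (range f)).
have [[y [x _ xy]] ub] := hs; rewrite (le_trans (f0 x))//.
by apply: ub_le_sup => //; exists x.
Qed.

Lemma normCm_ge0 (R : realType) (d m : nat) (f : 'rV[R]_d -> 'rV[R]_d) : 0 <= normCm m f.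
Proof.
apply: sumr_ge0 => a _; apply: sup_range_ge0 => x; exact: enorm_ge0.
Qed.

Lemma is_Cm0_bounded (R : realType) (d m : nat) (f : 'rV[R]_d -> 'rV[R]_d) x : is_Cm0 m f ->
  `|f x| <= normCm m f.
Proof.
move=> Hf; pose a0 : multi_index d m := [ffun=> ord0].
have o0 : order_mi a0 = 0%N by rewrite /order_mi big1// => i _; rewrite ffunE.
have E : mpartial a0 f = f by rewrite mpartialE (size0nil (s := mi_seq a0)) ?size_mi_seq.
rewrite /normCm (bigD1 a0)//=; last by rewrite o0.
apply: (@le_trans _ _ (sup (range (fun x => enorm (mpartial a0 f x))))); last first.
  rewrite lerDl; apply: sumr_ge0 => a _; apply: sup_range_ge0 => y; exact: enorm_ge0.
rewrite (le_trans (norm_le_enorm _))// E; apply: ub_le_sup; last by exists x.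
(* The supremum is meaningful only for a bounded range, so a bound on each coordinate is produced
   first. *)
have H j : {B : R | forall x, `|f x 0 j| <= B}.
  apply: cid; have /reg_C0[_ [B _ HB] _] := is_Cm0_reg j Hf.
  by exists B => y; rewrite -[B]mulr1; exact: (HB tt).
exists (\sum_j sval (H j)) => _ [y _ <-]; rewrite (le_trans (enorm_le_sum _))//.
by apply: ler_sum => j _; exact: (svalP (H j)).
Qed.

(** * Diffeomorphisms near the identity *)

Section near_identity.
Variables (R : realType) (d : nat).
Local Notation tau1 := (fun _ : unit => 1 : R).
Let tau1_01 (t : unit) : 0 <= tau1 t <= 1. Proof. by rewrite ler01 lexx. Qed.

(** Far out the entries of [M] are at most [1 / (2 * (d + 1))], so the system is dominated by its
    diagonal: a right-hand side below [e / 4] gives [|V| <= e / 4 + |V| / 2], hence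
    [|V| <= e / 2 < e]. Boundedness then follows from continuity and decay. *)
Lemma C0fam_solve (M : 'I_d -> 'I_d -> 'rV[R]_d -> R) (X : 'I_d -> 'rV[R]_d -> R) :
  (forall l j, C0fam tau1 (fun _ => M l j)) -> (forall l, continuous (X l)) ->
  (forall l, C0fam tau1 (fun _ x => X l x + \sum_j M l j x * X j x)) ->
  forall l, C0fam tau1 (fun _ => X l).
Proof.
move=> HM cX HY l.
have vX : vanishing (X l).
  move=> e e0.
  have e4 : 0 < e / 4 by rewrite divr_gt0.
  have HA a : {N : R | forall x, N < `|x| -> `|X a x + \sum_j M a j x * X j x| < e / 4}.
    by apply: cid; have [_ _ /(_ tt)] := HY a; apply.
  have d2 : 0 < (2 * d.+1%:R)^-1 :> R by rewrite invr_gt0 mulr_gt0.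
  have HB (p : 'I_d * 'I_d) : {N : R | forall x, N < `|x| -> `|M p.1 p.2 x| < (2 * d.+1%:R)^-1}.
    by apply: cid; have [_ _ /(_ tt)] := HM p.1 p.2; apply.
  exists (\sum_a `|sval (HA a)| + \sum_p `|sval (HB p)|) => x xM.
  have sA : 0 <= \sum_a `|sval (HA a)| by apply: sumr_ge0.
  have sB : 0 <= \sum_p `|sval (HB p)| by apply: sumr_ge0.
  have hA a : `|X a x + \sum_j M a j x * X j x| < e / 4.
    apply: (svalP (HA a)); apply: le_lt_trans xM; rewrite (le_trans (ler_norm _))//.
    by rewrite ler_wpDr// (bigD1 a)//= lerDl sumr_ge0.
  have hB a j : `|M a j x| < (2 * d.+1%:R)^-1.
    apply: (svalP (HB (a, j))); apply: le_lt_trans xM; rewrite (le_trans (ler_norm _))//.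
    by rewrite ler_wpDl// (bigD1 (a, j))//= lerDl sumr_ge0.
  pose V : 'rV[R]_d := \row_a X a x.
  have hV a : `|X a x| <= `|V| by rewrite (le_trans _ (ler_mx_entry V 0 a))// mxE.
  have VV : `|V| <= e / 4 + 2^-1 * `|V|.
    apply: mx_norm_ler; first by rewrite addr_ge0// ?mulr_ge0// ltW.
    move=> b a; rewrite mxE.
    have -> : X a x = (X a x + \sum_j M a j x * X j x) - \sum_j M a j x * X j x by rewrite addrK.
    rewrite (le_trans (ler_normB _ _))// lerD//; first by rewrite ltW.
    rewrite (le_trans (ler_norm_sum _ _ _))//.
    apply: (@le_trans _ _ (\sum_(j < d) (2 * d.+1%:R)^-1 * `|V|)).
      by apply: ler_sum => j _; rewrite normrM ler_pM// ltW.
    rewrite sumr_const card_ord -mulrnAl ler_wpM2r//.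
    rewrite -[X in X <= _]mulr_natr invfM -mulrA ler_piMr// mulrC ler_pdivrMr// mul1r.
    by rewrite ler_nat.
  have := hV l; lra.
split=> [_|//|_ //]; first exact: cX.
by have [B B0 HB] := vanishing_bounded (cX l) vX; exists B => // _ x; rewrite mulr1.
Qed.

(* The derivative of an inverse diffeomorphism, minus the identity, solves such a
   system, [M l j] being the partial derivatives of the displacement of the
   diffeomorphism, taken at the preimage. *)
Lemma reg_solve k (M : 'I_d -> 'I_d -> 'rV[R]_d -> R) (X : 'I_d -> 'rV[R]_d -> R) :
  (forall l j, reg tau1 k (fun _ => M l j)) -> (forall l, is_Cm k (X l)) ->
  (forall l, reg tau1 k (fun _ x => X l x + \sum_j M l j x * X j x)) ->
  forall l, reg tau1 k (fun _ => X l).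
Proof.
elim: k M X => [|k IH] M X HM HX HY l.
  split=> //; apply: (@C0fam_solve M).
  - by move=> a j; exact: reg_C0 (HM a j).
  - by move=> a; exact: is_Cm_continuous (HX a).
  - by move=> a; exact: reg_C0 (HY a).
split.
  apply: (@C0fam_solve M).
  - by move=> a j; exact: reg_C0 (HM a j).
  - by move=> a; exact: is_Cm_continuous (HX a).
  - by move=> a; exact: reg_C0 (HY a).
move=> i; exists (fun _ => partial i (X l)).
  by move=> _ x; apply: derivableP; have [_ /(_ i)[]] := HX l.
(* The derivatives of the [X l] solve a system with the same matrix [M]; the new right-hand side is
   the derivative of the old one minus the sum of the [partial i (M a j) * X j]. *)
apply: (IH M (fun l => partial i (X l))).
- by move=> a j; exact: regW.
- by move=> a; have [_ /(_ i)[]] := HX a.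
move=> a.
have rX j : reg tau1 k (fun _ => X j).
  apply: (IH M) => //.
  - by move=> b c; exact: regW.
  - by move=> b; exact: is_Cm_le (HX b).
  - by move=> b; exact: regW.
have [_ rY] := reg_partial i (HY a).
have rS : reg tau1 k (fun _ x => \sum_j partial i (M a j) x * X j x).
  by apply: reg_sum => // j; apply: regM => //; have [] := reg_partial i (HM a j).
have := regB rY rS; congr (reg _ _ _); apply/funext => _; apply/funext => x.
have dX j : is_derive x (delta_mx 0 i) (X j) (partial i (X j) x).
  by apply: derivableP; have [_ /(_ i)[]] := HX j.
have dM j : is_derive x (delta_mx 0 i) (M a j) (partial i (M a j) x).
  by apply: derivableP; have [+ _] := reg_partial i (HM a j); apply; exact: tt.
have D : is_derive x (delta_mx 0 i) (fun x => X a x + \sum_j M a j x * X j x)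
    (partial i (X a) x + \sum_j (partial i (M a j) x * X j x + M a j x * partial i (X j) x)).
  apply: is_deriveD; apply: is_derive_sumfun => j; exact: is_deriveMfun.
rewrite {1}/partial (@derive_val _ _ _ _ _ _ _ D) big_split /=.
by rewrite addrA -[LHS]addrA [X in _ + X]addrC -addrA; ring.
Qed.

Definition near_id m (f : 'rV[R]_d -> 'rV[R]_d) : Prop :=
  forall j, reg tau1 m (fun _ x => (f x - x) 0 j).

Lemma near_id_row (f : 'rV[R]_d -> 'rV[R]_d) x : x + \row_j (f x - x) 0 j = f x.
Proof. by apply/rowP => j; rewrite !mxE subrKC. Qed.

Lemma near_id_comp m f g : near_id m f -> near_id m g -> near_id m (f \o g).
Proof.
move=> Hf Hg j.
have := regD (reg_comp tau1_01 (Hf j) Hg) (Hg j); congr (reg _ _ _).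
apply/funext => _; apply/funext => x; rewrite near_id_row !mxE /=; ring.
Qed.

Lemma near_id_is_Cm m f : near_id m f -> is_Cm m f.
Proof.
move=> Hf; rewrite (_ : f = fun x => (\row_j (f x - x) 0 j) + id x).
  by apply: is_CmD; [exact: (reg_row_is_Cm Hf tt)|exact: is_Cm_id].
by apply/funext => x; rewrite addrC near_id_row.
Qed.

Lemma near_id_is_Cm0 m f : near_id m f -> is_Cm0 m (fun x => f x - x).
Proof.
move=> Hf; rewrite (_ : (fun x => f x - x) = fun x => \row_j (f x - x) 0 j).
  exact: (reg_row_is_Cm0 Hf tt).
by apply/funext => x; apply/rowP => j; rewrite !mxE.
Qed.

Lemma Diff0_near_id m (f : Diff0 R d m) : near_id m f.
Proof. by move=> j; exact: is_Cm0_reg (diff_fun_Cm0 f). Qed.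

(** [Diff0] records decay at infinity for the diffeomorphism only. For the displacement [h] of the
    inverse, differentiating [h = - u \o g] gives [h' + (u' \o g) h' = - (u' \o g)], a system of the
    kind treated by [reg_solve]. The induction is on the order: class [k] for [h] gives class [k]
    for [u' \o g], hence for [h']. *)
Lemma Diff0_inv_near_id m (f : Diff0 R d m) : near_id m (diff_inv f).
Proof.
have Hu := Diff0_near_id f.
pose u j x := (f x - x) 0 j.
pose g := diff_inv f.
pose h j y := (g y - y) 0 j.
have hE j y : h j y = - u j (g y).
  by rewrite /h /u diff_invK -opprB !mxE.
have cg : continuous g by exact: is_Cm_continuous (diff_inv_Cm f).
have Ch j : is_Cm m (h j).
  apply: (proj2 (is_Cm_coordP m (fun y => g y - y)) _ j).
  apply: is_CmD; first exact: diff_inv_Cm.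
  by apply: is_CmN; exact: is_Cm_id.
suff H k : (k <= m)%N -> forall j, reg tau1 k (fun _ => h j) by exact: H.
elim: k => [|k IH] km j.
  split=> //.
  have := @C0fam_comp _ _ unit tau1 (fun _ => u j) (fun _ => g) (reg_C0 (Hu j)).
  move=> /(_ (fun _ => cg)) H.
  have : C0fam tau1 (fun _ y => u j (g y)).
    apply: H => _.
    have [C HC] := near_id_bounded tau1_01 tt (fun j => reg_C0 (Hu j)).
    exists C => y; have := HC (g y); rewrite near_id_row diff_invK.
    by rewrite distrC.
  move=> /(C0famZ (-1)); congr (C0fam _ _); apply/funext => _; apply/funext => y.
  by rewrite hE mulN1r.
have rh l : reg tau1 k (fun _ => h l) by apply: IH; exact: ltnW.
have gE y : y + \row_j h j y = g y by exact: near_id_row.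
have ru l i : reg tau1 k (fun _ => partial i (u l)).
  by have := reg_le km (Hu l) => /(reg_partial i)[].
have dh l i y : is_derive y (delta_mx 0 i) (h l) (partial i (h l) y).
  apply: derivableP; have := is_Cm_le km (Ch l); by move=> [_ /(_ i)[]].
have dg i y : derivable g y (delta_mx 0 i).
  by have := is_Cm_le km (diff_inv_Cm f); move=> [_ /(_ i)[]].
have Dg i y a : 'D_(delta_mx 0 i) g y 0 a = (a == i)%:R + partial i (h a) y.
  have Dgid := is_deriveB (derivableP (dg i y)) (is_derive_id y (delta_mx 0 i)).
  have dgid : derivable (fun y => g y - y) y (delta_mx 0 i) by case: Dgid.
  rewrite -(partial_coord _ dgid) /partial (@derive_val _ _ _ _ _ _ _ Dgid) !mxE eqxx /=.
  by rewrite subrKC.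
have rM l i : reg tau1 k (fun _ y => partial i (u l) (g y)).
  have := reg_comp tau1_01 (ru l i) rh; congr (reg _ _ _).
  by apply/funext => _; apply/funext => y; rewrite gE.
split.
  exact: reg_C0 (rh j).
move=> i; exists (fun _ => partial i (h j)); first by move=> _ y; exact: dh.
apply: (@reg_solve k (fun l j y => partial j (u l) (g y)) (fun l => partial i (h l))).
- by move=> l a; exact: rM.
- by move=> l; have [_ /(_ i)[]] := is_Cm_le km (Ch l).
move=> l; have := regN (rM l i); congr (reg _ _ _).
apply/funext => _; apply/funext => y.
have du a z : derivable (u l) z (delta_mx 0 a).
  have := is_Cm_le km (reg_is_Cm tt (Hu l)); by move=> [_ /(_ a)[]].
have cu a : {for g y, continuous (partial a (u l))}.
  exact: (reg_continuous (t := tt) (ru l a)).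
have D := is_derive_comp_partial du cu (dg i y).
have hN : h l = - (u l \o g) by apply/funext => z; rewrite hE.
have -> : partial i (h l) y = - \sum_j 'D_(delta_mx 0 i) g y 0 j * partial j (u l) (g y).
  by rewrite {1}/partial hN (@derive_val _ _ _ _ _ _ _ (is_deriveN D)).
under eq_bigr do rewrite Dg mulrDl.
rewrite big_split /= (bigD1 i)//= eqxx mul1r big1 ?addr0; last first.
  by move=> j' /negbTE ->; rewrite mul0r.
by rewrite opprD; under [X in _ = _ + X]eq_bigr do rewrite mulrC; rewrite subrK.
Qed.

Lemma Diff0_of_near_id m (f g : 'rV[R]_d -> 'rV[R]_d) : cancel f g -> cancel g f ->
  near_id m f -> near_id m g -> exists h : Diff0 R d m, diff_fun h = f /\ diff_inv h = g.
Proof.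
move=> fg gf Hf Hg.
by exists (MkDiff0 fg gf (near_id_is_Cm Hf) (near_id_is_Cm Hg) (near_id_is_Cm0 Hf)).
Qed.

Lemma Diff0_inverse m (f : Diff0 R d m) : exists h : Diff0 R d m,
  diff_fun h = diff_inv f /\ diff_inv h = f.
Proof.
by apply: Diff0_of_near_id; [exact: diff_invK|exact: diff_funK|exact: Diff0_inv_near_id|
  exact: Diff0_near_id].
Qed.

Lemma Diff0_compose m (f g : Diff0 R d m) : exists h : Diff0 R d m, diff_fun h = f \o g.
Proof.
have fg : cancel (f \o g) (diff_inv g \o diff_inv f) by move=> x /=; rewrite !diff_funK.
have gf : cancel (diff_inv g \o diff_inv f) (f \o g) by move=> x /=; rewrite !diff_invK.
have [||h [hE _]] := Diff0_of_near_id fg gf (m := m); last by exists h.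
- by apply: near_id_comp; exact: Diff0_near_id.
- by apply: near_id_comp; exact: Diff0_inv_near_id.
Qed.

End near_identity.

(** * Bump functions *)

Lemma is_derive_coord (R : realType) (d : nat) (i j : 'I_d) (x : 'rV[R]_d) :
  is_derive x (delta_mx 0 i) (fun y : 'rV[R]_d => y 0 j) (j == i)%:R.
Proof.
have did := @derivable_id R _ x (delta_mx 0 i : 'rV[R]_d).
split; first by have /derivable_mxP/(_ 0 j) := did.
have := partial_coord j did; rewrite /partial => <-.
by rewrite derive_id mxE eqxx.
Qed.

(* [rbump] and [rbump_coord] generate an algebra stable under differentiation, so
   they are smooth and vanish at infinity with their derivatives; a C^m function
   with compact support is then obtained as a power of [max 0 (rbump - r0)]. *)
Section rational_bump.
Variables (R : realType) (d : nat) (p : 'rV[R]_d).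
Local Notation tau1 := (fun _ : unit => 1 : R).
Let tau1_01 (t : unit) : 0 <= tau1 t <= 1. Proof. by rewrite ler01 lexx. Qed.

Definition sqdist (y : 'rV[R]_d) : R := \sum_i (y 0 i - p 0 i) * (y 0 i - p 0 i).
Definition rbump (y : 'rV[R]_d) : R := (1 + sqdist y)^-1.
Definition rbump_coord i (y : 'rV[R]_d) : R := (y 0 i - p 0 i) * rbump y.

Lemma sqdist_ge0 y : 0 <= sqdist y.
Proof. by apply: sumr_ge0 => i _; rewrite -expr2 sqr_ge0. Qed.

Lemma sqdist_entry (y : 'rV[R]_d) i : `|y 0 i - p 0 i| ^+ 2 <= sqdist y.
Proof.
rewrite real_normK ?num_real// /sqdist (bigD1 i)//= -expr2 lerDl.
by apply: sumr_ge0 => j _; rewrite -expr2 sqr_ge0.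
Qed.

Lemma norm_sqdist (y : 'rV[R]_d) : `|y - p| ^+ 2 <= sqdist y.
Proof.
suff : `|y - p| <= Num.sqrt (sqdist y).
  by move=> /(lerXn2r 2); rewrite !nnegrE sqr_sqrtr ?sqdist_ge0// => ->.
apply: mx_norm_ler => // a i; rewrite ord1 !mxE -[leLHS]sqrtr_sqr ler_wsqrtr//.
by rewrite -[X in X <= _]real_normK ?num_real// sqdist_entry.
Qed.

Lemma sqdist1_gt0 y : 0 < 1 + sqdist y.
Proof. by rewrite ltr_pwDl// sqdist_ge0. Qed.

Lemma rbump_gt0 y : 0 < rbump y.
Proof. by rewrite invr_gt0 sqdist1_gt0. Qed.

Lemma rbump_le1 y : rbump y <= 1.
Proof. by rewrite invf_le1 ?sqdist1_gt0// lerDl sqdist_ge0. Qed.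

Lemma coord_le_sqdist (y : 'rV[R]_d) i : `|y 0 i - p 0 i| <= 1 + sqdist y.
Proof.
have := sqdist_entry y i; set z := `|_| => h.
apply: (@le_trans _ _ (1 + z ^+ 2)); last by rewrite lerD2l.
have := sqr_ge0 (z - 2^-1); rewrite expr2 [z ^+ 2]expr2; lra.
Qed.

Lemma rbump_coord_le1 i y : `|rbump_coord i y| <= 1.
Proof.
rewrite /rbump_coord normrM (gtr0_norm (rbump_gt0 y)) ler_pdivrMr ?sqdist1_gt0//.
by rewrite mul1r coord_le_sqdist.
Qed.

Lemma is_derive_sqdist j y :
  is_derive y (delta_mx 0 j) sqdist (2 * (y 0 j - p 0 j)).
Proof.
have D i : is_derive y (delta_mx 0 j) (fun y : 'rV[R]_d => y 0 i - p 0 i) ((i == j)%:R - 0).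
  exact: (is_deriveBfun (is_derive_coord j i y) (is_derive_cstfun _ _ _)).
apply: is_derive_eq (is_derive_sumfun _ (fun i => is_deriveMfun (D i) (D i))) _.
rewrite (bigD1 j)//= eqxx subr0 big1 ?addr0; last first.
  by move=> i /negbTE ->; rewrite subr0 mul0r mulr0 addr0.
by rewrite mul1r mulr1; ring.
Qed.

Lemma is_derive_rbump j y :
  is_derive y (delta_mx 0 j) rbump (- 2 * (rbump_coord j y * rbump y)).
Proof.
have D : is_derive y (delta_mx 0 j) (fun y => 1 + sqdist y) (0 + 2 * (y 0 j - p 0 j)).
  exact: (is_deriveDfun (is_derive_cstfun _ _ _) (is_derive_sqdist j y)).
have n0 : 1 + sqdist y != 0 := lt0r_neq0 (sqdist1_gt0 y).
split; first by apply: derivableV => //; case: D.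
rewrite deriveV// (@derive_val _ _ _ _ _ _ _ D) add0r /rbump_coord /rbump.
transitivity (- (1 + sqdist y) ^- 2 * (2 * (y 0 j - p 0 j))); first by [].
by field.
Qed.

Lemma is_derive_rbump_coord i j y : is_derive y (delta_mx 0 j) (rbump_coord i)
  ((i == j)%:R * rbump y + (- 2) * (rbump_coord i y * rbump_coord j y)).
Proof.
have D : is_derive y (delta_mx 0 j) (fun y : 'rV[R]_d => y 0 i - p 0 i) ((i == j)%:R - 0).
  exact: (is_deriveBfun (is_derive_coord j i y) (is_derive_cstfun _ _ _)).
apply: is_derive_eq (is_deriveMfun D (is_derive_rbump j y)) _.
by rewrite /rbump_coord; ring.
Qed.

Lemma sqdist_continuous : continuous sqdist.
Proof.
move=> y; apply: (@cvg_sumr R _ (nbhs y) _) => i _.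
have c : (fun y : 'rV[R]_d => y 0 i - p 0 i) @ y --> y 0 i - p 0 i.
  exact: (cvgB (@coord_continuous R 1 d 0 i y) (cvg_cst _)).
exact: (cvgM c c).
Qed.

Lemma rbump_continuous : continuous rbump.
Proof.
move=> y; have n0 : 1 + sqdist y != 0 := lt0r_neq0 (sqdist1_gt0 y).
exact: (cvgV n0 (cvgD (cvg_cst _) (@sqdist_continuous y))).
Qed.

Lemma rbump_vanishing : vanishing rbump /\ forall i, vanishing (rbump_coord i).
Proof.
have key e x : 0 < e -> e^-1 + `|p| < `|x| -> rbump x < e /\ forall i, `|rbump_coord i x| < e.
  move=> e0 xM.
  have N1 : e^-1 < `|x - p|.
    rewrite -ltrBrDr in xM; apply: (lt_le_trans xM); rewrite lerBlDr.
    by rewrite -{1}(subrK p x) ler_normD.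
  have N0 : 0 < `|x - p| by rewrite (lt_trans _ N1)// invr_gt0.
  have N2 := norm_sqdist x; rewrite expr2 in N2.
  have eN : 1 < e * `|x - p| by rewrite -ltr_pdivrMl// mulr1.
  split=> [|i].
    rewrite /rbump invf_plt ?posrE ?sqdist1_gt0//.
    have := sqr_ge0 (`|x - p| - 1); rewrite expr2 => h; nra.
  rewrite /rbump_coord normrM (gtr0_norm (rbump_gt0 x)) ltr_pdivrMr ?sqdist1_gt0//.
  have h : `|x 0 i - p 0 i| <= `|x - p|.
    by have := ler_mx_entry (x - p) 0 i; rewrite !mxE.
  apply: (le_lt_trans h); nra.
split=> [|i] e e0; exists (e^-1 + `|p|) => x /(key _ _ e0)[h1 h2] //.
by rewrite gtr0_norm// rbump_gt0.
Qed.

Lemma rbump_reg k : reg tau1 k (fun _ => rbump) /\ forall i, reg tau1 k (fun _ => rbump_coord i).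
Proof.
have [v1 v2] := rbump_vanishing.
have C1 : C0fam tau1 (fun _ => rbump).
  split=> [_|//|//]; first exact: rbump_continuous.
  by exists 1 => // _ x; rewrite mulr1 gtr0_norm ?rbump_gt0// rbump_le1.
have C2 i : C0fam tau1 (fun _ => rbump_coord i).
  split=> [_ y|//|//]; last by exists 1 => // _ x; rewrite mulr1 rbump_coord_le1.
  have c : (fun y : 'rV[R]_d => y 0 i - p 0 i) @ y --> y 0 i - p 0 i.
    exact: (cvgB (@coord_continuous R 1 d 0 i y) (cvg_cst _)).
  exact: (cvgM c (@rbump_continuous y)).
elim: k => [|k [IH1 IH2]]; first by split=> [|i]; split.
split=> [|i]; split=> // j.
  exists (fun _ y => - 2 * (rbump_coord j y * rbump y)).
    by move=> _ y; exact: is_derive_rbump.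
  by apply: regZ; apply: regM.
exists (fun _ y => (i == j)%:R * rbump y + - 2 * (rbump_coord i y * rbump_coord j y)).
  by move=> _ y; exact: is_derive_rbump_coord.
by apply: regD; apply: regZ => //; apply: regM.
Qed.

End rational_bump.

Lemma is_derive_pos_pow (R : realType) (n : nat) (s : R) :
  is_derive s 1 (fun x => Num.max 0 x ^+ n.+2) (n.+2%:R * Num.max 0 s ^+ n.+1).
Proof.
case: (ltrgtP s 0) => s0.
- apply: (@near_eq_is_derive _ _ _ (cst 0)).
  + near=> x; rewrite /= max_l ?expr0n//.
    by apply: ltW; near: x; exact: lt_nbhsl.
  + by rewrite expr0n mulr0; exact: is_derive_cst.
- apply: (@near_eq_is_derive _ _ _ (id ^+ n.+2 : R -> R)).
  + near=> x; rewrite fctE max_r//.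
    by rewrite -oppr_le0 ltW//; near: x; apply: Nlt_nbhsl; rewrite oppr_lt0.
  + apply: is_derive_eq (is_deriveX _ (is_derive_id _ _)) _.
    by rewrite [LHS]mulr1.
(* At the corner the difference quotient is at most [|h|] in absolute value for [|h| < 1], the
   exponent being at least 2. *)
- rewrite s0 expr0n mulr0.
  pose f (x : R) := Num.max 0 x ^+ n.+2.
  have key : (fun h : R => h^-1 *: ((f \o shift 0) (h *: (1 : R)) - f 0)) @ 0^' --> (0 : R).
    apply/cvgrPdist_lt => e e0; near=> h.
    rewrite sub0r normrN /f /= maxxx expr0n subr0 addr0 [h *: 1]mulr1.
    have h0 : h != 0 by near: h; exact: nbhs_dnbhs_neq.
    have h1 : `|h| < 1 by near: h; exact: dnbhs0_lt.
    have he : `|h| < e by near: h; exact: dnbhs0_lt.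
    apply: le_lt_trans he; rewrite [_ *: _]/(_ * _) normrM normfV ler_pdivrMl ?normr_gt0//.
    have hm : `|Num.max 0 h| <= `|h|.
      by case: (leP 0 h) => // _; rewrite normr0.
    rewrite normrX (le_trans (lerXn2r _ _ _ hm)) ?nnegrE//.
    by rewrite -expr2 -addn2 exprD ler_piMl// exprn_ile1// ltW.
  by split; [apply/cvg_ex; eexists; exact: key|exact/cvg_lim].
Unshelve. all: by end_near. Qed.

Lemma is_derive_comp1 (R : realType) (V : normedModType R) (f : V -> R) (phi : R -> R)
    (x v : V) (df dphi : R) : is_derive x v f df -> is_derive (f x) 1 phi dphi ->
  is_derive x v (fun y => phi (f y)) (dphi * df).
Proof.
move=> [d1 e1] [d2 e2]; pose g (s : R) := f (s *: v + x).
have g0 : g 0 = f x by rewrite /g scale0r add0r.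
have dg : derivable g 0 1 by have /derivable1P := d1.
have d2' : derivable phi (g 0) 1 by rewrite g0.
have dd : differentiable (phi \o g) 0.
  by apply: differentiable_comp; apply/derivable1_diffP.
split; first by apply/derivable1P; apply/derivable1_diffP.
have E (h : V -> R) : derivable h x v -> 'D_v h x = (fun s : R => h (s *: v + x))^`()%classic 0.
  move=> dh; rewrite derive1E; have /= H := @is_derive_line R V _ h x v 0.
  rewrite scale0r add0r in H.
  by rewrite (@derive_val _ _ _ _ _ _ _ (H dh)).
have dc : derivable (fun y => phi (f y)) x v by apply/derivable1P; apply/derivable1_diffP.
rewrite E// (_ : (fun s : R => _) = phi \o g)// derive1_comp//.
by rewrite derive1E g0 e2 -E// e1.
Qed.

Lemma max0_continuous (R : realType) : continuous (fun x : R => Num.max 0 x).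
Proof.
rewrite (_ : (fun x => _) = fun x : R => 2^-1 * (x + `|x|)).
  by move=> x; exact: (cvgM (cvg_cst _) (cvgD cvg_id (cvg_norm cvg_id))).
by apply/funext => x; case: (leP 0 x) => x0; [rewrite ger0_norm//|rewrite ltr0_norm//]; lra.
Qed.

Section bump.
Variables (R : realType) (d : nat) (p : 'rV[R]_d) (rho : R).
Hypothesis rho0 : 0 < rho.
Local Notation tau1 := (fun _ : unit => 1 : R).
Let tau1_01 (t : unit) : 0 <= tau1 t <= 1. Proof. by rewrite ler01 lexx. Qed.
(** The value of [rbump p] on the Euclidean sphere of radius [rho] about [p], so that truncating at
    this level cuts the support down to the ball. *)
Let r0 : R := (1 + rho ^+ 2)^-1.

Definition cutoff n (y : 'rV[R]_d) : R := Num.max 0 (rbump p y - r0) ^+ n.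

Let r0_gt0 : 0 < r0.
Proof. by rewrite invr_gt0 ltr_pwDl// sqr_ge0. Qed.

Let r0_lt1 : r0 < 1.
Proof.
have h : 0 < rho ^+ 2 by rewrite exprn_gt0.
by rewrite /r0 invf_lt1 ?ltrDl// addr_gt0.
Qed.

Lemma cutoff1_le y : 0 <= Num.max 0 (rbump p y - r0) <= rbump p y.
Proof.
rewrite le_max lexx /= ge_max (ltW (rbump_gt0 p y)) /=.
by rewrite lerBlDr lerDl ltW.
Qed.

(** Each differentiation costs one power: the derivative of [cutoff n.+1] is a multiple of
    [cutoff n] times a derivative of [rbump p]. An exponent larger than the order therefore
    suffices. *)
Lemma cutoff_reg k n : (k < n)%N -> reg tau1 k (fun _ => cutoff n).
Proof.
have C n' : C0fam tau1 (fun _ => cutoff n'.+1).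
  have bnd y : `|cutoff n'.+1 y| <= rbump p y.
    have /andP[h0 h1] := cutoff1_le y.
    rewrite normrX ger0_norm// exprS (le_trans _ h1)// ler_piMr//.
    by rewrite exprn_ile1// (le_trans h1)// rbump_le1.
  split=> [_ y|//|_ e e0].
  - have c1 : (fun y => rbump p y - r0) @ y --> rbump p y - r0.
      exact: (cvgB (@rbump_continuous _ _ p y) (cvg_cst _)).
    have c2 : {for rbump p y - r0, continuous (fun x : R => Num.max 0 x ^+ n'.+1)}.
      have cm : (fun x : R => Num.max 0 x) @ (rbump p y - r0) --> Num.max 0 (rbump p y - r0).
        exact: max0_continuous.
      exact: (continuous_comp cm (@exprn_continuous R n'.+1 _)).
    exact: (continuous_cvg _ c2 c1).
  - by exists 1 => // _ x; rewrite mulr1 (le_trans (bnd x))// rbump_le1.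
  - have [v _] := rbump_vanishing p; have [M HM] := v e e0; exists M => x /HM.
    by rewrite (gtr0_norm (rbump_gt0 p x)); exact: le_lt_trans.
elim: k n => [|k IH] [|n] //.
rewrite ltnS => kn; split=> [|i]; first exact: C.
exists (fun _ y => n.+1%:R * (cutoff n y * partial i (rbump p) y)); last first.
  have [rr _] := rbump_reg p k.+1.
  by apply: regZ; apply: regM => //; [exact: IH|have [] := reg_partial i rr].
move=> _ y; case: n kn => [//|n] _.
have D : is_derive y (delta_mx 0 i) (fun y => rbump p y - r0) (partial i (rbump p) y - 0).
  have dr : derivable (rbump p) y (delta_mx 0 i) by case: (is_derive_rbump p i y).
  exact: (is_deriveBfun (derivableP dr) (is_derive_cstfun _ _ _)).
apply: is_derive_eq (is_derive_comp1 D (is_derive_pos_pow n _)) _.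
by rewrite subr0 mulrA.
Qed.

(** The value 1 is attained at [p] alone; this is what later identifies the vertices of a tuple in
    the equality case. The normalizing constant is the value of the cutoff at [p], where [rbump p]
    equals 1, and [m.+1] is the least exponent accepted by [cutoff_reg]. *)
Lemma bump_exists m : exists b : 'rV[R]_d -> R, [/\ reg tau1 m (fun _ => b),
  forall y, 0 <= b y <= 1, b p = 1, forall y, b y = 1 -> y = p &
  forall y, b y != 0 -> `|y - p| < rho].
Proof.
have r1 : 0 < 1 - r0 by rewrite subr_gt0.
have rp : rbump p p = 1.
  by rewrite /rbump /sqdist big1 ?addr0 ?invr1// => i _; rewrite subrr mul0r.
pose b y := (1 - r0) ^- m.+1 * cutoff m.+1 y.
have b01 y : 0 <= Num.max 0 (rbump p y - r0) <= 1 - r0.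
  by rewrite le_max lexx /= ge_max (ltW r1) /= lerB// rbump_le1.
exists b; split.
- by apply: regZ; exact: cutoff_reg.
- move=> y; have /andP[h0 h1] := b01 y; apply/andP; split.
    by rewrite mulr_ge0// ?exprn_ge0// invr_ge0 exprn_ge0// ltW.
  by rewrite /b ler_pdivrMl ?exprn_gt0// mulr1 lerXn2r// nnegrE// ltW.
- by rewrite /b /cutoff rp max_r ?(ltW r1)// mulVf// gt_eqF// exprn_gt0.
- move=> y /(congr1 (fun z => (1 - r0) ^+ m.+1 * z)).
  rewrite /b mulrA mulfV ?gt_eqF ?exprn_gt0// mul1r mulr1 /cutoff.
  have /andP[h0 h1] := b01 y.
  move=> /eqP; rewrite eqrXn2// ?(ltW r1)// => /eqP E.
  have {}E : rbump p y = 1.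
    move: E; case: (leP 0 (rbump p y - r0)) => _ E; last by lra.
    by apply: (addIr (- r0)).
  have : 1 + sqdist p y = 1 by apply: invr_inj; rewrite invr1.
  move=> /(congr1 (fun z => z - 1)); rewrite addrC addKr subrr => s0.
  have := norm_sqdist p y; rewrite s0 => n0.
  apply/eqP; rewrite -subr_eq0 -normr_eq0 -sqrf_eq0 eq_le n0 exprn_ge0//.
- move=> y; rewrite /b mulf_eq0 negb_or => /andP[_].
  rewrite /cutoff expf_eq0 /= => n0.
  have : r0 < rbump p y.
    rewrite -subr_gt0; move: n0; case: (leP 0 (rbump p y - r0)); last by rewrite eqxx.
    by rewrite lt_neqAle eq_sym => -> ->.
  have p1 : 0 < 1 + rho ^+ 2 by rewrite addr_gt0// exprn_gt0.
  rewrite /r0 /rbump ltf_pV2 ?posrE ?sqdist1_gt0// ltrD2l => h.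
  have := le_lt_trans (norm_sqdist p y) h.
  by rewrite ltr_pXn2r// nnegrE// ltW.
Qed.

End bump.

(** * Shears *)

Lemma cvg_subZ (R : realType) (V : normedModType R) (T : Type) (F : set_system T)
    {FF : Filter F} (c : T -> R) (y : T -> V) (v : V) (l : R) (y0 : V) :
  c @ F --> l -> y @ F --> y0 -> (fun t => y t - c t *: v) @ F --> y0 - l *: v.
Proof. by move=> hc hy; apply: cvgB => //; apply: cvgZr_tmp. Qed.

Lemma reg_at (R : realType) (d : nat) (T : Type) (tau : T -> R) (k : nat)
    (F : T -> 'rV[R]_d -> R) (t : T) : reg tau k F -> reg (fun _ : unit => 1) k (fun _ => F t).
Proof.
have H0 (G : T -> 'rV[R]_d -> R) : C0fam tau G -> C0fam (fun _ : unit => 1) (fun _ : unit => G t).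
  move=> [cG [B B0 bG] vG]; split=> [_|//|_]; [exact: cG| |exact: vG].
  by exists (`|B * tau t|) => // _ x; rewrite mulr1 (le_trans (bG t x))// ler_norm.
elim: k F => [|k IH] F HF; first by split=> //; apply: H0; exact: reg_C0 HF.
split; first by apply: H0; exact: reg_C0 HF.
move=> i; have [F' F1 F2] := HF.2 i; exists (fun _ => F' t); last exact: IH.
by move=> _ x; exact: F1.
Qed.

Lemma reg_scale (R : realType) (d : nat) (T : Type) (tau : T -> R) (k : nat)
    (b : 'rV[R]_d -> R) : (forall t, 0 <= tau t <= 1) -> reg (fun _ : unit => 1) k (fun _ => b) ->
  reg tau k (fun t x => tau t * b x).
Proof.
move=> tau01.
have H0 (G : 'rV[R]_d -> R) : C0fam (fun _ : unit => 1) (fun _ : unit => G) ->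
    C0fam tau (fun t x => tau t * G x).
  move=> [cG [B B0 bG] vG]; split=> [t x|//|t e e0].
  - exact: (cvgM (cvg_cst _) (cG tt x)).
  - exists B => // t x; have /andP[t0 t1] := tau01 t.
    rewrite normrM ger0_norm// mulrC ler_wpM2r//; have := bG tt x; by rewrite mulr1.
  - have [M HM] := vG tt e e0; exists M => x /HM; have /andP[t0 t1] := tau01 t.
    rewrite normrM ger0_norm//; apply: le_lt_trans; exact: ler_piMl.
elim: k b => [|k IH] b Hb; first by split=> //; apply: H0; exact: reg_C0 Hb.
split; first by apply: H0; exact: reg_C0 Hb.
move=> i; have [F' F1 F2] := Hb.2 i; exists (fun t x => tau t * F' tt x).
  by move=> t x; apply: is_deriveZfun; exact: F1.
apply: IH; exact: reg_at F2.
Qed.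

Section shear.
Variables (R : realType) (d m : nat) (b : 'rV[R]_d -> R) (v : 'rV[R]_d).
Local Notation tau1 := (fun _ : unit => 1 : R).
Hypothesis m_gt0 : (0 < m)%N.
Hypothesis b_reg : reg tau1 m (fun _ => b).
Hypothesis b01 : forall y, 0 <= b y <= 1.

Let db i y : derivable b y (delta_mx 0 i).
Proof. by have := reg_le m_gt0 b_reg => /(reg_partial i)[/(_ tt)]. Qed.

Let cdb i : continuous (partial i b).
Proof.
have [_ h] := reg_partial i (reg_le m_gt0 b_reg).
exact: (reg_continuous (t := tt) h).
Qed.

Let cb : continuous b.
Proof. exact: (reg_continuous (t := tt) b_reg). Qed.

Let pbound i : {B : R | 0 <= B /\ forall y, `|partial i b y| <= B}.
Proof.
apply: cid; have := reg_le m_gt0 b_reg => /(reg_partial i)[_ /reg_C0[_ [B B0 HB] _]].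
by exists B; split=> // y; rewrite -[B]mulr1; exact: (HB tt).
Qed.

Let C1 : R := \sum_i `|v 0 i| * sval (pbound i).
Let C2 : R := \sum_i sval (pbound i).
(** [C1] bounds the derivative of [b] along [v], so for [t <= t0] the quantity [t] times this
    derivative is at most 1/2 and the shear is strictly increasing along [v]. The added 1 avoids a
    zero denominator, and the cap at 1 keeps the parameters in the range required of [tau]. *)
Let t0 : R := Num.min 1 (2 * (C1 + 1))^-1.

Let C1_ge0 : 0 <= C1.
Proof. by apply: sumr_ge0 => i _; rewrite mulr_ge0//; have [] := svalP (pbound i). Qed.

Let t0_gt0 : 0 < t0.
Proof. by rewrite lt_min ltr01 invr_gt0 mulr_gt0// ltr_wpDl. Qed.

Let small t (z : 'I_d -> 'rV[R]_d) : 0 < t <= t0 ->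
  `|t * \sum_i v 0 i * partial i b (z i)| <= 2^-1.
Proof.
move=> /andP[tp tt0]; rewrite normrM gtr0_norm//.
apply: (@le_trans _ _ (t * C1)).
  rewrite ler_wpM2l ?(ltW tp)// (le_trans (ler_norm_sum _ _ _))// ler_sum// => i _.
  by rewrite normrM ler_wpM2l//; have [_] := svalP (pbound i); exact.
have : t <= (2 * (C1 + 1))^-1 by rewrite (le_trans tt0)// ge_min lexx orbT.
have c0 : 0 < 2 * (C1 + 1) by rewrite mulr_gt0// ltr_wpDl.
by rewrite -[_^-1]mulr1 ler_pdivlMl// => h; have := C1_ge0; nra.
Qed.

Let inv1 t (z : 'I_d -> 'rV[R]_d) : 0 < t <= t0 ->
  2^-1 <= 1 + t * \sum_i v 0 i * partial i b (z i).
Proof. by move=> /(small z); rewrite ler_norml => /andP[h _]; move: h; lra. Qed.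

(** Points move along the single direction [v], so the preimage has one scalar unknown, and the
    intermediate value theorem on [0, 1] finds it: [f 0 <= 0] and, since [t] and [b] are at most 1,
    [0 <= f 1]. *)
Let solution t (y : 'rV[R]_d) : 0 < t <= t0 -> {c : R | c = t * b (y - c *: v)}.
Proof.
move=> tt0; apply: cid.
have t1 : t <= 1 by case/andP: tt0 => _ h; rewrite (le_trans h)// ge_min lexx.
have tp : 0 <= t by case/andP: tt0 => /ltW.
pose f (c : R) := c - t * b (y - c *: v).
have cf : continuous f.
  move=> c; have h : (fun c => y - c *: v) @ c --> y - c *: v.
    exact: (@cvg_subZ R _ _ (nbhs c) _ _ _ v _ _ (@cvg_id _ (nbhs c)) (cvg_cst y)).
  have h1 : b (y - c *: v) @[c --> c] --> b (y - c *: v) by apply: continuous_cvg h; exact: cb.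
  exact: (cvgB (@cvg_id _ (nbhs c)) (cvgM (cvg_cst t) h1)).
have [|c _ fc] := @IVT R f 0 1 0 ler01 (continuous_subspaceT cf).
  rewrite ge_min le_max /f sub0r oppr_le0 mulr_ge0 ?(proj1 (andP (b01 _)))//=.
  rewrite subr_ge0; apply/orP; right; apply: (le_trans _ t1).
  by rewrite ler_piMr// (proj2 (andP (b01 _))).
by exists c; apply/eqP; rewrite -subr_eq0; apply/eqP.
Qed.

(** The identity behind the uniqueness, continuity and differentiability of the solution [c]: apply
    the mean value theorem to [b] between the two preimages and collect the terms in [c' - c]. By
    [inv1] the factor multiplying [c' - c] is at least 1/2. *)
Let increment t (y y' : 'rV[R]_d) c c' : c = t * b (y - c *: v) -> c' = t * b (y' - c' *: v) ->
  exists2 z : 'I_d -> 'rV[R]_d,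
    forall i, `|z i - (y - c *: v)| <= `|(y' - c' *: v) - (y - c *: v)| &
    (c' - c) * (1 + t * \sum_i v 0 i * partial i b (z i)) =
      t * \sum_i (y' - y) 0 i * partial i b (z i).
Proof.
move=> hc hc'; set x := y - c *: v; set x' := y' - c' *: v.
have [z z1 z2] := box_mvt x (x' - x) db; exists z => //.
have E : c' - c = t * \sum_i (x' - x) 0 i * partial i b (z i).
  by rewrite -z2 [x + _]addrC subrK mulrBr -hc -hc'.
rewrite mulrDr mulr1 {1}E mulrCA -mulrDr; congr (t * _).
rewrite mulr_sumr -big_split /=; apply: eq_bigr => i _.
by rewrite /x /x' !mxE; ring.
Qed.

Let uniqueness t (y : 'rV[R]_d) c c' : 0 < t <= t0 -> c = t * b (y - c *: v) ->
  c' = t * b (y - c' *: v) ->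
  c' = c.
Proof.
move=> tt0 hc hc'; have [z _ E] := increment hc hc'.
have := inv1 z tt0 => h.
have /eqP : (c' - c) * (1 + t * \sum_i v 0 i * partial i b (z i)) = 0.
  by rewrite E big1 ?mulr0// => i _; rewrite subrr mxE mul0r.
rewrite mulf_eq0 subr_eq0 => /orP[/eqP//|/eqP h0]; move: h; rewrite h0; lra.
Qed.

Let T := {t : R | 0 < t <= t0}.
Let tau (t : T) : R := sval t.
(* [y - c *: v] is the preimage of [y] under [y |-> y + (t * b y) *: v] exactly
   when [c = t * b (y - c *: v)]. *)
Let gam (t : T) (y : 'rV[R]_d) : R := sval (solution y (svalP t)).
Let inv_shear (t : T) (y : 'rV[R]_d) := y - gam t y *: v.

Let tau01 t : 0 <= tau t <= 1.
Proof.
have /andP[h1 h2] := svalP t.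
by rewrite ltW//= (le_trans h2)// ge_min lexx.
Qed.

Let gamE t y : gam t y = tau t * b (inv_shear t y).
Proof. exact: (svalP (solution y (svalP t))). Qed.

Let gam_continuous t : continuous (gam t).
Proof.
move=> y; apply: (proj2 (@cvgrPdist_lt _ _ _ (nbhs y) _ _ _)) => e e0.
have C20 : 0 <= C2 by apply: sumr_ge0 => i _; have [] := svalP (pbound i).
have e1 : 0 < e / (2 * C2 + 1) by rewrite divr_gt0// ltr_wpDl// mulr_ge0.
near=> y'.
have [z _ E] := increment (gamE t y) (gamE t y').
have h := inv1 z (svalP t).
have yy : `|y' - y| < e / (2 * C2 + 1).
  rewrite distrC; near: y'; exact: (proj1 (@cvgrPdist_lt _ _ _ (nbhs y) _ _ _) (@cvg_id _ (nbhs y))).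
have /andP[th t1] := tau01 t.
have : `|gam t y' - gam t y| * 2^-1 <= C2 * `|y' - y|.
  apply: (@le_trans _ _ (`|gam t y' - gam t y| * (1 + tau t * \sum_i v 0 i * partial i b (z i)))).
    exact: ler_wpM2l.
  have h0 : 0 <= 1 + tau t * \sum_i v 0 i * partial i b (z i) by rewrite (le_trans _ h).
  rewrite -[X in _ * X <= _]ger0_norm// -normrM E normrM (ger0_norm th).
  rewrite (@le_trans _ _ (1 * \sum_i sval (pbound i) * `|y' - y|))//; last first.
    by rewrite mul1r mulr_suml.
  rewrite ler_pM// (le_trans (ler_norm_sum _ _ _))// ler_sum// => i _.
  rewrite normrM mulrC ler_pM//; last exact: ler_mx_entry.
  by have [_] := svalP (pbound i); exact.
rewrite distrC; set A := `|_ - _| => h3.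
have : A <= 2 * C2 * `|y' - y| by rewrite -mulrA; lra.
move=> /le_lt_trans; apply.
apply: (@le_lt_trans _ _ (2 * C2 * (e / (2 * C2 + 1)))).
  by rewrite ler_wpM2l ?mulr_ge0// ltW.
rewrite mulrCA gtr_pMr// ltr_pdivrMr ?ltr_wpDl ?mulr_ge0//; lra.
Unshelve. all: by end_near. Qed.

Let shear_slope (t : T) y := tau t * \sum_i v 0 i * partial i b y.

(** Implicit differentiation in one unknown: [increment] gives the difference quotient exactly, with
    partial derivatives at intermediate points, and continuity of [gam] forces these points to the
    preimage of [y]. *)
Let gam_derive t y j : is_derive y (delta_mx 0 j) (gam t)
  (tau t * partial j b (inv_shear t y) / (1 + shear_slope t (inv_shear t y))).
Proof.
pose g := inv_shear t.
have cg : continuous g.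
  move=> x; exact: (@cvg_subZ R _ _ (nbhs x) _ _ _ v _ _ (@gam_continuous t x) (@cvg_id _ (nbhs x))).
pose E : 'rV[R]_d := delta_mx 0 j.
have H s : {z : 'I_d -> 'rV[R]_d |
    (forall i, `|z i - g y| <= `|g (s *: E + y) - g y|) /\
    (gam t (s *: E + y) - gam t y) * (1 + tau t * \sum_i v 0 i * partial i b (z i)) =
      tau t * \sum_i (s *: E + y - y) 0 i * partial i b (z i)}.
  by apply: cid; have [z z1 z2] := increment (gamE t y) (gamE t (s *: E + y)); exists z.
pose z s := sval (H s).
have zE s : gam t (s *: E + y) - gam t y =
    s * (tau t * partial j b (z s j) / (1 + tau t * \sum_i v 0 i * partial i b (z s i))).
  have [_ h] := svalP (H s); have h1 := inv1 (z s) (svalP t).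
  have h0 : 1 + tau t * \sum_i v 0 i * partial i b (z s i) != 0.
    by rewrite gt_eqF// (lt_le_trans _ h1).
  apply: (mulIf h0); rewrite [LHS]h mulrA mulfVK// mulrCA; congr (_ * _).
  rewrite (bigD1 j)//= big1 ?addr0; last first.
    by move=> i ij; rewrite !mxE eqxx /= (negbTE ij) mulr0 add0r subrr mul0r.
  by rewrite !mxE !eqxx mulr1 addrK.
have g0 : g (s *: E + y) @[s --> (0 : R)] --> g y.
  have h : s *: E + y @[s --> (0 : R)] --> y.
    exact: (derivable_line_cvg (@derivable_id R _ y E)).
  exact: (continuous_cvg _ (cg y) h).
have cz0 i : z s i @[s --> (0 : R)] --> g y.
  apply/cvgrPdist_lt => e e0; move/cvgrPdist_lt: g0 => /(_ _ e0).
  apply: filterS => s hs; have [h _] := svalP (H s).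
  by rewrite distrC (le_lt_trans (h i))// distrC.
have cz i : z s i @[s --> 0^'] --> g y.
  by apply: cvg_trans (cz0 i); apply: cvg_app; exact: cvg_within.
have key : (fun s : R => s^-1 *: ((gam t \o shift y) (s *: E) - gam t y)) @ 0^' -->
    tau t * partial j b (g y) / (1 + shear_slope t (g y)).
  have : (fun s => tau t * partial j b (z s j) /
      (1 + tau t * \sum_i v 0 i * partial i b (z s i))) @ 0^' -->
      tau t * partial j b (g y) / (1 + shear_slope t (g y)).
    have hp i : partial i b (z s i) @[s --> 0^'] --> partial i b (g y).
      by apply: continuous_cvg => //; exact: cdb.
    have h1 := inv1 (fun _ => g y) (svalP t).
    apply: cvgM; first exact: (cvgM (cvg_cst _) (hp j)).
    apply: cvgV; first by rewrite gt_eqF// (lt_le_trans _ h1).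
    apply: cvgD; first exact: cvg_cst.
    apply: cvgM; first exact: cvg_cst.
    by apply: cvg_sumr => i _; exact: (cvgM (cvg_cst _) (hp i)).
  apply: cvg_trans; apply: near_eq_cvg; near=> s.
  have s0 : s != 0 by near: s; exact: nbhs_dnbhs_neq.
  by rewrite /= zE [RHS]mulKf.
by split; [apply/cvg_ex; eexists; exact: key|exact/cvg_lim].
Unshelve. all: by end_near. Qed.

(** A bootstrap: the derivative of [gam] involves [gam] only through [inv_shear], a displacement of
    the identity by [gam] along [v], so class [k] for [gam] gives class [k] for its derivatives as
    long as [b] has one more derivative. *)
Let gam_reg k : (k <= m)%N -> reg tau k gam.
Proof.
have invE t y : y + \row_j (fun t y => - v 0 j * gam t y) t y = inv_shear t y.
  by apply/rowP => j; rewrite !mxE mulNr mulrC.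
have C : C0fam tau gam.
  rewrite (_ : gam = fun t y => tau t * b (inv_shear t y)); last first.
    by apply/funext => t; apply/funext => y; exact: gamE.
  apply: (@C0fam_comp _ _ _ _ (fun t y => tau t * b y) inv_shear).
  - exact: (reg_C0 (reg_scale tau01 b_reg)).
  - move=> t y; exact: (@cvg_subZ R _ _ (nbhs y) _ _ _ v _ _ (@gam_continuous t y) (@cvg_id _ (nbhs y))).
  - move=> t; exists `|v| => y; rewrite addrC addKr normrN normrZ ler_piMl//.
    rewrite gamE; have /andP[h1 h2] := tau01 t; have /andP[h3 h4] := b01 (inv_shear t y).
    by rewrite ger0_norm ?mulr_ge0// mulr_ile1.
elim: k => [|k IH] km; first by split.
split=> // j.
have rg : forall i, reg tau k (fun t y => - v 0 i * gam t y).
  by move=> i; apply: regZ; apply: IH; exact: ltnW.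
have rb i : reg tau k (fun t y => tau t * partial i b (inv_shear t y)).
  have [_ h] := reg_partial i (reg_le km b_reg).
  have := reg_comp tau01 (reg_scale tau01 h) rg; congr (reg _ _ _).
  by apply/funext => t; apply/funext => y; rewrite invE.
pose c t y := shear_slope t (inv_shear t y).
have rc : reg tau k c.
  rewrite (_ : c = fun t y => \sum_i v 0 i * (tau t * partial i b (inv_shear t y))); last first.
    apply/funext => t; apply/funext => y; rewrite /c /shear_slope mulr_sumr.
    by apply: eq_bigr => i _; rewrite mulrCA.
  by apply: reg_sum => // i; exact: regZ.
have rq : reg tau k (fun t y => c t y / (1 + c t y)).
  apply: reg_frac => // t y; exact: (small (fun _ => inv_shear t y) (svalP t)).
(* The factor [1 / (1 + c)] is written [1 - c / (1 + c)], since only the latter quotient vanishes at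
   infinity. *)
exists (fun t y => tau t * partial j b (inv_shear t y)
   - tau t * partial j b (inv_shear t y) * (c t y / (1 + c t y))); last first.
  by apply: regB => //; apply: regM.
move=> t y; apply: is_derive_eq (gam_derive t y j) _.
have h1 := inv1 (fun _ => inv_shear t y) (svalP t).
have h0 : 1 + c t y != 0 by rewrite gt_eqF// (lt_le_trans _ h1).
by rewrite -/(c t y); field.
Qed.

(** The displacements of the shear and of its inverse, along [v] with coefficients [t * b] and
    [- gam], are both O(t) families; hence the constant [C] independent of [t]. *)
Lemma shear_family : exists2 t0 : R, 0 < t0 & exists C : R, forall t, 0 < t <= t0 ->
  exists2 phi : Diff0 R d m, forall y, phi y = y + (t * b y) *: v & diff_cost phi <= C * t.
Proof.
have H1 j : reg tau m (fun t y => v 0 j * (tau t * b y)) by apply: regZ; exact: reg_scale.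
have H2 j : reg tau m (fun t y => - v 0 j * gam t y) by apply: regZ; exact: gam_reg.
have [K1 _ HK1] := reg_row_normCm H1; have [K2 _ HK2] := reg_row_normCm H2.
exists t0 => //; exists (K1 + K2) => t tt0; pose s : T := exist _ t tt0.
pose f y := y + (t * b y) *: v.
have fE : (fun y => f y - y) = fun y => \row_j (v 0 j * (tau s * b y)).
  by apply/funext => y; apply/rowP => j; rewrite /f !mxE addrC addKr mulrC.
have gE : (fun y => inv_shear s y - y) = fun y => \row_j (- v 0 j * gam s y).
  by apply/funext => y; apply/rowP => j; rewrite /inv_shear !mxE addrC addKr mulNr mulrC.
have K : cancel f (inv_shear s).
  move=> y; rewrite /inv_shear.
  suff -> : gam s (f y) = t * b y by rewrite /f addrK.
  by apply: (uniqueness (y := f y) tt0); [rewrite /f addrK|exact: gamE].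
have K' : cancel (inv_shear s) f.
  by move=> y; rewrite /f -[t]/(tau s) -gamE /inv_shear subrK.
have [||phi [p1 p2]] := Diff0_of_near_id K K' (m := m).
- move=> j; have := reg_at s (H1 j); congr (reg _ _ _); apply/funext => _; apply/funext => y.
  by rewrite (congr1 (fun F => F y) fE) mxE.
- move=> j; have := reg_at s (H2 j); congr (reg _ _ _); apply/funext => _; apply/funext => y.
  by rewrite (congr1 (fun F => F y) gE) mxE.
exists phi; first by rewrite p1.
by rewrite /diff_cost p1 p2 fE gE mulrDl lerD// -[t]/(tau s).
Qed.

End shear.

(** * The Courant-Micheletti distance *)

Section courant.
Variables (R : realType) (d m : nat).
Implicit Types (f g h : Diff0 R d m) (fs gs : seq (Diff0 R d m)) (W : set 'rV[R]_d).

Lemma diff_cost_ge0 f : 0 <= diff_cost f.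
Proof. by rewrite addr_ge0// normCm_ge0. Qed.

Lemma diff_displacement f x : `|f x - x| <= diff_cost f.
Proof.
apply: (le_trans (is_Cm0_bounded x (diff_fun_Cm0 f))).
by rewrite lerDl normCm_ge0.
Qed.

Lemma compose_diffs_cat fs gs :
  compose_diffs (fs ++ gs) = compose_diffs gs \o compose_diffs fs.
Proof.
rewrite /compose_diffs foldl_cat; move: (foldl _ _ fs) => h.
elim: gs h => [//|g gs IH] h /=; rewrite IH [in RHS]IH.
by apply/funext => x.
Qed.

Lemma compose_diffs_cons f fs : compose_diffs (f :: fs) = compose_diffs fs \o f.
Proof. by rewrite -cat1s compose_diffs_cat. Qed.

(** Together with [courant_dist_lt], this turns closeness of two domains into a map of one onto the
    other that moves every point by little. *)
Lemma compose_diffs_displacement fs x :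
  `|compose_diffs fs x - x| <= \sum_(f <- fs) diff_cost f.
Proof.
elim: fs x => [|f fs IH] x; first by rewrite subrr normr0 big_nil.
rewrite compose_diffs_cons big_cons /= -(subrK (f x) (compose_diffs fs (f x))) -addrA addrC.
by rewrite (le_trans (ler_normD _ _))// lerD// diff_displacement.
Qed.

Lemma compose_diffs_Diff0 fs g : exists h, diff_fun h = compose_diffs fs \o g.
Proof.
elim: fs g => [|f fs IH] g; first by exists g.
have [h hE] := Diff0_compose f g; have [k kE] := IH h.
by exists k; rewrite kE hE compose_diffs_cons.
Qed.

Lemma courant_dist_le W1 W2 fs : (0 < size fs)%N -> compose_diffs fs @` W1 = W2 ->
  courant_dist m W1 W2 <= \sum_(f <- fs) diff_cost f.
Proof.
move=> s0 E; apply: ge_inf; last by exists fs.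
exists 0 => _ [gs [_ _ ->]]; apply: sumr_ge0 => f _; exact: diff_cost_ge0.
Qed.

(** Both domains lie in the orbit of [D], so the set of costs contains that of going back to [D] and
    out again. Nonemptiness matters: [inf] of the empty set is 0, and a small value would carry no
    information. *)
Lemma courant_dist_lt D W1 W2 (e : R) : orbit_shapes m D W1 -> orbit_shapes m D W2 ->
  courant_dist m W1 W2 < e -> exists fs, [/\ (0 < size fs)%N, compose_diffs fs @` W1 = W2 &
    \sum_(f <- fs) diff_cost f < e].
Proof.
move=> [f ->] [g ->] lt_e.
have [k [kE _]] := Diff0_inverse f.
pose A := [set s | exists fs, [/\ (0 < size fs)%N, compose_diffs fs @` (f @` D) = g @` D &
        s = \sum_(f <- fs) diff_cost f]].
have A0 : A !=set0.
  exists (\sum_(f <- [:: k; g]) diff_cost f), [:: k; g]; split=> //.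
  rewrite /compose_diffs /= kE; apply/seteqP; split=> [_ [_ [x Dx <-] <-]|_ [x Dx <-]].
    by exists x => //=; rewrite diff_funK.
  by exists (f x); [exists x|rewrite /= diff_funK].
have [s [fs [s0 E ->]] lt_s] : exists2 s, A s & s < e by exact: inf_lt.
by exists fs.
Qed.

Lemma courant_dist_triangle D W1 W2 W3 : orbit_shapes m D W1 -> orbit_shapes m D W2 ->
  orbit_shapes m D W3 ->
  courant_dist m W1 W3 <= courant_dist m W1 W2 + courant_dist m W2 W3.
Proof.
move=> o1 o2 o3; apply/ler_addgt0Pr => e e0.
have e2 : 0 < e / 2 by rewrite divr_gt0.
have [|fs [s1 E1 l1]] := courant_dist_lt o1 o2 (e := courant_dist m W1 W2 + e / 2).
  by rewrite ltrDl.
have [|gs [s2 E2 l2]] := courant_dist_lt o2 o3 (e := courant_dist m W2 W3 + e / 2).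
  by rewrite ltrDl.
have E : compose_diffs (fs ++ gs) @` W1 = W3 by rewrite compose_diffs_cat -image_comp E1.
have := courant_dist_le _ E; rewrite size_cat big_cat /= ltn_addr// => /(_ isT).
by move=> /le_trans; apply; lra.
Qed.

End courant.

(** * Interiors for the Courant-Micheletti balls *)

Section inner.
Variables (R : realType) (d m : nat) (D : set 'rV[R]_d).
Implicit Type V : set (shape_space m D).

Definition ball_interior V : set (shape_space m D) :=
  [set W | V W /\ exists2 e : R, 0 < e & shape_ball W e `<=` V].

Lemma open_ball_interior V : open (ball_interior V).
Proof.
suff : shape_open (ball_interior V) by [].
move=> W [VW [e e0 We]]; exists e => // W' WW'; split; first exact: We.
exists (e - courant_dist m (val W) (val W')); first by rewrite subr_gt0.
move=> W'' W'W''; apply: We; rewrite /shape_ball /=.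
apply: (le_lt_trans (courant_dist_triangle (D := D) _ _ _ (W2 := val W'))).
- exact: set_valP.
- exact: set_valP.
- exact: set_valP.
by rewrite addrC -ltrBrDr.
Qed.

End inner.

(** * Simplices *)

Section simplex.
Variables (R : realType) (d : nat).
Implicit Types (X Y V : 'M[R]_(d.+1, d)) (a i j : 'I_d.+1) (k : 'I_d).

(** Homogeneous coordinates, in which an affine map of the vertices becomes right multiplication by
    a block matrix; the determinant is [d!] times the signed volume. *)
Definition homog X : 'M[R]_d.+1 := row_mx (const_mx 1 : 'cV[R]_d.+1) X.
Definition vol X : R := \det (homog X).
Definition sqd X i j : R := \sum_k (X i k - X j k) ^+ 2.
(* The weights distinguish the vertices, so that [spread] is not invariant under
   permutations of them; the constant 1 keeps it positive. *)
Definition spread X : R := 1 + \sum_(i < d.+1) \sum_(j < d.+1) i%:R * sqd X i j.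
Definition Phi X : R := vol X ^+ 2 * spread X.

(** [vgrad] is the gradient of [vol], by Laplace expansion along row [i], and [sgrad] that of
    [spread]: the edge between [i] and [j] occurs in both orders, whence its total weight
    [i + j]. *)
Definition vgrad X i k : R := cofactor (homog X) i (rshift 1 k).
Definition sgrad X i k : R := 2 * \sum_(j < d.+1) (i + j)%:R * (X i k - X j k).
Definition Phigrad X : 'M[R]_(d.+1, d) :=
  \matrix_(i, k) (2 * vol X * vgrad X i k * spread X + vol X ^+ 2 * sgrad X i k).

Definition mxdot X Y : R := \sum_i \sum_k X i k * Y i k.
Definition affine (A : 'M[R]_d) (c : 'rV[R]_d) X : 'M[R]_(d.+1, d) :=
  X *m A + (const_mx 1 : 'cV[R]_d.+1) *m c.

Lemma homog_0 X i : homog X i (lshift d (ord0 : 'I_1)) = 1.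
Proof. by rewrite /homog (@row_mxEl _ d.+1 1 d) mxE. Qed.

Lemma homog_S X i k : homog X i (rshift 1 k) = X i k.
Proof. by rewrite /homog (@row_mxEr _ d.+1 1 d). Qed.

Lemma sum_ord1p (f : 'I_(1 + d) -> R) :
  \sum_i f i = f (lshift d (ord0 : 'I_1)) + \sum_k f (rshift 1 k).
Proof. by rewrite big_split_ord big_ord1. Qed.

Lemma spread_ge1 X : 1 <= spread X.
Proof.
rewrite lerDl; apply: sumr_ge0 => i _; apply: sumr_ge0 => j _; rewrite mulr_ge0//.
by apply: sumr_ge0 => k _; exact: sqr_ge0.
Qed.

Lemma spread_gt0 X : 0 < spread X.
Proof. exact: lt_le_trans (spread_ge1 X). Qed.

Lemma Phi_gt0 X : (0 < Phi X) = (vol X != 0).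
Proof.
rewrite /Phi pmulr_lgt0 ?spread_gt0//.
have [->|v0] := eqVneq (vol X) 0; first by rewrite expr0n ltxx.
by rewrite lt_neqAle sqr_ge0 eq_sym expf_neq0.
Qed.

(* [vol] is affine in the vertex [x_a] and vanishes when [x_a = x_j]. *)
Lemma vgrad_dot X a j : \sum_k vgrad X a k * (X a k - X j k) = (j != a)%:R * vol X.
Proof.
have H i : cofactor (homog X) a (lshift d (ord0 : 'I_1)) + \sum_k X i k * vgrad X a k
    = vol X *+ (i == a).
  have := congr1 (fun M : 'M[R]_d.+1 => M i a) (mul_mx_adj (homog X)).
  rewrite !mxE => <-; rewrite (sum_ord1p (fun l => homog X i l * _)) homog_0 mul1r mxE.
  by congr (_ + _); apply: eq_bigr => k _; rewrite homog_S mxE.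
have Hj := H j; have Ha := H a; rewrite eqxx mulr1n in Ha.
transitivity ((cofactor (homog X) a (lshift d (ord0 : 'I_1)) + \sum_k X a k * vgrad X a k) -
  (cofactor (homog X) a (lshift d (ord0 : 'I_1)) + \sum_k X j k * vgrad X a k)).
  rewrite opprD addrACA subrr add0r -sumrB; apply: eq_bigr => k _.
  by rewrite -mulrBl mulrC.
rewrite Ha Hj; case: eqP => _; first by rewrite mulr1n subrr mul0r.
by rewrite mulr0n subr0 mul1r.
Qed.

(** A linear relation among the edges at [x_a] becomes a left null vector of the invertible matrix
    [homog X] once the coefficient at [a] is adjusted to make the coefficients sum to 0, which
    handles the column of ones. *)
Lemma vertices_independent X a (w : 'I_d.+1 -> R) : vol X != 0 ->
  (forall k, \sum_j w j * (X a k - X j k) = 0) -> forall j, j != a -> w j = 0.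
Proof.
move=> v0 H j ja.
pose S := \sum_i w i.
have sumS (f : 'I_d.+1 -> R) : \sum_i (i == a)%:R * f i = f a.
  rewrite (bigD1 a)//= eqxx mul1r big1 ?addr0// => i /negbTE ->.
  by rewrite mul0r.
pose g : 'rV[R]_d.+1 := \row_l ((l == a)%:R * S - w l).
have g0 : g *m homog X = 0.
  apply/rowP => l; rewrite !mxE.
  case: (@split_ordP 1 d l) => [l' ->|k ->].
    rewrite (ord1 l') (eq_bigr (fun i => g 0 i)); last by move=> i _; rewrite homog_0 mulr1.
    rewrite (eq_bigr (fun l => (l == a)%:R * S - w l)); last by move=> i _; rewrite mxE.
    by rewrite sumrB sumS subrr.
  apply: (etrans _ (H k)).
  rewrite (eq_bigr (fun i => (i == a)%:R * (S * X i k) - w i * X i k)); last first.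
    by move=> i _; rewrite homog_S mxE mulrBl mulrA.
  rewrite sumrB sumS /S mulr_suml -sumrB; apply: eq_bigr => i _; ring.
have U : homog X \in unitmx by rewrite unitmxE unitfE.
have : g = 0 by rewrite -(mulmxK U g) g0 mul0mx.
move=> /(congr1 (fun g : 'rV[R]_d.+1 => g 0 j)); rewrite !mxE (negbTE ja) mul0r sub0r.
by move=> /eqP; rewrite oppr_eq0 => /eqP.
Qed.

Lemma affineE A c X i k : affine A c X i k = (X *m A) i k + c 0 k.
Proof. by rewrite mxE [X in _ + X]mxE big_ord1 [X in _ + X * _]mxE mul1r. Qed.

Lemma homog_affine A c X : homog (affine A c X) = homog X *m block_mx 1%:M c 0 A.
Proof.
rewrite /homog /affine (@mul_row_block _ d.+1 1 d 1 d) mulmx1 mulmx0 addr0.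
by rewrite addrC.
Qed.

Lemma orth_det (A : 'M[R]_d) : A *m A^T = 1%:M -> (\det A) ^+ 2 = 1 :> R.
Proof. by move=> /(congr1 determinant); rewrite det_mulmx det_tr det1 expr2. Qed.

Lemma vol_affine A c X : vol (affine A c X) = vol X * \det A.
Proof.
rewrite /vol homog_affine det_mulmx.
by rewrite (_ : \det (block_mx 1%:M c 0 A) = \det A)// (@det_ublock _ 1 d) det1 mul1r.
Qed.

Lemma sqd_affine A c X i j : A *m A^T = 1%:M -> sqd (affine A c X) i j = sqd X i j.
Proof.
move=> AA; pose x : 'rV[R]_d := \row_k (X i k - X j k).
have E (y : 'rV[R]_d) : \sum_k (y 0 k) ^+ 2 = (y *m y^T) 0 0.
  by rewrite mxE; apply: eq_bigr => k _; rewrite mxE expr2.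
transitivity (((x *m A) *m (x *m A)^T) 0 0).
  rewrite -E; apply: eq_bigr => k _; congr (_ ^+ 2).
  rewrite !mxE !big_ord1 !mxE !mul1r opprD addrACA subrr addr0 -sumrB.
  by apply: eq_bigr => l _; rewrite mxE mulrBl.
rewrite trmx_mul mulmxA -(mulmxA x) AA mulmx1 -E.
by apply: eq_bigr => k _; rewrite mxE.
Qed.

Lemma Phi_affine A c X : A *m A^T = 1%:M -> Phi (affine A c X) = Phi X.
Proof.
move=> AA; rewrite /Phi vol_affine exprMn (orth_det AA) mulr1; congr (_ * (1 + _)).
by apply: eq_bigr => i _; apply: eq_bigr => j _; rewrite sqd_affine.
Qed.

Lemma affine_fix A c X : vol X != 0 -> affine A c X = X -> A = 1%:M /\ c = 0.
Proof.
move=> v0 E.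
have U : homog X \in unitmx by rewrite unitmxE unitfE.
have : block_mx 1%:M c 0 A = 1%:M :> 'M[R]_(1 + d).
  by rewrite -[LHS](mulKmx U) -homog_affine E mulVmx.
by rewrite [X in _ = X](@scalar_mx_block R 1 d 1) => /eq_block_mx[_ -> _ ->].
Qed.

(** Pair the gradient at [x_a] with half of [sgrad] there, the vector [D]. By [vgrad_dot] the volume
    part contributes a positive multiple of [vol X ^ 2], and the spread part a multiple of the sum
    of the [D k ^ 2]: pushing a vertex away from the weighted others increases [Phi]. *)
Lemma Phigrad_neq0 X a : (0 < d)%N -> vol X != 0 -> exists k, Phigrad X a k != 0.
Proof.
move=> d0 v0; apply/existsP; rewrite -negb_forall; apply/negP => /forallP H.
have {}H k : Phigrad X a k = 0 by apply/eqP.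
pose w (j : 'I_d.+1) : R := (a + j)%:R.
pose D k := \sum_j w j * (X a k - X j k).
have : \sum_k Phigrad X a k * D k = 0 by rewrite big1// => k _; rewrite H mul0r.
rewrite (eq_bigr (fun k => 2 * vol X * spread X * (vgrad X a k * D k) +
    2 * vol X ^+ 2 * D k ^+ 2)); last first.
  by move=> k _; rewrite mxE /sgrad -/(D k); ring.
rewrite big_split /= -!mulr_sumr.
have -> : \sum_k vgrad X a k * D k = (\sum_(j | j != a) w j) * vol X.
  rewrite (eq_bigr (fun k => \sum_j w j * (vgrad X a k * (X a k - X j k)))); last first.
    by move=> k _; rewrite mulr_sumr; apply: eq_bigr => j _; rewrite mulrCA.
  rewrite exchange_big /= mulr_suml [RHS]big_mkcond /=; apply: eq_bigr => j _.
  by rewrite -mulr_sumr vgrad_dot; case: eqP => _; rewrite ?mul0r ?mulr0 ?mul1r.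
have w0 : 0 < \sum_(j | j != a) w j.
  (* The weight [a + j] vanishes only for [a = j = 0], so label 0 serves unless [a] is 0. *)
  pose j : 'I_d.+1 := if a == ord0 then lift ord0 (Ordinal d0) else ord0.
  have ja : j != a.
    rewrite /j; have [->|a0] := eqVneq a ord0; first by rewrite eq_sym neq_lift.
    by rewrite eq_sym.
  rewrite (bigD1 j)//= ltr_pwDl// ?ltr0n; last by apply: sumr_ge0.
  rewrite addn_gt0 /j; have [a0|a0] := eqVneq a ord0; first by rewrite orbT.
  by rewrite lt0n; move: a0; rewrite -val_eqE => ->.
have v2 : 0 < vol X ^+ 2 by rewrite exprn_even_gt0.
move=> E.
have h1 : 0 < spread X * (\sum_(j | j != a) w j) * vol X ^+ 2.
  by rewrite mulr_gt0// mulr_gt0// spread_gt0.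
have h2 : 0 <= vol X ^+ 2 * \sum_k D k ^+ 2.
  by rewrite mulr_ge0 ?sqr_ge0//; apply: sumr_ge0 => k _; exact: sqr_ge0.
have h3 : 2 * (spread X * (\sum_(j | j != a) w j) * vol X ^+ 2) +
   2 * (vol X ^+ 2 * \sum_k D k ^+ 2) = 0 by apply: (etrans _ E); ring.
lra.
Qed.

(** [Y] is [X] with its vertices relabelled by [s]. The volume part of the gradient does not see the
    labels, so equal gradients force equal spread gradients; by independence of the edges, the
    weights then agree edge by edge, [s a + s j = a + j]. *)
Lemma Phigrad_rigid X Y (s : 'I_d.+1 -> 'I_d.+1) : (1 < d)%N -> injective s ->
  vol X != 0 -> (forall a k, Y (s a) k = X a k) -> Phi Y = Phi X ->
  (forall a k, Phigrad Y (s a) k = Phigrad X a k) -> forall a, s a = a.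
Proof.
move=> d1 inj_s v0 YX PhiE GE.
have volE : vol Y ^+ 2 = vol X ^+ 2.
  have -> : vol X = (-1) ^+ (perm inj_s) * vol Y.
    rewrite /vol -det_perm -det_mulmx -row_permE; congr (\det _).
    apply/matrixP => i l; rewrite [RHS]mxE permE; case: (@split_ordP 1 d l) => [l' ->|k ->].
      by rewrite (ord1 l') !homog_0.
    by rewrite !homog_S YX.
  by rewrite exprMn sqrr_sign mul1r.
have v2 : 0 < vol X ^+ 2 by rewrite exprn_even_gt0.
have spE : spread Y = spread X.
  by apply: (mulfI (lt0r_neq0 v2)); rewrite -{1}volE.
have sgB a k : sgrad Y (s a) k - sgrad X a k =
    2 * \sum_j ((s a + s j)%:R - (a + j)%:R) * (X a k - X j k).
  rewrite /sgrad -mulrBr (reindex_inj inj_s) /= -sumrB; congr (2 * _).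
  by apply: eq_bigr => j _; rewrite !YX -mulrBl.
have sgE a k : sgrad Y (s a) k = sgrad X a k.
  pose w (j : 'I_d.+1) : R := (s a + s j)%:R - (a + j)%:R.
  pose D k := \sum_j w j * (X a k - X j k).
  have DE l : sgrad Y (s a) l - sgrad X a l = 2 * D l by exact: sgB.
  (* [e] is the volume part of the gradient difference, up to the factor [spread X]. By [vgrad_dot]
     it is orthogonal to every edge at [x_a], hence to [D]; but [GD] makes it a multiple of [D], so
     [D] is 0. *)
  pose e l := 2 * vol Y * vgrad Y (s a) l - 2 * vol X * vgrad X a l.
  have eD j : \sum_l e l * (X a l - X j l) = 0.
    rewrite (eq_bigr (fun l => 2 * vol Y * (vgrad Y (s a) l * (Y (s a) l - Y (s j) l)) -
      2 * vol X * (vgrad X a l * (X a l - X j l)))); last first.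
      by move=> l _; rewrite /e !YX; ring.
    rewrite sumrB -!mulr_sumr !vgrad_dot (inj_eq inj_s).
    have : (vol Y * vol Y = vol X * vol X) by rewrite -!expr2.
    move=> h; rewrite mulrCA -[X in _ * X - _]mulrA h; ring.
  have GD l : spread X * e l + vol X ^+ 2 * (2 * D l) = 0.
    have := GE a l; rewrite !mxE spE volE -DE => h.
    by rewrite /e; move/eqP: h; rewrite -subr_eq0 => /eqP h; rewrite -[RHS]h; ring.
  have eDD : \sum_l e l * D l = 0.
    rewrite (eq_bigr (fun l => \sum_j w j * (e l * (X a l - X j l)))); last first.
      by move=> l _; rewrite mulr_sumr; apply: eq_bigr => j _; rewrite mulrCA.
    by rewrite exchange_big big1// => j _; rewrite -mulr_sumr eD mulr0.
  have DD : \sum_l D l ^+ 2 = 0.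
    have : \sum_l (spread X * e l + vol X ^+ 2 * (2 * D l)) * D l = 0.
      by rewrite big1// => l _; rewrite GD mul0r.
    rewrite (eq_bigr (fun l => spread X * (e l * D l) + 2 * vol X ^+ 2 * D l ^+ 2)); last first.
      by move=> l _; ring.
    rewrite big_split /= -!mulr_sumr eDD mulr0 add0r => /eqP.
    by rewrite mulf_eq0 mulf_eq0 pnatr_eq0 (gt_eqF v2) => /eqP.
  have D0 l : D l = 0.
    apply/eqP; rewrite -sqrf_eq0; apply/eqP.
    by have /psumr_eq0P := DD; apply=> // i _; exact: sqr_ge0.
  by apply/eqP; rewrite -subr_eq0 DE D0 mulr0.
have key a j : j != a -> (s a + s j = a + j)%N.
  move=> ja; apply/eqP; rewrite -(eqr_nat R) -subr_eq0; apply/eqP.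
  apply: (vertices_independent (a := a) (w := fun j => (s a + s j)%:R - (a + j)%:R) v0) => // k.
  by have /eqP := sgB a k; rewrite sgE subrr eq_sym mulf_eq0 pnatr_eq0 => /eqP.
move=> a.
(* With three distinct labels, adding the equations for the two edges at [a] and subtracting the one
   for the third edge gives [2 * s a = 2 * a]. *)
have [j [l [ja la jl]]] : exists j l : 'I_d.+1, [/\ j != a, l != a & j != l].
  have d0 := ltnW d1.
  pose p := lift a (Ordinal d0); pose q := lift a (Ordinal d1).
  exists p, q; split; rewrite ?(eq_sym _ a) ?neq_lift//.
  by rewrite (inj_eq (@lift_inj _ a)).
have h1 := key a j ja; have h2 := key a l la; have h3 := key j l; rewrite eq_sym in h3.
have {}h3 := h3 jl; apply: val_inj => /=.
move: h1 h2 h3; move: (nat_of_ord (s a)) (nat_of_ord (s j)) (nat_of_ord (s l)) => x y z.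
by lia.
Qed.

End simplex.

(** * Continuity and first variation of [Phi] *)

Lemma cvg_prodr (R : realType) (T : Type) (F : set_system T) {FF : Filter F}
    (I : Type) (r : seq I) (f : I -> T -> R) (l : I -> R) :
  (forall i, f i @ F --> l i) ->
  (fun t => \prod_(i <- r) f i t) @ F --> \prod_(i <- r) l i.
Proof.
move=> H; elim: r => [|a r IH].
  under eq_fun do rewrite big_nil.
  by rewrite big_nil; exact: cvg_cst.
under eq_fun do rewrite big_cons.
by rewrite big_cons; apply: cvgM.
Qed.

Lemma det_cvg (R : realType) (T : Type) (F : set_system T) {FF : Filter F} (n : nat)
    (A : T -> 'M[R]_n) (A0 : 'M[R]_n) :
  (forall i j, A t i j @[t --> F] --> A0 i j) -> \det (A t) @[t --> F] --> \det A0.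
Proof.
move=> H; rewrite /determinant; apply: cvg_sumr => s _; apply: cvgM; first exact: cvg_cst.
by apply: cvg_prodr => i; exact: H.
Qed.

Lemma cofactor_cvg (R : realType) (T : Type) (F : set_system T) {FF : Filter F} (n : nat)
    (A : T -> 'M[R]_n) (A0 : 'M[R]_n) i j :
  (forall i j, A t i j @[t --> F] --> A0 i j) ->
  cofactor (A t) i j @[t --> F] --> cofactor A0 i j.
Proof.
move=> H; rewrite /cofactor; apply: cvgM; first exact: cvg_cst.
apply: det_cvg => a b; rewrite !mxE; under eq_fun do rewrite !mxE.
exact: H.
Qed.

Section Phi_continuity.
Variables (R : realType) (d : nat) (T : Type) (F : set_system T).
Context {FF : Filter F}.
Variables (X : T -> 'M[R]_(d.+1, d)) (X0 : 'M[R]_(d.+1, d)).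
Hypothesis hX : X @ F --> X0.

Let eX i k : X t i k @[t --> F] --> X0 i k.
Proof. by have /cvg_mxP := hX; apply. Qed.

Lemma vol_cvg : vol (X t) @[t --> F] --> vol X0.
Proof.
apply: det_cvg => i j; case: (@split_ordP 1 d j) => [j' ->|k ->].
  rewrite (ord1 j') homog_0; under eq_fun do rewrite homog_0.
  exact: cvg_cst.
by rewrite homog_S; under eq_fun do rewrite homog_S; exact: eX.
Qed.

Lemma spread_cvg : spread (X t) @[t --> F] --> spread X0.
Proof.
apply: cvgD; first exact: cvg_cst.
apply: cvg_sumr => i _; apply: cvg_sumr => j _; apply: cvgM; first exact: cvg_cst.
apply: cvg_sumr => k _; rewrite expr2; under eq_fun do rewrite expr2.
by apply: cvgM; apply: cvgB.
Qed.

Lemma Phi_cvg : Phi (X t) @[t --> F] --> Phi X0.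
Proof.
apply: cvgM; last exact: spread_cvg.
rewrite expr2; under eq_fun do rewrite expr2.
by apply: cvgM; exact: vol_cvg.
Qed.

Lemma Phigrad_cvg : Phigrad (X t) @[t --> F] --> Phigrad X0.
Proof.
apply/cvg_mxP => i k; rewrite mxE; under eq_fun do rewrite mxE.
have cg : vgrad (X t) i k @[t --> F] --> vgrad X0 i k.
  apply: cofactor_cvg => a l; case: (@split_ordP 1 d l) => [l' ->|b ->].
    rewrite (ord1 l') homog_0; under eq_fun do rewrite homog_0.
    exact: cvg_cst.
  by rewrite homog_S; under eq_fun do rewrite homog_S; exact: eX.
have cs : sgrad (X t) i k @[t --> F] --> sgrad X0 i k.
  apply: cvgM; first exact: cvg_cst.
  apply: cvg_sumr => j _; apply: cvgM; first exact: cvg_cst.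
  by apply: cvgB.
apply: cvgD; apply: cvgM => //.
- apply: cvgM => //; apply: cvgM; [exact: cvg_cst|exact: vol_cvg].
- exact: spread_cvg.
- rewrite expr2; under eq_fun do rewrite expr2.
  by apply: cvgM; exact: vol_cvg.
Qed.

End Phi_continuity.

Section difference_quotient.
Variables (R : realType) (d : nat) (T : Type) (F : set_system T).
Context {FF : Filter F}.
Variables (X V : T -> 'M[R]_(d.+1, d)) (s : T -> R) (X0 V0 : 'M[R]_(d.+1, d)).
Hypotheses (hX : X @ F --> X0) (hV : V @ F --> V0) (hs : s @ F --> 0) (s0 : forall t, s t != 0).
Let Y t := X t + s t *: V t.

Let eX i k : X t i k @[t --> F] --> X0 i k.
Proof. by have /cvg_mxP := hX; apply. Qed.

Let eV i k : V t i k @[t --> F] --> V0 i k.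
Proof. by have /cvg_mxP := hV; apply. Qed.

Let hY : Y @ F --> X0.
Proof.
rewrite -[X0]addr0 -[0 as X in _ + X](scale0r V0) /Y.
by apply: cvgD => //; apply: cvgZ.
Qed.

Lemma spread_quotient :
  (spread (Y t) - spread (X t)) / s t @[t --> F] --> \sum_i \sum_k sgrad X0 i k * V0 i k.
Proof.
have -> : \sum_i \sum_k sgrad X0 i k * V0 i k =
    \sum_(i < d.+1) \sum_(j < d.+1) i%:R * \sum_k (2 * (X0 i k - X0 j k) * (V0 i k - V0 j k)).
  pose f (i j : 'I_d.+1) := \sum_k 2 * (X0 i k - X0 j k) * V0 i k.
  transitivity (\sum_(i < d.+1) \sum_(j < d.+1) (i + j)%:R * f i j).
    apply: eq_bigr => i _; rewrite /f.
    under [RHS]eq_bigr do rewrite mulr_sumr.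
    rewrite exchange_big /=; apply: eq_bigr => k _.
    rewrite /sgrad mulrAC mulr_sumr; apply: eq_bigr => j _; ring.
  (* Split the weight [i + j] and exchange the two indices in one half: the gradient becomes the
     termwise derivative of the double sum. *)
  transitivity (\sum_(i < d.+1) \sum_(j < d.+1) i%:R * f i j +
      \sum_(i < d.+1) \sum_(j < d.+1) i%:R * f j i).
    rewrite [X in _ + X]exchange_big /= -big_split /=; apply: eq_bigr => i _.
    rewrite -big_split /=; apply: eq_bigr => j _; by rewrite natrD mulrDl.
  rewrite -big_split /=; apply: eq_bigr => i _; rewrite -big_split /=.
  apply: eq_bigr => j _; rewrite -mulrDr; congr (_ * _).
  rewrite /f -big_split /=; apply: eq_bigr => k _; ring.
rewrite (_ : (fun t => _) = fun t => \sum_(i < d.+1) \sum_(j < d.+1) i%:R *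
    \sum_k (2 * (X t i k - X t j k) * (V t i k - V t j k) + s t * (V t i k - V t j k) ^+ 2)).
  apply: cvg_sumr => i _; apply: cvg_sumr => j _; apply: cvgM; first exact: cvg_cst.
  apply: cvg_sumr => k _; rewrite -[X in _ --> X]addr0; apply: cvgD.
    apply: cvgM; last by apply: cvgB.
    by apply: cvgM; [exact: cvg_cst|apply: cvgB].
  rewrite -(mul0r ((V0 i k - V0 j k) ^+ 2)); apply: cvgM => //.
  rewrite expr2; under eq_fun do rewrite expr2.
  by apply: cvgM; apply: cvgB.
apply/funext => t; rewrite /spread opprD addrACA subrr add0r -sumrB mulr_suml.
apply: eq_bigr => i _; rewrite -sumrB mulr_suml; apply: eq_bigr => j _.
rewrite -mulrBr -mulrA; congr (_ * _); rewrite /sqd -sumrB mulr_suml.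
apply: eq_bigr => k _; rewrite /Y !mxE; have := s0 t; move: (s t) => st st0; field.
exact: st0.
Qed.

(** The first [n] rows are already moved: passing from [n] to [n.+1] changes one row, in which the
    determinant is linear with cofactors that do not involve that row. *)
Let M n t : 'M[R]_d.+1 := \matrix_(i, j) (if (i < n)%N then homog (Y t) i j else homog (X t) i j).

Let M_step (i : 'I_d.+1) t : \det (M i.+1 t) - \det (M i t) =
  s t * \sum_k V t i k * cofactor (M i t) i (rshift 1 k).
Proof.
have E j : cofactor (M i.+1 t) i j = cofactor (M i t) i j.
  rewrite /cofactor; congr (_ * \det _); apply/matrixP => a b; rewrite !mxE.
  rewrite ltnS leq_eqVlt; have -> : (lift i a == i :> nat) = false.
    by apply/negbTE; rewrite eq_sym (neq_lift i a).
  by [].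
rewrite (expand_det_row _ i) (expand_det_row (M i t) i) -sumrB.
rewrite (eq_bigr (fun j => (M i.+1 t i j - M i t i j) * cofactor (M i t) i j)); last first.
  by move=> j _; rewrite E mulrBl.
rewrite (sum_ord1p (fun j => (M i.+1 t i j - M i t i j) * _)).
rewrite mxE [X in _ - X]mxE ltnSn ltnn !homog_0 subrr mul0r add0r mulr_sumr.
apply: eq_bigr => k _; rewrite mxE [X in _ - X]mxE ltnSn ltnn !homog_S /Y !mxE.
ring.
Qed.

Let M_cvg n i j : M n t i j @[t --> F] --> homog X0 i j.
Proof.
have H Z : Z @ F --> X0 -> homog (Z t) i j @[t --> F] --> homog X0 i j.
  move=> hZ; case: (@split_ordP 1 d j) => [j' ->|k ->].
    rewrite (ord1 j') homog_0; under eq_fun do rewrite homog_0.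
    exact: cvg_cst.
  rewrite homog_S; under eq_fun do rewrite homog_S.
  by have /cvg_mxP := hZ; apply.
have [h|h] := boolP (i < n)%N.
  rewrite (_ : (fun t => _) = fun t => homog (Y t) i j); first exact: H.
  by apply/funext => t; rewrite mxE h.
rewrite (_ : (fun t => _) = fun t => homog (X t) i j); first exact: H.
by apply/funext => t; rewrite mxE (negbTE h).
Qed.

Lemma vol_quotient :
  (vol (Y t) - vol (X t)) / s t @[t --> F] --> \sum_i \sum_k vgrad X0 i k * V0 i k.
Proof.
rewrite (_ : (fun t => _) = fun t =>
    \sum_(i < d.+1) \sum_k cofactor (M i t) i (rshift 1 k) * V t i k).
  apply: cvg_sumr => i _; apply: cvg_sumr => k _; apply: cvgM => //.
  by apply: cofactor_cvg => a b; exact: M_cvg.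
apply/funext => t.
have -> : vol (Y t) = \det (M d.+1 t).
  by congr (\det _); apply/matrixP => i j; rewrite [RHS]mxE ltn_ord.
have -> : vol (X t) = \det (M 0 t) by congr (\det _); apply/matrixP => i j; rewrite [RHS]mxE.
rewrite -(telescope_sumr (fun n => \det (M n t)) (leq0n d.+1)) big_mkord mulr_suml.
apply: eq_bigr => i _; rewrite M_step mulrAC mulfV// mul1r.
by apply: eq_bigr => k _; rewrite mulrC.
Qed.

(** A strict form of differentiability: base point and direction both vary with the parameter, since
    the formula is applied to near-optimal tuples of which only the convergence is known. *)
Lemma Phi_quotient :
  (Phi (Y t) - Phi (X t)) / s t @[t --> F] --> mxdot (Phigrad X0) V0.
Proof.
have -> : mxdot (Phigrad X0) V0 =
  ((\sum_i \sum_k vgrad X0 i k * V0 i k) * vol X0 + vol X0 * (\sum_i \sum_k vgrad X0 i k * V0 i k))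
  * spread X0 + vol X0 * vol X0 * \sum_i \sum_k sgrad X0 i k * V0 i k.
  rewrite /mxdot (eq_bigr (fun i => 2 * vol X0 * spread X0 * (\sum_k vgrad X0 i k * V0 i k) +
      vol X0 ^+ 2 * \sum_k sgrad X0 i k * V0 i k)).
    rewrite big_split /= -!mulr_sumr; ring.
  move=> i _; transitivity (\sum_k 2 * vol X0 * spread X0 * (vgrad X0 i k * V0 i k) +
      \sum_k vol X0 ^+ 2 * (sgrad X0 i k * V0 i k)); last by rewrite -!mulr_sumr.
  by rewrite -big_split /=; apply: eq_bigr => k _; rewrite mxE; ring.
rewrite (_ : (fun t => _) = fun t =>
  ((vol (Y t) - vol (X t)) / s t * vol (Y t) + vol (X t) * ((vol (Y t) - vol (X t)) / s t))
  * spread (Y t) + vol (X t) * vol (X t) * ((spread (Y t) - spread (X t)) / s t)).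
  have cvX : vol (X t) @[t --> F] --> vol X0 by exact: vol_cvg.
  have cvY : vol (Y t) @[t --> F] --> vol X0 by exact: vol_cvg.
  have cq := vol_quotient.
  apply: cvgD; apply: cvgM.
  - by apply: cvgD; apply: cvgM.
  - exact: spread_cvg.
  - by apply: cvgM.
  - exact: spread_quotient.
apply/funext => t; rewrite /Phi; field; exact: s0.
Qed.

End difference_quotient.

(** * Extremal simplices *)

Section ultrafilter.

Lemma ultra_fmap (S T : Type) (f : S -> T) (U : set_system S) :
  UltraFilter U -> UltraFilter (f @ U).
Proof.
move=> UU; split=> [|G GF sUG]; first exact: fmap_proper_filter.
apply/seteqP; split=> // B GB.
have [//|nB] := in_ultra_setVsetC (f @^-1` B) UU.
have GnB : G (~` B) by apply: sUG.
have GI : G (B `&` ~` B) by exact: filterI.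
by have [x []] := filter_ex GI.
Qed.

Lemma ultra_compact_cvg (T : topologicalType) (S : Type) (U : set_system S) (K : set T)
    (u : S -> T) : UltraFilter U -> compact K -> (forall t, K (u t)) ->
  exists2 p, K p & u @ U --> p.
Proof.
rewrite compact_ultra => UU cK uK.
have UK : U (u @^-1` K) by apply: filterS filterT => t _; exact: uK.
by have [p [Kp up]] := cK _ (ultra_fmap u UU) UK; exists p.
Qed.

Lemma ultra_nat : exists2 U : set_system nat, UltraFilter U & \oo `<=` U.
Proof. by have [U [UU sU]] := @ultraFilterLemma nat \oo _; exists U. Qed.

End ultrafilter.

Section extremal.
Variables (R : realType) (d : nat).
Implicit Types (K : set 'rV[R]_d) (X Y Z : 'M[R]_(d.+1, d)).

Definition tuples K : set 'M[R]_(d.+1, d) := [set X | forall i, K (row i X)].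

Lemma tuples_compact K : compact K -> compact (tuples K).
Proof.
move=> cK; rewrite compact_ultra => F FU FK.
have H i : {p : 'rV[R]_d | K p /\ row i Z @[Z --> F] --> p}.
  apply: cid; move: cK; rewrite compact_ultra => cK.
  have FKi : F ((row i : 'M[R]_(d.+1, d) -> 'rV[R]_d) @^-1` K) by apply: filterS FK => Z; exact.
  have [p [Kp up]] := cK _ (ultra_fmap (row i : 'M[R]_(d.+1, d) -> 'rV[R]_d) FU) FKi.
  by exists p.
exists (\matrix_(i, k) sval (H i) 0 k); split.
  move=> i; have [+ _] := svalP (H i); congr (K _).
  by apply/rowP => k; rewrite !mxE.
have : id @ F --> \matrix_(i, k) sval (H i) 0 k; last by [].
apply: (proj1 (@cvg_mxP R _ F _ _ _ id _)) => i k; rewrite mxE.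
have [_ /cvg_mxP/(_ 0 k)] := svalP (H i); apply: cvg_trans; apply: near_eq_cvg.
by apply: filterS filterT => Z _; rewrite mxE.
Qed.

Lemma Phi_continuous : continuous (@Phi R d).
Proof. by move=> X; apply: (@Phi_cvg R d _ (nbhs X) _ id X); exact: cvg_id. Qed.

Lemma Phigrad_sqnorm_continuous : continuous (fun X => mxdot (Phigrad X) (Phigrad X)).
Proof.
move=> X; have : Phigrad Y @[Y --> X] --> Phigrad X.
  by apply: (@Phigrad_cvg R d _ (nbhs X) _ id X); exact: cvg_id.
move=> /(@cvg_mxP R _ (nbhs X) _) H.
apply: (@cvg_sumr R _ (nbhs X) _) => i _; apply: (@cvg_sumr R _ (nbhs X) _) => k _.
exact: (cvgM (H i k) (H i k)).
Qed.

Lemma vol_rows_neq X i j : vol X != 0 -> i != j -> row i X != row j X.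
Proof.
move=> v0 ij; apply/negP => /eqP E; move/negP: v0; apply.
have := vgrad_dot X i j; rewrite eq_sym ij mul1r => <-.
rewrite big1// => k _; have := congr1 (fun x : 'rV[R]_d => x 0 k) E.
by rewrite !mxE => ->; rewrite subrr mulr0.
Qed.

(** The separation [r] is uniform over all maximizers because they form a compact set of
    nondegenerate simplices; bumps of radius [r / 2] will then meet at most one vertex of each
    maximizer. *)
Lemma extremal_simplex K : compact K -> (exists2 Z, tuples K Z & vol Z != 0) ->
  exists X, [/\ tuples K X, vol X != 0, forall Z, tuples K Z -> Phi Z <= Phi X,
    forall Z, tuples K Z -> Phi Z = Phi X ->
      mxdot (Phigrad Z) (Phigrad Z) <= mxdot (Phigrad X) (Phigrad X) &
    exists2 r : R, 0 < r & forall Z, tuples K Z -> Phi Z = Phi X -> forall i j, i != j ->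
      r <= `|row i Z - row j Z|].
Proof.
move=> cK [Z0 KZ0 vZ0].
have cT := tuples_compact cK.
have T0 : tuples K !=set0 by exists Z0.
have [M0 + HM0] := compact_EVT_max T0 cT (continuous_subspaceT Phi_continuous).
rewrite inE => KM0.
have {}HM0 Z : tuples K Z -> Phi Z <= Phi M0 by move=> KZ; apply: HM0; rewrite inE.
pose M := tuples K `&` [set Z | Phi Z = Phi M0].
have cM : compact M.
  apply: compact_closedI => //.
  rewrite (_ : [set Z | _] = @Phi R d @^-1` [set Phi M0])//.
  apply: preimage_closed; last exact: closed_eq.
  by move=> Z _; exact: Phi_continuous.
have M0' : M !=set0 by exists M0.
have [X + HX] := compact_EVT_max M0' cM (continuous_subspaceT Phigrad_sqnorm_continuous).
rewrite inE => -[KX PX].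
have v0 Z : M Z -> vol Z != 0.
  by move=> [_ /= PZ]; rewrite -Phi_gt0 PZ (lt_le_trans _ (HM0 _ KZ0))// Phi_gt0.
exists X; split=> //.
- exact: v0.
- by move=> Z KZ; rewrite PX HM0.
- by move=> Z KZ PZ; apply: HX; rewrite inE; split=> //=; rewrite PZ PX.
have H (p : 'I_d.+1 * 'I_d.+1) : {r : R | 0 < r /\ forall Z, M Z -> p.1 != p.2 ->
    r <= `|row p.1 Z - row p.2 Z|}.
  apply: cid; have [p12|p12] := eqVneq p.1 p.2; first by exists 1.
  have cf : continuous (fun Z => `|row p.1 Z - row p.2 Z|).
    move=> Z; have hr i : row i Z' @[Z' --> Z] --> row i Z.
      apply: (proj1 (@cvg_mxP R _ (nbhs Z) _ _ _ _ _)) => a k.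
      rewrite mxE; under eq_fun do rewrite mxE.
      exact: (@coord_continuous R d.+1 d i k Z).
    exact: (cvg_norm (cvgB (hr p.1) (hr p.2))).
  have [c + Hc] := compact_EVT_min M0' cM (continuous_subspaceT cf).
  rewrite inE => Mc; exists (`|row p.1 c - row p.2 c|); split.
    by rewrite normr_gt0 subr_eq0 vol_rows_neq// v0.
  by move=> Z MZ _; apply: Hc; rewrite inE.
exists (\big[Num.min/1]_p sval (H p)).
  by apply: lt_bigmin => // p _; have [] := svalP (H p).
move=> Z KZ PZ i j ij; have [_ h] := svalP (H (i, j)).
apply: le_trans (h Z _ ij); last by split=> //=; rewrite PZ PX.
exact: bigmin_le_cond.
Qed.

End extremal.

(* The gain of a tuple [Y] under the displacement field
   [u y = \sum_a b a y *: Phigrad X a] is at most |Phigrad Y| |u Y|, and both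
   factors are at most |Phigrad X|; equality forces [Y] to be [X] up to a
   permutation [s] of the vertices with matching gradients. *)
Lemma gain_rigid (R : realType) (d : nat) (X Y : 'M[R]_(d.+1, d))
    (b : 'I_d.+1 -> 'rV[R]_d -> R) :
  (1 < d)%N -> vol X != 0 -> Phi Y = Phi X ->
  mxdot (Phigrad Y) (Phigrad Y) <= mxdot (Phigrad X) (Phigrad X) ->
  (forall a y, 0 <= b a y <= 1) -> (forall a, b a (row a X) = 1) ->
  (forall a y, b a y = 1 -> y = row a X) ->
  (forall a c y, b a y != 0 -> b c y != 0 -> a = c) ->
  (forall a i j, b a (row i Y) != 0 -> b a (row j Y) != 0 -> i = j) ->
  mxdot (Phigrad X) (Phigrad X) <=
    mxdot (Phigrad Y) (\matrix_(i, k) \sum_a b a (row i Y) * Phigrad X a k) ->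
  Y = X.
Proof.
move=> d1 v0 PE GY b01 bx b1 bdisj bsep gain.
set GX := Phigrad X in GY gain *; set GYm := Phigrad Y in GY gain *.
set u := (\matrix_(i, k) _) in gain.
pose N a := \sum_k GX a k ^+ 2.
(* The total squared weight that bump [a] puts on the vertices of [Y]. By [bsep] at most one term is
   nonzero, so it is at most 1. *)
pose beta a := \sum_i b a (row i Y) ^+ 2.
have N0 a : 0 < N a.
  have [k k0] := Phigrad_neq0 a (ltnW d1) v0.
  rewrite /N (bigD1 k)//= ltr_pwDl ?exprn_even_gt0//.
  by apply: sumr_ge0 => l _; exact: sqr_ge0.
have single a i : b a (row i Y) != 0 -> beta a = b a (row i Y) ^+ 2.
  move=> bi; rewrite /beta (bigD1 i)//= big1 ?addr0// => j ji.
  have [->|bj] := eqVneq (b a (row j Y)) 0; first by rewrite expr0n.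
  by move: ji; rewrite (bsep _ _ _ bi bj) eqxx.
have beta1 a : beta a <= 1.
  have [[i bi]|nb] := pselect (exists i, b a (row i Y) != 0).
    by rewrite (single _ _ bi) exprn_ile1//; have /andP[] := b01 a (row i Y).
  rewrite /beta big1// => i _; apply/eqP; rewrite sqrf_eq0.
  by apply/negP => /negP bi; apply: nb; exists i.
have uu : mxdot u u = \sum_a N a * beta a.
  rewrite /mxdot; transitivity (\sum_i \sum_a b a (row i Y) ^+ 2 * N a); last first.
    rewrite exchange_big /=; apply: eq_bigr => a _.
    by rewrite /beta mulr_sumr; apply: eq_bigr => i _; rewrite mulrC.
  apply: eq_bigr => i _.
  transitivity (\sum_k \sum_a b a (row i Y) ^+ 2 * GX a k ^+ 2); last first.
    by rewrite exchange_big; apply: eq_bigr => a _; rewrite mulr_sumr.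
  apply: eq_bigr => k _; rewrite mxE mulr_suml; apply: eq_bigr => a _.
  have [->|ba] := eqVneq (b a (row i Y)) 0; first by rewrite expr0n !mul0r.
  rewrite (bigD1 a)//= big1 ?addr0 -?exprMn ?expr2//.
  move=> c ca; have [->|bc] := eqVneq (b c (row i Y)) 0; first by rewrite mul0r.
  by move: ca; rewrite (bdisj _ _ _ ba bc) eqxx.
have NE : mxdot GX GX = \sum_a N a.
  by apply: eq_bigr => a _; apply: eq_bigr => k _; rewrite expr2.
have sq : \sum_i \sum_k (GYm i k - u i k) ^+ 2 =
    mxdot GYm GYm - 2 * mxdot GYm u + mxdot u u.
  rewrite /mxdot mulr_sumr -sumrB -big_split /=; apply: eq_bigr => i _.
  rewrite mulr_sumr -sumrB -big_split /=; apply: eq_bigr => k _; ring.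
have sq0 : 0 <= \sum_i \sum_k (GYm i k - u i k) ^+ 2.
  by apply: sumr_ge0 => i _; apply: sumr_ge0 => k _; exact: sqr_ge0.
have nb0 : 0 <= \sum_a N a * (1 - beta a).
  by apply: sumr_ge0 => a _; rewrite mulr_ge0 ?subr_ge0// ltW.
have nbE : \sum_a N a * (1 - beta a) = mxdot GX GX - mxdot u u.
  by rewrite NE uu -sumrB; apply: eq_bigr => a _; rewrite mulrBr mulr1.
(* The left-hand sides of [sq] and [nbE] add up to |Phigrad Y|^2 + |Phigrad X|^2 minus twice the
   gain, which is at most 0 by [GY] and [gain]. Both are nonnegative, hence both are 0. *)
have sqE : \sum_i \sum_k (GYm i k - u i k) ^+ 2 = 0 by lra.
have nbE0 : \sum_a N a * (1 - beta a) = 0 by lra.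
have Gu i k : GYm i k = u i k.
  apply/eqP; rewrite -subr_eq0 -sqrf_eq0; apply/eqP.
  have /psumr_eq0P := sqE => /(_ (fun i _ => sumr_ge0 _ (fun k _ => sqr_ge0 _)) i isT).
  by move=> /psumr_eq0P; apply=> // l _; exact: sqr_ge0.
have beta_eq1 a : beta a = 1.
  have /psumr_eq0P := nbE0 => /(_ _ a isT) h.
  apply/eqP; rewrite eq_sym -subr_eq0; apply/eqP.
  have : N a * (1 - beta a) = 0.
    by apply: h => c _; rewrite mulr_ge0 ?subr_ge0// ltW.
  by move=> /eqP; rewrite mulf_eq0 (gt_eqF (N0 a)) => /eqP.
(* [beta a = 1] with a single nonzero term makes some vertex of [Y] a point where bump [a] is 1, the
   value -1 being excluded by positivity; that point can only be [x_a]. *)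
have Hs a : {i | row i Y = row a X}.
  apply: cid; have [[i bi]|nb] := pselect (exists i, b a (row i Y) != 0).
    exists i; apply: b1; have /andP[h0 h1] := b01 a (row i Y).
    have := single _ _ bi; rewrite beta_eq1 => /esym/eqP.
    by rewrite sqrf_eq1 => /orP[/eqP//|/eqP E]; move: h0; rewrite E; lra.
  have : beta a = 0.
    rewrite /beta big1// => i _; apply/eqP; rewrite sqrf_eq0.
    by apply/negP => /negP bi; apply: nb; exists i.
  by rewrite beta_eq1 => /eqP; rewrite oner_eq0.
pose s a := sval (Hs a).
have sE a : row (s a) Y = row a X by exact: (svalP (Hs a)).
have inj_s : injective s.
  move=> a c ac; apply: (bdisj a c (row a X)); first by rewrite bx oner_neq0.
  by rewrite -(sE a) ac sE bx oner_neq0.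
have YX a k : Y (s a) k = X a k.
  by have := congr1 (fun x : 'rV[R]_d => x 0 k) (sE a); rewrite !mxE.
have GE a k : GYm (s a) k = GX a k.
  rewrite Gu mxE sE (bigD1 a)//= bx mul1r big1 ?addr0// => c ca.
  have [->|bc] := eqVneq (b c (row a X)) 0; first by rewrite mul0r.
  have ba : b a (row a X) != 0 by rewrite bx oner_neq0.
  by move: ca; rewrite (bdisj _ _ _ ba bc) eqxx.
have sid := Phigrad_rigid d1 inj_s v0 YX PE GE.
by apply/matrixP => i k; rewrite -YX sid.
Qed.

(** * Symmetries of perturbed domains *)

Lemma row_cvg (R : realType) (m n : nat) (T : Type) (G : set_system T) {GG : Filter G}
    (Z : T -> 'M[R]_(m, n)) (Z0 : 'M[R]_(m, n)) i :
  Z @ G --> Z0 -> (fun t => row i (Z t)) @ G --> row i Z0.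
Proof.
move=> /cvg_mxP H; apply: (proj1 (@cvg_mxP R _ G _ _ _ _ _)) => a k.
by rewrite mxE; under eq_fun do rewrite mxE; exact: H.
Qed.

Section limit.
Variables (R : realType) (d : nat) (W K : set 'rV[R]_d) (X : 'M[R]_(d.+1, d)).
Variables (b : 'I_d.+1 -> 'rV[R]_d -> R).
Hypothesis d1 : (1 < d)%N.
Hypothesis W0 : W !=set0.
Hypothesis WB : exists B : R, forall x, W x -> `|x| <= B.
Hypothesis cK : compact K.
Hypothesis WK : W `<=` K.
Hypothesis KW : forall x, K x -> forall e : R, 0 < e -> exists2 w, W w & `|w - x| <= e.
Hypothesis KX : tuples K X.
Hypothesis v0 : vol X != 0.
Hypothesis Xmax : forall Z, tuples K Z -> Phi Z <= Phi X.
Hypothesis Gmax : forall Z, tuples K Z -> Phi Z = Phi X ->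
  mxdot (Phigrad Z) (Phigrad Z) <= mxdot (Phigrad X) (Phigrad X).
Hypothesis b01 : forall a y, 0 <= b a y <= 1.
Hypothesis bx : forall a, b a (row a X) = 1.
Hypothesis b1 : forall a y, b a y = 1 -> y = row a X.
Hypothesis bdisj : forall a c y, b a y != 0 -> b c y != 0 -> a = c.
Hypothesis bsep : forall Z, tuples K Z -> Phi Z = Phi X -> forall a i j,
  b a (row i Z) != 0 -> b a (row j Z) != 0 -> i = j.

Definition field_on (Z : 'M[R]_(d.+1, d)) : 'M[R]_(d.+1, d) :=
  \matrix_(i, k) \sum_a b a (row i Z) * Phigrad X a k.

Variables (U : set_system nat) (t : nat -> R) (F : nat -> 'rV[R]_d -> 'rV[R]_d).
Context {UU : UltraFilter U}.
Hypothesis t_gt0 : forall n, 0 < t n.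
Hypothesis t_cvg0 : t @ U --> 0.
Hypothesis F_bounded : forall n, exists C : R, forall x, `|F n x - x| <= C.
(** A first-order expansion in [t] stated along moving points, the form in which it survives both
    the composition of shears and an additional displacement of size [t ^ 2]. *)
Hypothesis F_displacement : forall (y : nat -> 'rV[R]_d) (p : 'rV[R]_d), y @ U --> p ->
  (fun n => (t n)^-1 *: (F n (y n) - y n)) @ U --> \sum_a b a p *: row a (Phigrad X).

Let Fmx n (Z : 'M[R]_(d.+1, d)) : 'M[R]_(d.+1, d) := \matrix_(i, k) F n (row i Z) 0 k.
Let V n Z := (t n)^-1 *: (Fmx n Z - Z).

Let t_neq0 n : t n != 0. Proof. by rewrite gt_eqF. Qed.

Let row_Fmx n Z i : row i (Fmx n Z) = F n (row i Z).
Proof. by apply/rowP => k; rewrite !mxE. Qed.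

Let FmxE n Z : Fmx n Z = Z + t n *: V n Z.
Proof. by rewrite /V scalerA mulfV// scale1r subrKC. Qed.

Let V_cvg (Z : nat -> 'M[R]_(d.+1, d)) (Z0 : 'M[R]_(d.+1, d)) : Z @ U --> Z0 ->
  (fun n => V n (Z n)) @ U --> field_on Z0.
Proof.
move=> hZ; apply: (proj1 (@cvg_mxP R _ U _ _ _ _ _)) => i k.
have H : (fun n => (t n)^-1 *: (F n (row i (Z n)) - row i (Z n))) @ U -->
    \sum_a b a (row i Z0) *: row a (Phigrad X).
  by apply: F_displacement; exact: row_cvg.
have /cvg_mxP/(_ 0 k) := H; rewrite /field_on mxE.
have -> : (\sum_a b a (row i Z0) *: row a (Phigrad X)) 0 k =
    \sum_a b a (row i Z0) * Phigrad X a k.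
  by rewrite summxE; apply: eq_bigr => a _; rewrite !mxE.
apply: cvg_trans; apply: near_eq_cvg; apply: filterS filterT => n _.
by rewrite /V !mxE.
Qed.

Let Fmx_cvg (Z : nat -> 'M[R]_(d.+1, d)) (Z0 : 'M[R]_(d.+1, d)) : Z @ U --> Z0 ->
  (fun n => Fmx n (Z n)) @ U --> Z0.
Proof.
move=> hZ; rewrite -[Z0]addr0 -[0 as Y in _ + Y](scale0r (field_on Z0)).
under eq_fun do rewrite FmxE.
by apply: cvgD => //; apply: cvgZ => //; exact: V_cvg.
Qed.

Let quotient (Z : nat -> 'M[R]_(d.+1, d)) (Z0 : 'M[R]_(d.+1, d)) : Z @ U --> Z0 ->
  (Phi (Fmx n (Z n)) - Phi (Z n)) / t n @[n --> U] --> mxdot (Phigrad Z0) (field_on Z0).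
Proof.
move=> hZ; under eq_fun do rewrite FmxE.
by apply: Phi_quotient => //; exact: V_cvg.
Qed.

Let field_on_X : field_on X = Phigrad X.
Proof.
apply/matrixP => i k; rewrite mxE (bigD1 i)//= bx mul1r big1 ?addr0// => a ai.
have [->|ba] := eqVneq (b a (row i X)) 0; first by rewrite mul0r.
have bi : b i (row i X) != 0 by rewrite bx oner_neq0.
by move: ai; rewrite (bdisj ba bi) eqxx.
Qed.

(* Up to o(t), moving the vertices of [X] by the displacement field is the best
   one can do among tuples of [F n @` W]. *)
Let near_optimal_cvg (Z : nat -> 'M[R]_(d.+1, d)) : (forall n, tuples W (Z n)) ->
  (forall n Z', tuples W Z' -> Phi (Fmx n Z') <= Phi (Fmx n (Z n)) + t n ^+ 2) ->
  Z @ U --> X.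
Proof.
move=> WZ opt.
have KZ n : tuples K (Z n) by move=> i; apply: WK; exact: WZ.
have [Z0 KZ0 hZ] := ultra_compact_cvg UU (tuples_compact cK) KZ.
(* The vertices of [X] lie only in [K]; they are approximated from [W] within [t n ^ 2], so that the
   error is still o(1) after division by [t n]. The corrected velocity [V'] below absorbs it and
   lets the quotient be taken at the fixed base point [X]. *)
have Hw n : {w : 'M[R]_(d.+1, d) | tuples W w /\ `|w - X| <= t n ^+ 2}.
  apply: cid; have tn2 : 0 < t n ^+ 2 by rewrite exprn_gt0.
  have H i : {w : 'rV[R]_d | W w /\ `|w - row i X| <= t n ^+ 2}.
    by apply: cid; have [w Ww wX] := KW (KX i) tn2; exists w.
  exists (\matrix_(i, k) sval (H i) 0 k); split.
    move=> i; have [+ _] := svalP (H i); congr (W _).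
    by apply/rowP => k; rewrite !mxE.
  apply: mx_norm_ler => [|i k]; first exact: ltW.
  have [_] := svalP (H i); apply: le_trans.
  by have := ler_mx_entry (sval (H i) - row i X) 0 k; rewrite !mxE.
pose w n := sval (Hw n).
have Ww n : tuples W (w n) by have [] := svalP (Hw n).
have wX n : `|w n - X| <= t n ^+ 2 by have [] := svalP (Hw n).
pose V' n := V n (w n) + (t n)^-1 *: (w n - X).
have FwE n : Fmx n (w n) = X + t n *: V' n.
  have E : t n *: ((t n)^-1 *: (w n - X)) = w n - X by rewrite scalerA mulfV// scale1r.
  by rewrite FmxE /V' scalerDr E [RHS]addrCA subrKC addrC.
have d0 : (t n)^-1 *: (w n - X) @[n --> U] --> (0 : 'M[R]_(d.+1, d)).
  apply/cvgrPdist_le => e e0; move/cvgrPdist_le: t_cvg0 => /(_ _ e0).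
  apply: filterS => n; rewrite !sub0r !normrN gtr0_norm// => te.
  rewrite normrZ normfV gtr0_norm// ler_pdivrMl// (le_trans (wX n))// expr2.
  by rewrite ler_wpM2l// ltW.
have hw : w @ U --> X.
  have : X + t n *: ((t n)^-1 *: (w n - X)) @[n --> U] --> X + 0 *: (0 : 'M[R]_(d.+1, d)).
    by apply: cvgD; [exact: cvg_cst|apply: cvgZ].
  rewrite scale0r addr0; apply: cvg_trans; apply: near_eq_cvg; apply: filterS filterT => n _.
  by rewrite scalerA mulfV// scale1r subrKC.
have hV' : V' @ U --> Phigrad X.
  by rewrite -[Phigrad X]addr0 -field_on_X; apply: cvgD => //; exact: V_cvg.
have q1 : (Phi (X + t n *: V' n) - Phi X) / t n @[n --> U] --> mxdot (Phigrad X) (Phigrad X).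
  by apply: (@Phi_quotient R d nat U _ (cst X)) => //; exact: cvg_cst.
have q2 := quotient hZ.
(* Compare [Z n] with the competitor [w n]: near-optimality together with [Phi (Z n) <= Phi X]
   bounds the quotient based at [X], minus [t n], by the quotient based at [Z n]. *)
have gain : mxdot (Phigrad X) (Phigrad X) <= mxdot (Phigrad Z0) (field_on Z0).
  have q1' : (Phi (X + t n *: V' n) - Phi X) / t n - t n @[n --> U] -->
      mxdot (Phigrad X) (Phigrad X) - 0 by apply: cvgB.
  rewrite -[leLHS]subr0; apply: (ler_cvg_to q1' q2); apply: filterS filterT => n _ /=.
  rewrite -FwE ler_pdivlMr// mulrBl mulfVK// -expr2.
  by have := opt n _ (Ww n); have := Xmax (KZ n); lra.
have P0 : Phi Z0 = Phi X.
  apply/eqP; rewrite eq_le Xmax//=.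
  have c1 : Phi (Fmx n (Z n)) + t n ^+ 2 @[n --> U] --> Phi Z0 + 0.
    apply: cvgD.
      by apply: (Phi_cvg (X := fun n => Fmx n (Z n))); exact: Fmx_cvg.
    rewrite -(mul0r (0 : R)); under eq_fun do rewrite expr2.
    exact: cvgM.
  have c2 : Phi (Fmx n (w n)) @[n --> U] --> Phi X.
    by apply: (Phi_cvg (X := fun n => Fmx n (w n))); exact: Fmx_cvg.
  rewrite -[leRHS]addr0; apply: (ler_cvg_to c2 c1); apply: filterS filterT => n _ /=.
  exact: opt.
suff <- : Z0 = X by [].
apply: (gain_rigid d1 v0 P0 _ b01 bx b1 bdisj) => //; first exact: Gmax.
by move=> a i j; exact: bsep.
Qed.

(** The maximum over tuples of [W] need not be attained, hence the tolerance. The supremum is finite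
    because [F n], having bounded displacement, sends [W] into a compact ball on whose tuples [Phi]
    is bounded. *)
Let near_optimal n : {Z : 'M[R]_(d.+1, d) | tuples W Z /\
  forall Z', tuples W Z' -> Phi (Fmx n Z') <= Phi (Fmx n Z) + t n ^+ 2}.
Proof.
apply: cid.
pose S := [set Phi (Fmx n Z) | Z in tuples W].
have [w Ww] := W0; have [B HB] := WB; have [C HC] := F_bounded n.
have hS : has_sup S.
  split; first by exists (Phi (Fmx n (\matrix_(i, k) w 0 k))), (\matrix_(i, k) w 0 k) => // i;
    rewrite (_ : row _ _ = w)//; apply/rowP => k; rewrite !mxE.
  pose K' := [set x : 'rV[R]_d | `|x| <= B + C].
  have cK' : compact K'.
    apply: bounded_closed_compact.
      by exists (B + C); split=> [|y yM x /= xM]; [exact: num_real|rewrite (le_trans xM)// ltW].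
    rewrite (_ : K' = (fun x => `|x|) @^-1` [set y | y <= B + C])//.
    apply: preimage_closed; last exact: closed_le.
    by move=> x _; exact: norm_continuous.
  have FK' Z : tuples W Z -> tuples K' (Fmx n Z).
    move=> WZ i; rewrite row_Fmx /K' /= -(subrK (row i Z) (F n (row i Z))) addrC.
    by rewrite (le_trans (ler_normD _ _))// lerD// HB.
  have T0 : tuples K' !=set0.
    exists (Fmx n (\matrix_(i, k) w 0 k)); apply: FK' => i.
    by rewrite (_ : row _ _ = w)//; apply/rowP => k; rewrite !mxE.
  have [Z0 _ HZ0] := compact_EVT_max T0 (tuples_compact cK')
    (continuous_subspaceT (@Phi_continuous R d)).
  by exists (Phi Z0) => _ [Z WZ <-]; apply: HZ0; rewrite inE; exact: FK'.
have tn2 : 0 < t n ^+ 2 by rewrite exprn_gt0.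
have [_ [Z WZ <-] lt_sup] := sup_adherent tn2 hS.
exists Z; split=> // Z' WZ'.
have : Phi (Fmx n Z') <= sup S by apply: ub_le_sup; [exact: hS.2|exists Z'].
by move: lt_sup; rewrite -/S; lra.
Qed.

Variables (A : nat -> 'M[R]_d) (c : nat -> 'rV[R]_d).
Hypothesis AA : forall n, A n *m (A n)^T = 1%:M.
Hypothesis sym : forall n, (fun x => x *m A n + c n) @` (F n @` W) = F n @` W.

Lemma symmetries_cvg_id : A @ U --> (1%:M : 'M[R]_d) /\ c @ U --> (0 : 'rV[R]_d).
Proof.
pose Z n := sval (near_optimal n).
have WZ n : tuples W (Z n) by have [] := svalP (near_optimal n).
have optZ n Z' : tuples W Z' -> Phi (Fmx n Z') <= Phi (Fmx n (Z n)) + t n ^+ 2.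
  by have [_] := svalP (near_optimal n); exact.
have HY n : {Y : 'M[R]_(d.+1, d) | tuples W Y /\ Fmx n Y = affine (A n) (c n) (Fmx n (Z n))}.
  apply: cid.
  have H i : {y : 'rV[R]_d | W y /\ F n y = row i (affine (A n) (c n) (Fmx n (Z n)))}.
    apply: cid.
    have : ((fun x => x *m A n + c n) @` (F n @` W)) (row i (affine (A n) (c n) (Fmx n (Z n)))).
      exists (row i (Fmx n (Z n))); first by rewrite row_Fmx; exists (row i (Z n)) => //; exact: WZ.
      apply/rowP => k; rewrite !mxE big_ord1 !mxE mul1r; congr (_ + _).
      by apply: eq_bigr => l _; rewrite mxE.
    by rewrite sym => -[y Wy Fy]; exists y.
  exists (\matrix_(i, k) sval (H i) 0 k).
  have rE i : row i (\matrix_(i, k) sval (H i) 0 k) = sval (H i).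
    by apply/rowP => k; rewrite !mxE.
  split; first by move=> i; rewrite rE; have [] := svalP (H i).
  by apply/row_matrixP => i; rewrite row_Fmx rE; have [_ ->] := svalP (H i).
pose Y n := sval (HY n).
have WY n : tuples W (Y n) by have [] := svalP (HY n).
have YE n : Fmx n (Y n) = affine (A n) (c n) (Fmx n (Z n)) by have [] := svalP (HY n).
have hZ : Z @ U --> X by exact: near_optimal_cvg.
have hY : Y @ U --> X.
  by apply: near_optimal_cvg => // n Z' WZ'; rewrite YE Phi_affine// optZ.
have hFZ := Fmx_cvg hZ; have hFY := Fmx_cvg hY.
have entA n i j : `|A n i j| <= 1.
  have := congr1 (fun M : 'M[R]_d => M i i) (AA n); rewrite !mxE eqxx => E.
  rewrite -(@ler_sqr _ _ 1) ?nnegrE// expr1n real_normK ?num_real// -[leRHS]E (bigD1 j)//= !mxE.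
  by rewrite -expr2 lerDl; apply: sumr_ge0 => l _; rewrite mxE -expr2 sqr_ge0.
(* Entries of orthogonal matrices lie in [-1, 1], so they converge along the ultrafilter without
   extraction of a subsequence. *)
have [A0 hA] : exists A0 : 'M[R]_d, A @ U --> A0.
  have H (p : 'I_d * 'I_d) : {l : R | A n p.1 p.2 @[n --> U] --> l}.
    apply: cid; have [|l _ hl] := @ultra_compact_cvg R _ U `[-1, 1]%classic
      (fun n => A n p.1 p.2) UU (@segment_compact _ _ _); last by exists l.
    by move=> n; rewrite /= in_itv /= -ler_norml.
  exists (\matrix_(i, j) sval (H (i, j))).
  by apply: (proj1 (@cvg_mxP R _ U _ _ _ _ _)) => i j; rewrite mxE; exact: (svalP (H (i, j))).
have mulA i k (Q : nat -> 'M[R]_(d.+1, d)) (Q0 : 'M[R]_(d.+1, d)) : Q @ U --> Q0 ->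
    (Q n *m A n) i k @[n --> U] --> (Q0 *m A0) i k.
  move=> /cvg_mxP hQ; rewrite mxE; under eq_fun do rewrite mxE.
  by apply: cvg_sumr => l _; apply: cvgM => //; have /cvg_mxP := hA; apply.
(* No bound on the translations is given in advance; they are read off from the image of vertex 0,
   and so converge with the other data. *)
have cE n k : c n 0 k = Fmx n (Y n) ord0 k - (Fmx n (Z n) *m A n) ord0 k.
  by rewrite YE affineE addrC addKr.
pose c0 : 'rV[R]_d := \row_k (X ord0 k - (X *m A0) ord0 k).
have hc : c @ U --> c0.
  apply: (proj1 (@cvg_mxP R _ U _ _ _ _ _)) => i k; rewrite (ord1 i) mxE.
  under eq_fun do rewrite cE.
  by apply: cvgB; [have /cvg_mxP := hFY; apply|exact: mulA].
have fixX : affine A0 c0 X = X.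
  apply/matrixP => i k.
  have h1 : Fmx n (Y n) i k @[n --> U] --> X i k by have /cvg_mxP := hFY; apply.
  have h2 : Fmx n (Y n) i k @[n --> U] --> affine A0 c0 X i k.
    rewrite affineE; under eq_fun do rewrite YE affineE.
    by apply: cvgD; [exact: mulA|have /cvg_mxP := hc; apply].
  exact: (cvg_unique _ h2 h1).
by have [A01 c00] := affine_fix v0 fixX; rewrite A01 in hA; rewrite c00 in hc.
Qed.

End limit.

(** * Density *)

(** Each shear acts at a point that the previous ones have moved by o(1), so by continuity of the
    bumps the displacements add up to first order. *)
Lemma shears_displacement (R : realType) (d m : nat) (I : Type) (l : seq I)
    (b : I -> 'rV[R]_d -> R) (v : I -> 'rV[R]_d) (U : set_system nat) {UF : Filter U}
    (t : nat -> R) (phi : nat -> I -> Diff0 R d m) :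
  (forall a, continuous (b a)) -> (forall n, t n != 0) -> t @ U --> 0 ->
  (forall n a y, phi n a y = y + (t n * b a y) *: v a) ->
  forall (y : nat -> 'rV[R]_d) (p : 'rV[R]_d), y @ U --> p ->
  (fun n => (t n)^-1 *: (compose_diffs [seq phi n a | a <- l] (y n) - y n)) @ U -->
    \sum_(a <- l) b a p *: v a.
Proof.
move=> cb t0 t_cvg phiE; elim: l => [|a l IH] y p hy.
  rewrite big_nil; rewrite (_ : (fun n => _) = cst 0); first exact: cvg_cst.
  by apply/funext => n; rewrite /compose_diffs /= subrr scaler0.
have hb : b a (y n) @[n --> U] --> b a p by apply: continuous_cvg hy; exact: cb.
have hy' : phi n a (y n) @[n --> U] --> p.
  rewrite -[p]addr0 -[0 as X in _ + X](scale0r (v a)) -[0 as X in X *: _](mul0r (b a p)).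
  under eq_fun do rewrite phiE.
  by apply: cvgD => //; apply: cvgZr_tmp; apply: cvgM.
rewrite big_cons addrC.
have hz : b a (y n) *: v a @[n --> U] --> b a p *: v a by exact: cvgZr_tmp hb.
rewrite (_ : (fun n => _) = fun n => (t n)^-1 *: (compose_diffs [seq phi n c | c <- l]
    (phi n a (y n)) - phi n a (y n)) + b a (y n) *: v a); first exact: (cvgD (IH _ _ hy') hz).
apply/funext => n; rewrite compose_diffs_cons /=; set z := compose_diffs _ _.
rewrite -[in LHS](subrK (phi n a (y n)) z) -addrA scalerDr; congr (_ + _).
by rewrite phiE [_ - y n]addrAC subrr add0r scalerA mulrA mulVf// mul1r.
Qed.

(** The simplex has corner [p] and edges [s] along the axes. The block factorization separates the
    translation by [p], of determinant 1, from the edges, of determinant [s ^ d]. *)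
Lemma vol_corner_neq0 (R : realType) (d : nat) (p : 'rV[R]_d) (s : R) : s != 0 ->
  vol (col_mx p (const_mx 1 *m p + s%:M) : 'M[R]_(1 + d, d)) != 0.
Proof.
move=> s0.
have -> : vol (col_mx p (const_mx 1 *m p + s%:M) : 'M[R]_(1 + d, d)) =
    \det (block_mx 1%:M 0 (const_mx 1) s%:M *m block_mx 1%:M p 0 1%:M : 'M[R]_(1 + d)).
  rewrite mulmx_block !mul1mx !mulmx1 !mul0mx !mulmx0 !addr0.
  rewrite /vol /homog /block_mx; congr (\det _).
  apply/matrixP => i j; case: (@split_ordP 1 d i) => i' ->; case: (@split_ordP 1 d j) => j' ->.
  - rewrite (@row_mxEl _ (1 + d) 1 d) (@col_mxEu _ 1 d (1 + d)) (@row_mxEl _ 1 1 d) !mxE.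
    by rewrite (ord1 i') (ord1 j').
  - by rewrite (@row_mxEr _ (1 + d) 1 d) (@col_mxEu _ 1 d d)
      (@col_mxEu _ 1 d (1 + d)) (@row_mxEr _ 1 1 d).
  - by rewrite (@row_mxEl _ (1 + d) 1 d) (@col_mxEd _ 1 d (1 + d)) (@row_mxEl _ d 1 d) !mxE.
  - by rewrite (@row_mxEr _ (1 + d) 1 d) (@col_mxEd _ 1 d d)
      (@col_mxEd _ 1 d (1 + d)) (@row_mxEr _ d 1 d).
rewrite (@det_mulmx _ (1 + d)) (@det_lblock _ 1 d) (@det_ublock _ 1 d) !det1 !mul1r det_scalar.
by rewrite mulr1 expf_neq0.
Qed.

Section asymmetry.
Variables (R : realType) (d m : nat) (D : set 'rV[R]_d).

Definition nearly_asymmetric (e : R) : set (shape_space m D) :=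
  [set W | forall (A : 'M[R]_d) (c : 'rV[R]_d), A *m A^T = 1%:M ->
    (fun x => x *m A + c) @` val W = val W -> `|A - 1%:M| < e /\ `|c| < e].

Lemma eq0_of_lt_inv (r : R) : 0 <= r -> (forall n : nat, r < n.+1%:R^-1) -> r = 0.
Proof.
move=> r0 H; apply/eqP; rewrite eq_le r0 andbT leNgt; apply/negP => rp.
have := H (Num.truncn (r^-1)); rewrite ltNge => /negP; apply.
rewrite -[leRHS]invrK lef_pV2 ?posrE ?invr_gt0//; apply: ltW.
exact: truncnS_gt.
Qed.

Lemma nearly_asymmetric_Iso (W : shape_space m D) :
  (forall n : nat, nearly_asymmetric n.+1%:R^-1 W) -> Iso (val W) = [set id].
Proof.
move=> H; apply/seteqP; split=> [S [[A [c [AA ->]]] SW]|_ ->]; last first.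
  split; last by rewrite image_id.
  exists 1%:M, 0; split; first by rewrite mul1mx trmx1.
  by apply/funext => x; rewrite mulmx1 addr0.
have A1 : A = 1%:M.
  apply/eqP; rewrite -subr_eq0 -normr_eq0; apply/eqP; apply: eq0_of_lt_inv => // n.
  by have [] := H n A c AA SW.
have c0 : c = 0.
  apply/eqP; rewrite -normr_eq0; apply/eqP; apply: eq0_of_lt_inv => // n.
  by have [] := H n A c AA SW.
by apply/funext => x; rewrite A1 c0 mulmx1 addr0.
Qed.

Hypotheses (hd : (2 <= d)%N) (hm : (0 < m)%N) (D_nonempty : D !=set0)
  (D_bounded : bounded_set D) (D_open : open D).

Lemma shape_bounded (W : shape_space m D) : exists B : R, forall x, val W x -> `|x| <= B.
Proof.
have [g ->] := set_valP W; have [M [_ HM]] := D_bounded.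
exists (diff_cost g + (M + 1)) => _ [x Dx <-].
rewrite -(subrK x (g x)) (le_trans (ler_normD _ _))// lerD//; first exact: diff_displacement.
by apply: (HM (M + 1)) => //; rewrite ltrDl.
Qed.

Lemma shape_open_set (W : shape_space m D) : open (val W).
Proof.
have [g ->] := set_valP W.
rewrite (_ : g @` D = diff_inv g @^-1` D).
  by apply: open_comp => // x _; exact: (is_Cm_continuous (diff_inv_Cm g)).
apply/seteqP; split=> [_ [x Dx <-]|x /= Dx]; first by rewrite /= diff_funK.
by exists (diff_inv g x) => //; rewrite diff_invK.
Qed.

Lemma shape_nonempty (W : shape_space m D) : val W !=set0.
Proof. by have [g ->] := set_valP W; have [x Dx] := D_nonempty; exists (g x), x. Qed.

Lemma closure_approx (w : set 'rV[R]_d) x (e : R) : closure w x -> 0 < e ->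
  exists2 y, w y & `|y - x| <= e.
Proof.
move=> cx e0; have [y [wy xy]] := cx _ (nbhsx_ballx x e e0).
by exists y => //; move: xy; rewrite -ball_normE /= distrC => /ltW.
Qed.

Lemma dense_nearly_asymmetric (e : R) : 0 < e -> dense (ball_interior (nearly_asymmetric e)).
Proof.
move=> e0 O [W OW] oO.
have [eps eps0 We] : exists2 eps : R, 0 < eps & shape_ball W eps `<=` O by exact: oO.
set w := val W.
have [B HB] := shape_bounded W.
have cK : compact (closure w).
  apply: bounded_closed_compact; last exact: closed_closure.
  exists (B + 1); split=> [|y yB x cx]; first exact: num_real.
  have [z wz zx] := closure_approx cx ltr01.
  rewrite /= (le_trans _ (ltW yB))// -(subrK z x) addrC (le_trans (ler_normD _ _))//.
  by rewrite lerD ?HB// distrC.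
(* Openness gives a ball inside the domain, and the corner simplex with edges [s / 2] fits in the
   ball of radius [s]. *)
have [Z KZ vZ] : exists2 Z, tuples (closure w) Z & vol Z != 0.
  have [p wp] := shape_nonempty W.
  have [s s0 ws] : exists2 s : R, 0 < s & ball p s `<=` w.
    by apply/nbhs_ballP; apply: open_nbhs_nbhs; split=> //; exact: shape_open_set.
  have s2 : s / 2 != 0 by rewrite mulf_neq0// gt_eqF.
  exists (col_mx p (const_mx 1 *m p + (s / 2)%:M) : 'M[R]_(1 + d, d)); last exact: vol_corner_neq0.
  move=> i; apply: subset_closure; apply: ws; rewrite -ball_normE /=.
  rewrite (@le_lt_trans _ _ (s / 2))//; last by rewrite ltr_pdivrMr// ltr_pMr// ltr1n.
  apply: mx_norm_ler => [|a k]; first by rewrite divr_ge0// ltW.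
  rewrite mxE (ord1 a) [X in _ + X]mxE [X in _ - X]mxE; case: (@split_ordP 1 d i) => i' ->.
    by rewrite (@col_mxEu _ 1 d d) (ord1 i') subrr normr0 divr_ge0// ltW.
  rewrite (@col_mxEd _ 1 d d) !mxE big_ord1 !mxE mul1r opprD addrA subrr sub0r normrN.
  by case: eqP => _; rewrite ?mulr1n ?mulr0n ?normr0 ?divr_ge0 ?(ltW s0)// ger0_norm// divr_ge0// ltW.
have [X [KX v0 Xmax Gmax [r r0 sep]]] := extremal_simplex cK (ex_intro2 _ _ Z KZ vZ).
have r2 : 0 < r / 2 by rewrite divr_gt0.
(* Radius [r / 2] serves twice: supports around different vertices of [X] are disjoint, and no
   support contains two vertices of the same maximizer. *)
have Hb a := cid (bump_exists (row a X) r2 m).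
pose b a := sval (Hb a).
have b_reg a : reg (fun _ : unit => 1) m (fun _ => b a) by have [] := svalP (Hb a).
have b01 a y : 0 <= b a y <= 1 by have [_ h _ _ _] := svalP (Hb a); exact: h.
have bx a : b a (row a X) = 1 by have [] := svalP (Hb a).
have b1 a y : b a y = 1 -> y = row a X by have [_ _ _ h _] := svalP (Hb a); exact: h.
have bsupp a y : b a y != 0 -> `|y - row a X| < r / 2 by have [_ _ _ _ h] := svalP (Hb a); exact: h.
have bdisj a c y : b a y != 0 -> b c y != 0 -> a = c.
  move=> /bsupp h1 /bsupp h2; apply/eqP/negPn/negP => ac.
  have := sep X KX erefl _ _ ac; rewrite leNgt => /negP; apply.
  rewrite -(subrKA y) (le_lt_trans (ler_normD _ _))// [r]splitr ltrD//.
  by rewrite distrC.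
have bsep Z' : tuples (closure w) Z' -> Phi Z' = Phi X -> forall a i j,
    b a (row i Z') != 0 -> b a (row j Z') != 0 -> i = j.
  move=> KZ' PZ' a i j /bsupp h1 /bsupp h2; apply/eqP/negPn/negP => ij.
  have := sep Z' KZ' PZ' _ _ ij; rewrite leNgt => /negP; apply.
  rewrite -(subrKA (row a X)) (le_lt_trans (ler_normD _ _))// [r]splitr ltrD//.
  by rewrite distrC.
have Hsh a : {tC : R * R | 0 < tC.1 /\ forall t, 0 < t <= tC.1 ->
    exists2 phi : Diff0 R d m, forall y, phi y = y + (t * b a y) *: row a (Phigrad X) &
      diff_cost phi <= tC.2 * t}.
  apply: cid; have [t0 t00 [C HC]] := shear_family (row a (Phigrad X)) hm (b_reg a) (b01 a).
  by exists (t0, C).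
pose Ct := 1 + \sum_a `|(sval (Hsh a)).2|.
have Ct0 : 0 < Ct by rewrite ltr_pwDl//; apply: sumr_ge0.
(* The first term keeps the total cost of the shears at most [eps / 2]; the second stays below the
   thresholds under which every shear is a diffeomorphism. *)
pose tm := Num.min (eps / (2 * Ct)) (\big[Num.min/1]_a (sval (Hsh a)).1).
have tm0 : 0 < tm.
  rewrite lt_min divr_gt0 ?mulr_gt0//=; apply: lt_bigmin => // a _.
  by have [] := svalP (Hsh a).
pose t (n : nat) := tm / n.+1%:R.
have t_gt0 n : 0 < t n by rewrite divr_gt0.
have t_le n : t n <= tm by rewrite ler_piMr ?invf_le1 ?ler1n// ltW.
have Hphi n a : {phi : Diff0 R d m | (forall y, phi y = y + (t n * b a y) *: row a (Phigrad X)) /\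
    diff_cost phi <= (sval (Hsh a)).2 * t n}.
  apply: cid; have [_ h] := svalP (Hsh a).
  have [|phi p1 p2] := h (t n); last by exists phi.
  rewrite t_gt0 (le_trans (t_le n))// /tm ge_min; apply/orP; right.
  exact: bigmin_le_cond.
pose phi n a := sval (Hphi n a).
have phiE n a y : phi n a y = y + (t n * b a y) *: row a (Phigrad X).
  by have [h _] := svalP (Hphi n a); exact: h.
pose fs n := [seq phi n a | a <- enum 'I_d.+1].
have cost n : \sum_(f <- fs n) diff_cost f < eps.
  have -> : \sum_(f <- fs n) diff_cost f = \sum_a diff_cost (phi n a) by rewrite big_map big_enum.
  apply: (@le_lt_trans _ _ (Ct * tm)).
    rewrite /Ct mulrDl mul1r ler_wpDl ?(ltW tm0)// mulr_suml; apply: ler_sum => a _.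
    have [_ h] := svalP (Hphi n a); rewrite (le_trans h)//.
    apply: (@le_trans _ _ (`|(sval (Hsh a)).2| * t n)); first by rewrite ler_wpM2r ?ler_norm// ltW.
    by rewrite ler_wpM2l.
  apply: (@le_lt_trans _ _ (Ct * (eps / (2 * Ct)))).
    by rewrite ler_wpM2l ?(ltW Ct0)// /tm ge_min lexx.
  have -> : Ct * (eps / (2 * Ct)) = eps / 2 by field; rewrite gt_eqF.
  by lra.
have [g gE] := set_valP W.
have oW n : orbit_shapes m D (compose_diffs (fs n) @` w).
  have [h hE] := compose_diffs_Diff0 (fs n) g; exists h.
  by rewrite hE /w gE image_comp.
pose Wn n : shape_space m D := SigSub (mem_set (oW n)).
have valWn n : val (Wn n) = compose_diffs (fs n) @` w by [].
have OWn n : O (Wn n).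
  apply: We; rewrite /shape_ball /=; apply: le_lt_trans (cost n).
  by apply: courant_dist_le => //; rewrite size_map size_enum_ord.
(* Either some perturbed domain is as desired, or all of them fail, and the failures yield a
   sequence to which the limit argument applies. *)
have [[n Vn]|noV] := pselect (exists n, ball_interior (nearly_asymmetric e) (Wn n)).
  by exists (Wn n).
exfalso.
have HF n : {FAc : ('rV[R]_d -> 'rV[R]_d) * 'M[R]_d * 'rV[R]_d |
    [/\ forall x, `|FAc.1.1 x - x| <= t n ^+ 2, FAc.1.2 *m FAc.1.2^T = 1%:M,
      (fun x => x *m FAc.1.2 + FAc.2) @` (FAc.1.1 @` val (Wn n)) = FAc.1.1 @` val (Wn n) &
      ~ (`|FAc.1.2 - 1%:M| < e /\ `|FAc.2| < e)]}.
  apply: cid.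
  have bad (W' : shape_space m D) : ~ nearly_asymmetric e W' ->
      exists Ac : 'M[R]_d * 'rV[R]_d, [/\ Ac.1 *m Ac.1^T = 1%:M,
        (fun x => x *m Ac.1 + Ac.2) @` val W' = val W' &
        ~ (`|Ac.1 - 1%:M| < e /\ `|Ac.2| < e)].
    move=> nW'; apply: contrapT => H; apply: nW' => A c AA sW.
    by apply: contrapT => h; apply: H; exists (A, c).
  have tn2 : 0 < t n ^+ 2 by rewrite exprn_gt0.
  (* Failure has two forms: [Wn n] itself has a symmetry far from the identity, and the extra map is
     [id]; or a domain within [t n ^ 2] of it does, and the extra map carries [Wn n] onto that
     domain. *)
  have [VW|nVW] := pselect (nearly_asymmetric e (Wn n)); last first.
    have [[A c] /= [AA sW h]] := bad _ nVW; exists (id, A, c); split=> //=.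
      by move=> x; rewrite subrr normr0 ltW.
    by rewrite image_id.
  have [W' WW' nW'] : exists2 W', shape_ball (Wn n) (t n ^+ 2) W' & ~ nearly_asymmetric e W'.
    apply: contrapT => H; apply: noV; exists n; split=> //; exists (t n ^+ 2) => // W' WW'.
    by apply: contrapT => h; apply: H; exists W'.
  have [gs [_ gsE gscost]] := courant_dist_lt (set_valP (Wn n)) (set_valP W') WW'.
  have [[A c] /= [AA sW h]] := bad _ nW'.
  exists (compose_diffs gs, A, c); split=> //=.
    by move=> x; rewrite (le_trans (compose_diffs_displacement _ _))// ltW.
  by rewrite [compose_diffs gs @` _]gsE.
pose F' n := (sval (HF n)).1.1; pose A n := (sval (HF n)).1.2; pose c n := (sval (HF n)).2.
have F't n x : `|F' n x - x| <= t n ^+ 2 by have [h _ _ _] := svalP (HF n); exact: h.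
have AA n : A n *m (A n)^T = 1%:M by have [] := svalP (HF n).
have AcN n : ~ (`|A n - 1%:M| < e /\ `|c n| < e) by have [] := svalP (HF n).
pose F n := F' n \o compose_diffs (fs n).
have sym n : (fun x => x *m A n + c n) @` (F n @` w) = F n @` w.
  by rewrite /F -[(F' n \o _) @` _]image_comp; have [_ _ h _] := svalP (HF n); exact: h.
have [U UU sU] := ultra_nat.
have t_cvg0 : t @ U --> 0.
  have h : t @ \oo --> tm * 0 by apply: cvgM; [exact: cvg_cst|exact: cvg_harmonic].
  rewrite mulr0 in h; apply: cvg_trans h; exact: cvg_app.
have F_bounded n : exists C : R, forall x, `|F n x - x| <= C.
  exists (t n ^+ 2 + \sum_(f <- fs n) diff_cost f) => x.
  rewrite -(subrKA (compose_diffs (fs n) x)) (le_trans (ler_normD _ _))// lerD//.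
    exact: F't.
  exact: compose_diffs_displacement.
have cb a : continuous (b a) by exact: (reg_continuous (t := tt) (b_reg a)).
have t_neq0 n : t n != 0 by rewrite gt_eqF.
have F_disp (y : nat -> 'rV[R]_d) (p : 'rV[R]_d) : y @ U --> p ->
    (fun n => (t n)^-1 *: (F n (y n) - y n)) @ U --> \sum_a b a p *: row a (Phigrad X).
  move=> hy; have h1 := shears_displacement (l := enum 'I_d.+1) cb t_neq0 t_cvg0 phiE hy.
  have h2 : (fun n => (t n)^-1 *: (F' n (compose_diffs (fs n) (y n)) - compose_diffs (fs n) (y n)))
      @ U --> (0 : 'rV[R]_d).
    apply/cvgrPdist_le => e1 e10; move/cvgrPdist_le: t_cvg0 => /(_ _ e10).
    apply: filterS => n; rewrite !sub0r !normrN gtr0_norm// => te.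
    rewrite normrZ normfV gtr0_norm// ler_pdivrMl// (le_trans (F't n _))// expr2.
    by rewrite ler_wpM2l// ltW.
  (* The extra map contributes at most [t n ^ 2 / t n], which tends to 0, so only the shears count
     in the limit. *)
  rewrite (_ : (fun n => _) = fun n =>
      (t n)^-1 *: (F' n (compose_diffs (fs n) (y n)) - compose_diffs (fs n) (y n)) +
      (t n)^-1 *: (compose_diffs (fs n) (y n) - y n)); last first.
    by apply/funext => n; rewrite -scalerDr subrKA.
  rewrite -[X in _ --> X]add0r; apply: cvgD => //.
  by move: h1; rewrite big_enum; apply; exact: filter_filter.
have [hA hc] := @symmetries_cvg_id R d w (closure w) X b hd (shape_nonempty W)
  (ex_intro _ B HB) cK (@subset_closure _ w)
  (fun x cx e1 e10 => closure_approx cx e10) KX v0 Xmax Gmax b01 bx b1 bdisj bsep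
  U t F UU t_gt0 t_cvg0 F_bounded F_disp A c AA sym.
have : \forall n \near U, `|A n - 1%:M| < e /\ `|c n| < e.
  near=> n; split.
    by rewrite distrC; near: n; move/cvgrPdist_lt: hA => /(_ _ e0).
  by rewrite -[c n]subr0 distrC; near: n; move/cvgrPdist_lt: hc => /(_ _ e0).
by move=> /filter_ex[n]; exact: AcN.
Unshelve. all: by end_near. Qed.

End asymmetry.

Unset Implicit Arguments.

Theorem theorem1p2 (R : realType) (d m : nat) (hd : (2 <= d)%N)
    (hm : (3 <= m)%N) (D : set 'rV[R]_d) (D_nonempty : D !=set0)
    (D_bounded : bounded_set D) (D_connected : connected D) (D_open : open D)
    (D_Cm : Cm_domain m D) :
  residual [set W : shape_space m D | Iso (val W) = [set id]].
Proof.
have m0 : (0 < m)%N by rewrite (leq_trans _ hm).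
exists (fun n => ball_interior (@nearly_asymmetric R d m D n.+1%:R^-1)); split=> [n|].
  split; first exact: open_ball_interior.
  by apply: dense_nearly_asymmetric => //; rewrite invr_gt0.
by move=> W HW; apply: nearly_asymmetric_Iso => n; have [] := HW n I.
Qed.
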